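(* Let $\alpha<0$, let $B$ be a measure on $]0,1[$ with $\int_0^1 y(1-y)B(dy)<\infty$ and $B(]0,1[)>0$, let $\mu_0$ be a measure on $]0,\infty[$ with $\int_0^\infty x\mu_0(dx)=1$ whose support is bounded with supremum equal to $1$, and let $(\mu_t,t\ge0)$ be the unique solution of the fragmentation equation with parameters $(\alpha,B)$ starting from $\mu_0$. Let $m(t)=\int_0^\infty x\,\mu_t(dx)$ and $\phi(t)=\int_0^1(1-x^t)\,x\,B(dx)$, $t\ge 0$. For all $\lambda<\phi(\infty):=\lim_{x\to\infty}\phi(x)$ there exists a constant $C_\lambda<\infty$ such that $m(t)\le C_\lambda\exp(-\lambda t)$ for all $t\ge0$. More precisely, if the function $u\in\,]0,1[\,\mapsto\int_0^{1-u}x\,B(dx)$ varies regularly at $0$ with index $-\beta\in\,]-1,0]$, then $$-\ln(m(t))\sim\frac{1-\beta}{|\alpha|}\,\varphi(|\alpha|t)\qquad\text{as }t\to\infty ,$$ where $\varphi$ is the inverse function of $t\mapsto t/\phi(t)$ (well defined in a neighborhood of $\infty$). In particular, $t\mapsto-\ln(m(t))$ is regularly varying at $\infty$ with index $1/(1-\beta)$.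
   Context: A solution of the fragmentation equation with parameters $(\alpha,B)$ starting from $\mu_0$ is any family of measures $(\mu_t,t\ge0)$ on $]0,\infty[$, equal to $\mu_0$ at $t=0$, such that: (a) for every real-valued continuously differentiable function $f$ on $]0,\infty[$ with compact support, $\partial_t\int f\,d\mu_t=\int_0^\infty x^\alpha\big(\int_0^1(f(yx)-f(x)y)B(dy)\big)\mu_t(dx)$; (b) $\int_0^\infty x\,\mu_t(dx)\le\int_0^\infty x\,\mu_0(dx)=1$ for all $t\ge0$; (c) if $\mu_0([M,\infty[)=0$ for some $M>0$, then $\mu_t([M,\infty[)=0$ for all $t\ge 0$. When $\alpha<0$ and $\mu_0$ has bounded support, such a solution exists and is unique. The supremum of the support of $\mu_0$ is the real $s$ such that $\mu_0(]s,\infty[)=0$ and $\mu_0(]s-\varepsilon,s])>0$ for all $0<\varepsilon<s$. The function $t\mapsto t/\phi(t)$ is continuous and strictly increasing on $]0,\infty[$ and tends to $\infty$ at $\infty$. *)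

(* Defs.v *)
From HB Require Import structures.
From mathcomp Require Import all_boot all_order all_algebra.
From mathcomp Require Import all_classical all_reals all_analysis.
Set Implicit Arguments.
Unset Strict Implicit.
Unset Printing Implicit Defensive.
Import Order.TTheory GRing.Theory Num.Theory.
Import numFieldNormedType.Exports.

Local Open Scope classical_set_scope.
Local Open Scope ring_scope.

(* Measures on an interval D are represented as Borel measures on R that do
   not charge the complement of D; integrals are still restricted to D so that
   values of integrands outside D never matter. *)
Definition borel_measure (R : realType) : Type :=
  {measure set (measurableTypeR R) -> \bar R}.

Definition measure_on (R : realType) (D : set R) (mu : borel_measure R) : Prop :=
  mu (~` D) = 0%E.

(* A C^1 function on ]0, oo[ with compact support extends by 0 to a C^1
   function on R supported in some [a, b] with 0 < a; we quantify over these
   extensions. *)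
Definition test_function (R : realType) (f : R -> R) : Prop :=
  [/\ forall x, derivable f x 1,
      continuous (derive1 f) &
      exists a b : R, 0 < a /\ forall x, x \notin `[a, b] -> f x = 0].

(* Derivative at t >= 0 of a function on [0, oo[; one-sided at t = 0. *)
Definition has_derivative_nonneg (R : realType) (F : R -> R) (t l : R) : Prop :=
  (F s - F t) / (s - t) @[s --> within [set s | 0 <= s] t^'] --> l.

(* All real-valued integrals below are integrals of integrable functions when
   \int y (1 - y) B(dy) and \int x mu_t(dx) are finite: for fixed x > 0,
   f (y x) - f x * y is O(y (1 - y)), and the outer integrand is O(x). *)
Definition fragmentation_solution (R : realType) (alpha : R)
    (B mu0 : borel_measure R) (mu : R -> borel_measure R) : Prop :=
  [/\ (forall t, 0 <= t -> measure_on `]0, +oo[ (mu t)) /\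
      (forall A : set R, measurable A -> mu 0 A = mu0 A),
      forall f, test_function f -> forall t, 0 <= t ->
        has_derivative_nonneg
          (fun s => \int[mu s]_(x in `]0, +oo[) f x) t
          (\int[mu t]_(x in `]0, +oo[)
             (x `^ alpha * \int[B]_(y in `]0, 1[) (f (y * x) - f x * y))),
      forall t, 0 <= t ->
        (\int[mu t]_(x in `]0%R, +oo[) x%:E <=
           \int[mu0]_(x in `]0%R, +oo[) x%:E)%E /\
        (\int[mu0]_(x in `]0%R, +oo[) x%:E)%E = 1%E &
      forall M : R, 0 < M -> mu0 `[M, +oo[%classic = 0%E ->
        forall t, 0 <= t -> mu t `[M, +oo[%classic = 0%E].

Definition support_sup (R : realType) (mu : borel_measure R) (s : R) : Prop :=
  mu `]s, +oo[%classic = 0%E /\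
  forall eps : R, 0 < eps < s -> (0 < mu `](s - eps)%R, s]%classic)%E.

(* Real-valued: for a solution the integral is at most 1. *)
Definition total_mass (R : realType) (mu : R -> borel_measure R) (t : R) : R :=
  \int[mu t]_(x in `]0, +oo[) x.

Definition frag_phi (R : realType) (B : borel_measure R) (t : R) : R :=
  \int[B]_(x in `]0, 1[) ((1 - x `^ t) * x).

(* phi is real-valued and nondecreasing on [0, oo[, and its limit may be +oo. *)
Definition frag_phi_infty (R : realType) (B : borel_measure R) : \bar R :=
  lim ((frag_phi B x)%:E @[x --> +oo]).

(* The endpoint 1 - u is included; excluding it gives the same regular
   variation at 0 since the function is monotone in u. *)
Definition size_tail (R : realType) (B : borel_measure R) (u : R) : R :=
  \int[B]_(x in `]0, (1 - u)]) x.

(* As usual, regular variation includes positivity and measurability near the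
   point at which it is considered. *)
Definition regularly_varying_at0 (R : realType) (f : R -> R) (rho : R) : Prop :=
  (exists d : R, [/\ 0 < d, measurable_fun `]0, d[ f &
     forall x, 0 < x < d -> 0 < f x]) /\
  forall c : R, 0 < c -> f (c * x) / f x @[x --> 0^'+] --> c `^ rho.

Definition regularly_varying_at_infty (R : realType) (f : R -> R) (rho : R)
    : Prop :=
  (exists A : R, measurable_fun `]A, +oo[ f /\ forall x, A < x -> 0 < f x) /\
  forall c : R, 0 < c -> f (c * x) / f x @[x --> +oo] --> c `^ rho.

(* When g is continuous, strictly increasing and tends to +oo, as t / phi(t) is
   on ]0, oo[, this determines h on a neighbourhood of +oo. *)
Definition inverse_near_infty (R : realType) (g h : R -> R) : Prop :=
  (\forall t \near +oo, h (g t) = t) /\ (\forall s \near +oo, g (h s) = s).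

(* The library has no canonical [filter_on] for the filter at +oo, which its
   asymptotic equivalence [f ~_F g] (that is, f = g + o(g) along F) needs. *)
Definition at_infty (R : realType) : filter_on R :=
  FilterType (pinfty_nbhs R) _.

(* Main.v *)
(* Let a = |alpha| and M_s(t) = int x^(1+s) mu_t(dx), so that m = M_0.

   Testing the equation with regularisations of x^(1+s) gives, formally,
   M_s' = - phi(s) M_(s-a). To make this rigorous, one first tests it with
   C^1 functions x psi(x), psi nondecreasing, to get that int x psi(x) mu_t(dx)
   is nonincreasing in t; hence M_s(T) - M_s(t) lies between
   (t - T) phi(s) M_(s-a)(t) and (t - T) phi(s) M_(s-a)(T) for s >= a, T <= t.

   With s = k a this makes M_s decay at least as exp(-phi(ka) t), and m(t) is at
   most a constant times M_(ka)(t - 1), whence the exponential bound.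

   The normalised moments J_k = M_(ka) / (phi(a) ... phi(ka)) satisfy
   J_(k+1)' = - J_k, J_0 = m, so that k! J_k(0) is formally the k-th moment of a
   variable I of tail P(I > t) = m(t). As M_(ka)(0) = exp(o(k)), Markov's
   inequality at the k with g(ka) = a t, for g(x) = x / phi(x), bounds m(t)
   above, and a truncation of the k-th moment at levels T < S bounds it below.
   Both give - ln m(t) ~ sum_(i <= k) ln (g(ka) / g(ia)) ~ (1 - beta) k, since g
   is regularly varying of index 1 - beta: this follows from the hypothesis on B
   by an Abelian argument for phi, and from Potter's bounds. *)
From HB Require Import structures.
From mathcomp Require Import all_boot all_order all_algebra.
From mathcomp Require Import all_classical all_reals all_analysis.
From mathcomp Require Import measurable_realfun ring lra.
Require Import Defs.
Set Implicit Arguments.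
Unset Strict Implicit.
Unset Printing Implicit Defensive.
Import Order.TTheory GRing.Theory Num.Theory.
Import numFieldNormedType.Exports.
Local Open Scope classical_set_scope.
Local Open Scope ring_scope.

(** * Chains of moments *)

(** The increment bounds on moments come from limits of regularised test functions, and such limits
    preserve inequalities, not derivatives; continuity of the mass in time is never established. The
    whole analysis therefore rests on the two-sided bounds of a [chain]. The variable [I] is not
    built: integration in time is replaced by telescoping over grids, and tail integrals by the
    finite sums [G].

    The truncation argument works because, up to the factors [M_(ka)(0)], consecutive moments of
    [a I] have ratio about [g(ka)], and [g] changes by a factor at most [1 + d] between [ka] and
    [(1 + d)ka]. So the [k]-th moment concentrates near [g(ka) / a]: comparison with the moments of
    order [k - n] and [k + n], [n] about [d k], shows that the parts outside [exp(-e) g(ka) / a] and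
    [exp(e) g(ka) / a] are exponentially small. The charge of [mu0] near 1 makes [M_(ka)(0)] decay
    too slowly to cancel this gain. *)

Lemma le0_of_natmul_le (R : realType) (d C : R) :
  (forall n, d * n.+1%:R <= C) -> d <= 0.
Proof.
move=> H; rewrite leNgt; apply/negP => d0.
have /andP[_] := truncn_itv (divr_ge0 (normr_ge0 C) (ltW d0)).
rewrite ltr_pdivrMr // mulrC ltNge (le_trans (H _)) //.
exact: ler_norm.
Qed.

(* The bound on one step is summed over a uniform grid: the right-hand sides
   telescope up to a factor equal to the mesh. *)
Lemma le_of_grid (R : realType) (F q : R -> R) (T t : R) : T <= t ->
  (forall r r', T <= r -> r <= r' -> r' <= t ->
     F r - F r' <= (r' - r) * (q r - q r')) ->
  F T <= F t.
Proof.
move=> Tt H; rewrite -subr_le0.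
apply: (@le0_of_natmul_le _ _ ((t - T) * (q T - q t))) => n.
pose d := (t - T) / n.+1%:R.
have d0 : 0 <= d by rewrite divr_ge0 // subr_ge0.
have dn : d * n.+1%:R = t - T by rewrite /d divfK // pnatr_eq0.
pose x i := T + d * i%:R.
have xS i : x i.+1 - x i = d by rewrite /x -natr1; ring.
have x0 : x 0%N = T by rewrite /x mulr0 addr0.
have xn : x n.+1 = t by rewrite /x dn addrC subrK.
have step i : (i < n.+1)%N -> F (x i) - F (x i.+1) <= d * (q (x i) - q (x i.+1)).
  move=> iN; rewrite -(xS i); apply: H.
  - by rewrite /x lerDl mulr_ge0.
  - by rewrite -subr_ge0 xS.
  - by rewrite -xn /x lerD2l ler_wpM2l // ler_nat.
have tel (f : R -> R) : \sum_(i < n.+1) (f (x i) - f (x i.+1)) = f T - f t.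
  rewrite -(big_mkord predT (fun i => f (x i) - f (x i.+1))).
  have := telescope_sumr (fun i => - f (x i)) (leq0n n.+1).
  rewrite x0 xn opprK => e; rewrite [RHS]addrC -e.
  by apply: eq_bigr => i _; rewrite opprK addrC.
have -> : (t - T) * (q T - q t) = d * (q T - q t) * n.+1%:R by rewrite -dn; ring.
rewrite ler_wpM2r // -(tel F) -(tel q) mulr_sumr.
by apply: ler_sum => i _; apply: step.
Qed.

(** The polynomials with [p_(k+1)' = p_k] and [p_k(0) = b k]. At [t - r] with [b i = J i t], this is
    the expansion of [J k r] backwards from [t]. *)
Definition taylor (R : realType) (b : nat -> R) (k : nat) (x : R) : R :=
  \sum_(j < k.+1) x ^+ j / j`!%:R * b (k - j)%N.

Lemma taylor_0 (R : realType) (b : nat -> R) (k : nat) : taylor b k 0 = b k.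
Proof.
rewrite /taylor big_ord_recl /= expr0 fact0 divr1 mul1r subn0 big1 ?addr0 // => i _.
by rewrite expr0n /= !mul0r.
Qed.

Lemma taylor_r0 (R : realType) (b : nat -> R) (x : R) : taylor b 0 x = b 0%N.
Proof. by rewrite /taylor big_ord1 expr0 fact0 divr1 mul1r. Qed.

Lemma pow_sub_itv (R : realType) (k : nat) (x y : R) : 0 <= x -> x <= y ->
  (y - x) * (k.+1%:R * x ^+ k) <= y ^+ k.+1 - x ^+ k.+1 <=
  (y - x) * (k.+1%:R * y ^+ k).
Proof.
move=> x0 xy; have y0 := le_trans x0 xy.
have yx0 : 0 <= y - x by rewrite subr_ge0.
rewrite subrXX; apply/andP; split; apply: ler_wpM2l => //.
- rewrite mulr_natl -[in leLHS](card_ord k.+1) -sumr_const.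
  apply: ler_sum => i _.
  have /subnKC {1}<- : (i <= k)%N by rewrite -ltnS.
  by rewrite exprD mulrC -subSS subnS /= ler_wpM2r ?exprn_ge0 ?lerXn2r ?nnegrE.
- rewrite mulr_natl -[in leRHS](card_ord k.+1) -sumr_const.
  apply: ler_sum => i _.
  have /subnKC e : (i <= k)%N by rewrite -ltnS.
  have -> : y ^+ k = y ^+ (i + (k - i)) by rewrite e.
  rewrite exprD [leRHS]mulrC -subSS subnS /=.
  by rewrite ler_wpM2l ?exprn_ge0 ?lerXn2r ?nnegrE.
Qed.

(** Integrated form of [p_(k+1)' = p_k]: with nonnegative coefficients [p_k] is nondecreasing on the
    positive axis, so the increment lies between the end slopes. It has the shape of [chain_incr],
    to be set against it. *)
Lemma taylor_incr (R : realType) (b : nat -> R) (k : nat) (x y : R) :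
  (forall i, 0 <= b i) -> 0 <= x -> x <= y ->
  (y - x) * taylor b k x <= taylor b k.+1 y - taylor b k.+1 x <=
  (y - x) * taylor b k y.
Proof.
move=> b0 x0 xy.
have -> : taylor b k.+1 y - taylor b k.+1 x = \sum_(j < k.+1)
    (y ^+ j.+1 / j.+1`!%:R * b (k - j)%N - x ^+ j.+1 / j.+1`!%:R * b (k - j)%N).
  rewrite /taylor !(big_ord_recl k.+1) /= !expr0 opprD addrACA subrr add0r -sumrB.
  by apply: eq_bigr => j _; rewrite /bump /= !add1n subSS.
have fE (j : nat) : j.+1`!%:R = j.+1%:R * j`!%:R :> R by rewrite factS natrM.
have f0 (j : nat) : 0 < j`!%:R :> R by rewrite ltr0n fact_gt0.
have s0 (j : nat) : 0 < j.+1%:R :> R by rewrite ltr0n.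
have E (j : nat) (c : R) : 
    (y ^+ j.+1 / j.+1`!%:R * c - x ^+ j.+1 / j.+1`!%:R * c) =
    (y ^+ j.+1 - x ^+ j.+1) * (c / j.+1`!%:R) by ring.
have E2 (j : nat) (c z : R) : (y - x) * (z ^+ j / j`!%:R * c) =
    (y - x) * (j.+1%:R * z ^+ j) * (c / j.+1`!%:R).
  rewrite fE; move: (s0 j) (f0 j); move: (j.+1%:R) (j`!%:R) => N f N0 F0.
  by field; rewrite (gt_eqF N0) (gt_eqF F0).
rewrite /taylor !mulr_sumr; apply/andP; split; apply: ler_sum => i _;
  rewrite E E2 ler_wpM2r ?divr_ge0 //;
  by have /andP[] := pow_sub_itv i x0 xy.
Qed.

(** Both sides are the coefficient of degree [k] in [e^(xX) e^(yX) B(X)], with [B] the generating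
    polynomial of [b]; truncating the series at degree [k] does not affect it. *)
Lemma taylor_conv (R : realType) (b : nat -> R) (k : nat) (x y : R) :
  \sum_(j < k.+1) x ^+ j / j`!%:R * taylor b (k - j) y = taylor b k (x + y).
Proof.
pose e (z : R) := \poly_(j < k.+1) (z ^+ j / j`!%:R).
pose B := \poly_(j < k.+1) b j.
have ecoef z i : (i <= k)%N -> (e z)`_i = z ^+ i / i`!%:R.
  by move=> ik; rewrite coef_poly ltnS ik.
have tE i z : (i <= k)%N -> taylor b i z = (e z * B)`_i.
  move=> ik; rewrite coefM /taylor; apply: eq_bigr => j _.
  have ji : (j <= i)%N by rewrite -ltnS.
  rewrite ecoef ?(leq_trans ji) // coef_poly ltnS.
  by rewrite (leq_trans (leq_subr _ _) ik).
have eD i : (i <= k)%N -> (e x * e y)`_i = (e (x + y))`_i.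
  move=> ik; rewrite coefM ecoef // addrC exprDn mulr_suml; apply: eq_bigr => j _.
  have ji : (j <= i)%N by rewrite -ltnS.
  rewrite !ecoef ?(leq_trans ji) ?(leq_trans (leq_subr _ _) ik) //.
  have f0 (n : nat) : n`!%:R != 0 :> R by rewrite pnatr_eq0 -lt0n fact_gt0.
  have -> : i`!%:R = 'C(i, j)%:R * j`!%:R * (i - j)`!%:R :> R.
    by rewrite -!natrM -mulnA bin_fact.
  have c0 : 'C(i, j)%:R != 0 :> R by rewrite pnatr_eq0 -lt0n bin_gt0.
  by rewrite -mulr_natr; field; rewrite c0 !f0.
transitivity ((e x * (e y * B))`_k).
  rewrite coefM; apply: eq_bigr => j _.
  have jk : (j <= k)%N by rewrite -ltnS.
  by rewrite ecoef // tE // leq_subr.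
rewrite mulrA tE // !coefM; apply: eq_bigr => j _.
by rewrite eD // -ltnS.
Qed.

(* J k = M_{k|alpha|} / (phi(|alpha|) ... phi(k|alpha|)), where
   M_s(t) = int x^(1+s) mu_t(dx), is such a chain: formally J k.+1' = - J k. *)
Record chain (R : realType) (J : nat -> R -> R) : Prop := Chain {
  chain_ge0 : forall k t, 0 <= t -> 0 <= J k t;
  chain_le : forall k T t, 0 <= T -> T <= t -> J k t <= J k T;
  chain_incr : forall k T t, 0 <= T -> T <= t ->
    (t - T) * J k t <= J k.+1 T - J k.+1 t <= (t - T) * J k T }.

Section ChainTheory.
Context (R : realType) (J : nat -> R -> R) (cJ : chain J).

(** Taylor's formula at [t] has as remainder a [k]-fold integral of [J 0 - J 0 t], nonnegative
    before [t]. Without integrals: the difference of the two sides vanishes at [t], and the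
    induction hypothesis gives its monotonicity through [le_of_grid]. *)
Lemma chain_taylor_ge (k : nat) (r t : R) : 0 <= r -> r <= t ->
  taylor (J ^~ t) k (t - r) <= J k r.
Proof.
move=> r0 rt; have t0 := le_trans r0 rt.
have b0 i : 0 <= J i t by apply: chain_ge0.
suff H : forall x, 0 <= x -> x <= t -> taylor (J ^~ t) k (t - x) <= J k x by apply: H.
elim: k => [|k IH] x x0 xt; first by rewrite taylor_r0 chain_le.
rewrite -subr_ge0 -oppr_le0 opprB.
have -> : 0 = taylor (J ^~ t) k.+1 (t - t) - J k.+1 t.
  by rewrite subrr taylor_0 subrr.
apply: (@le_of_grid _ (fun u => taylor (J ^~ t) k.+1 (t - u) - J k.+1 u)
  (fun u => taylor (J ^~ t) k (t - u)) _ _ xt) => u v xu uv vt.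
have u0 := le_trans x0 xu; have v0 := le_trans u0 uv.
have tv0 : 0 <= t - v by rewrite subr_ge0.
have tuv : t - v <= t - u by rewrite lerD2l lerN2.
have /andP[_] := taylor_incr k b0 tv0 tuv.
have /andP[+ _] := chain_incr cJ k u0 uv.
have := IH v v0 vt.
have vu0 : 0 <= v - u by rewrite subr_ge0.
move=> /(ler_wpM2l vu0) h1 h2.
have -> : t - u - (t - v) = v - u by ring.
move=> h3; rewrite mulrBr; lra.
Qed.

(** Same remainder, bounded by replacing [J 0] on [[T, t]] by a constant above its largest value
    [J 0 T]. *)
Lemma chain_taylor_le (k : nat) (T t c : R) : 0 <= T -> T <= t -> J 0%N T <= c ->
  J k T <= taylor (fun i => if i is 0%N then c else J i t) k (t - T).
Proof.
move=> T0 Tt Tc; have t0 := le_trans T0 Tt.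
set b := fun i => _.
have c0 : 0 <= c by apply: le_trans Tc; apply: chain_ge0.
have b0 i : 0 <= b i by case: i => [|i] //=; apply: chain_ge0.
suff H : forall x, T <= x -> x <= t -> J k x <= taylor b k (t - x) by apply: H.
elim: k => [|k IH] x Tx xt.
  by rewrite taylor_r0 (le_trans _ Tc)// chain_le.
rewrite -subr_le0.
have -> : 0 = J k.+1 t - taylor b k.+1 (t - t) by rewrite subrr taylor_0 subrr.
apply: (@le_of_grid _ (fun u => J k.+1 u - taylor b k.+1 (t - u))
  (fun u => taylor b k (t - u)) _ _ xt) => u v xu uv vt.
have Tu := le_trans Tx xu; have u0 := le_trans T0 Tu.
have tv0 : 0 <= t - v by rewrite subr_ge0.
have tuv : t - v <= t - u by rewrite lerD2l lerN2.
have /andP[+ _] := taylor_incr k b0 tv0 tuv.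
have /andP[_ +] := chain_incr cJ k u0 uv.
have := IH u Tu (le_trans uv vt).
have vu0 : 0 <= v - u by rewrite subr_ge0.
move=> /(ler_wpM2l vu0) h1 h2.
have -> : t - u - (t - v) = v - u by ring.
move=> h3; rewrite mulrBr; lra.
Qed.

(** Keeps only the term of degree [k] in the expansion. For the formal variable [I] this is Markov's
    inequality for the [k]-th power of the positive part of [I - r]. *)
Lemma chain_pow_le (k : nat) (r t : R) : 0 <= r -> r <= t ->
  (t - r) ^+ k * J 0%N t <= k`!%:R * J k r.
Proof.
move=> r0 rt; have := chain_taylor_ge k r0 rt.
rewrite /taylor big_ord_recr /= subnn => H.
have f0 : 0 < k`!%:R :> R by rewrite ltr0n fact_gt0.
rewrite -ler_pdivrMl // (le_trans _ H) // mulrA [k`!%:R^-1 * _]mulrC lerDr.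
apply: sumr_ge0 => i _.
by rewrite mulr_ge0 ?divr_ge0 ?exprn_ge0 ?subr_ge0 //; apply: chain_ge0; rewrite ?(le_trans r0).
Qed.

(* G k t stands for int_t^oo r^(k-1) / (k-1)! J 0 r dr. *)
Let G (k : nat) (t : R) : R := \sum_(j < k) t ^+ j / j`!%:R * J (k - j) t.

(** An increment of [G k] is formally the integral of [r^(k-1) / (k-1)!] times the nonincreasing
    [J 0]. Each [J (k - j) T] is expanded from [t] by the two Taylor bounds, and [taylor_conv]
    recombines the expansions at [T + (t - T)]. *)
Let G_incr (k : nat) (T t : R) : 0 <= T -> T <= t ->
  J 0%N t * (t ^+ k - T ^+ k) <= k`!%:R * (G k T - G k t) <=
  J 0%N T * (t ^+ k - T ^+ k).
Proof.
move=> T0 Tt; have t0 := le_trans T0 Tt.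
have f0 : 0 < k`!%:R :> R by rewrite ltr0n fact_gt0.
have GE x : \sum_(j < k.+1) x ^+ j / j`!%:R * J (k - j) x =
    G k x + x ^+ k / k`!%:R * J 0%N x.
  by rewrite big_ord_recr /= subnn.
have TtE : T + (t - T) = t by ring.
pose b i := if i is 0%N then J 0%N T else J i t.
have GbE : taylor b k t = G k t + t ^+ k / k`!%:R * J 0%N T.
  rewrite /taylor big_ord_recr /= subnn; congr (_ + _).
  apply: eq_bigr => j _; rewrite /b.
  by have := ltn_ord j; rewrite -subn_gt0; case: (k - j)%N.
have f1 (x y : R) : k`!%:R * (x ^+ k / k`!%:R * y) = y * x ^+ k.
  by field; rewrite gt_eqF.
have hcoef j : 0 <= T ^+ j / j`!%:R by rewrite divr_ge0 ?exprn_ge0.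
apply/andP; split.
- have : G k t + t ^+ k / k`!%:R * J 0%N t <= G k T + T ^+ k / k`!%:R * J 0%N t.
    rewrite -GE.
    have -> : \sum_(j < k.+1) t ^+ j / j`!%:R * J (k - j) t =
      taylor (J ^~ t) k (T + (t - T)) by rewrite TtE.
    rewrite -taylor_conv big_ord_recr /= subnn taylor_r0 lerD2r.
    by apply: ler_sum => j _; rewrite ler_wpM2l // chain_taylor_ge.
  rewrite -(ler_pM2l f0) !mulrDr !f1; lra.
- have : G k T + T ^+ k / k`!%:R * J 0%N T <= taylor b k t.
    rewrite -GE -[in leRHS]TtE -taylor_conv; apply: ler_sum => j _.
    by rewrite ler_wpM2l // chain_taylor_le.
  rewrite GbE -(ler_pM2l f0) !mulrDr !f1; lra.
Qed.

Let G_ge0 (k : nat) (t : R) : 0 <= t -> 0 <= G k t.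
Proof.
move=> t0; apply: sumr_ge0 => i _.
by rewrite mulr_ge0 ?divr_ge0 ?exprn_ge0 //; apply: (chain_ge0 cJ).
Qed.

Let G_0 (k : nat) : (0 < k)%N -> G k 0 = J k 0.
Proof.
case: k => // k _; rewrite /G big_ord_recl /= expr0 fact0 divr1 mul1r subn0.
by rewrite big1 ?addr0 // => i _; rewrite expr0n /= !mul0r.
Qed.

(** Formally [k! G k S] is the expectation of the positive part of [I^k - S^k], and [S^l] times that
    is at most the expectation of [I^(k+l)]. On the sums, the last [k] terms of [G (k + l) S]
    dominate those of [G k S] one by one. *)
Let G_tail (k l : nat) (S : R) : (0 < k)%N -> 0 <= S ->
  S ^+ l * (k`!%:R * G k S) <= (k + l)`!%:R * J (k + l)%N 0.
Proof.
move=> k0 S0.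
have /andP[+ _] := G_incr (k + l) (lexx 0) S0.
have J0 := chain_ge0 cJ 0 S0.
have kl0 : (0 < k + l)%N by rewrite ltn_addr.
rewrite -(G_0 kl0) mulrBr.
have -> : 0 ^+ (k + l) = 0 :> R by rewrite expr0n gtn_eqF.
rewrite mulr0 subr0 => h.
have : 0 <= J 0%N S * S ^+ (k + l) by rewrite mulr_ge0 ?exprn_ge0.
suff : S ^+ l * (k`!%:R * G k S) <= (k + l)`!%:R * G (k + l) S by lra.
rewrite /G [in leRHS]addnC big_split_ord /= mulrDr.
rewrite -[leLHS]add0r lerD //.
  by rewrite mulr_ge0 // sumr_ge0 // => i _;
    rewrite mulr_ge0 ?divr_ge0 ?exprn_ge0 //; apply: (chain_ge0 cJ).
rewrite !mulr_sumr; apply: ler_sum => i _.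
have -> : (l + k - (l + i) = k - i)%N by rewrite subnDl.
rewrite exprD.
have fi (n : nat) : 0 < n`!%:R :> R by rewrite ltr0n fact_gt0.
suff : k`!%:R / i`!%:R <= (l + k)`!%:R / (l + i)`!%:R :> R.
  move=> h1; have h2 : 0 <= S ^+ l * S ^+ i * J (k - i)%N S.
    by rewrite !mulr_ge0 ?exprn_ge0 //; apply: (chain_ge0 cJ).
  have := ler_wpM2r h2 h1.
  by congr (_ <= _); ring.
rewrite ler_pdivrMr // mulrAC ler_pdivlMr // -!natrM ler_nat.
have ik : (i <= k)%N by apply: ltnW.
have /leq_mul : ('C(k, i) <= 'C(l + k, l + i))%N.
  rewrite -bin_sub // -[in leqRHS]bin_sub ?leq_add2l // subnDl.
  exact: leq_bin2l (leq_addl _ _).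
have e1 := bin_fact ik.
have e2 : ('C(l + k, l + i) * ((l + i)`! * (k - i)`!) = (l + k)`!)%N.
  by rewrite -(bin_fact (_ : l + i <= l + k)%N) ?leq_add2l // subnDl.
move=> /(_ ((k - i)`! * (i`! * (l + i)`!))%N _ (leqnn _)).
rewrite -e1 -e2; congr (_ <= _)%N; ring.
Qed.

(* Formally k! (G k 0 - G k T) = E[min(I, T)^k] for a variable I of tail J 0, and
   E[min(I, T)^(k+1)] <= T E[min(I, T)^k]. *)
Let G_head (k p : nat) (T : R) : (0 < p)%N -> (p <= k)%N -> 0 <= T ->
  k`!%:R * (G k 0 - G k T) <= T ^+ (k - p) * (p`!%:R * J p 0).
Proof.
move=> p0 pk T0; rewrite -(G_0 p0).
apply: (@le_trans _ _ (T ^+ (k - p) * (p`!%:R * (G p 0 - G p T)))); last first.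
  rewrite ler_wpM2l ?exprn_ge0 // ler_wpM2l // lerBlDr lerDl; exact: G_ge0.
pose D k t := k`!%:R * (G k 0 - G k t).
rewrite -/(D k T) -/(D p T).
suff step n t : (0 < n)%N -> 0 <= t -> D n.+1 t <= t * D n t.
  rewrite -(subnK pk); elim: (k - p)%N => [|n IH].
    by rewrite add0n subnn expr0 mul1r.
  rewrite addSn (le_trans (step _ _ _ T0)) ?ltn_addl //.
  by rewrite -addSn addnK exprS -mulrA ler_wpM2l // -{2}(addnK p n).
(* Formally the derivative of [u D_n(u) - D_(n+1)(u)] is [D_n(u) - u^n J_0(u)], nonnegative since
   [J_0] is nonincreasing. On a grid the error is the drop of [J_0] times the mesh times
   [(n+1) t^n]. *)
move=> n0 t0; rewrite -subr_ge0.
have -> : 0 = 0 * D n 0 - D n.+1 0 by rewrite /D !subrr !mulr0 subr0.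
apply: (@le_of_grid _ (fun t => t * D n t - D n.+1 t)
  (fun u => n.+1%:R * t ^+ n * J 0%N u) _ _ t0) => u v u0 uv vt.
have v0 := le_trans u0 uv.
have DB i x y : i`!%:R * (G i x - G i y) = D i y - D i x by rewrite /D; ring.
have D0 i : D i 0 = 0 by rewrite /D subrr mulr0.
have /andP[h1 _] := G_incr n (lexx 0) v0.
have /andP[h2 _] := G_incr n u0 uv.
have /andP[_ h3] := G_incr n.+1 u0 uv.
move: h1 h2 h3; rewrite !DB D0 expr0n gtn_eqF // !subr0 => h1 h2 h3.
have h1' := ler_wpM2l (_ : 0 <= v - u) h1; rewrite subr_ge0 in h1'.
have h2' := ler_wpM2l u0 h2.
have Jm : 0 <= J 0%N u - J 0%N v by rewrite subr_ge0 (chain_le cJ).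
have h4 : v ^+ n.+1 - u ^+ n.+1 <= (v - u) * (n.+1%:R * t ^+ n).
  have /andP[_ h] := pow_sub_itv n u0 uv.
  rewrite (le_trans h) // ler_wpM2l ?subr_ge0 // ler_wpM2l //.
  by rewrite lerXn2r ?nnegrE.
have h4' := ler_wpM2l Jm h4.
move: (h1' uv) h2' h3 h4'; rewrite !exprS; nra.
Qed.

(** Splits the [k]-th moment of [I] at [T] and [S]: below [T] the exponent is lowered to [p],
    between the levels the tail is at most [J 0 T], and above [S] the exponent is raised to [k + l].
    A lower bound on [J 0 T] follows once the outer parts are small. *)
Lemma chain_moment_le (k p l : nat) (T S : R) : (0 < p)%N -> (p <= k)%N ->
  0 <= T -> T <= S ->
  S ^+ l * (k`!%:R * J k 0) <=
    S ^+ l * (T ^+ (k - p) * (p`!%:R * J p 0) + J 0%N T * S ^+ k)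
    + (k + l)`!%:R * J (k + l)%N 0.
Proof.
move=> p0 pk T0 TS; have S0 := le_trans T0 TS.
have k0 := leq_trans p0 pk.
rewrite -(G_0 k0).
have -> : k`!%:R * G k 0 =
  k`!%:R * (G k 0 - G k T) + k`!%:R * (G k T - G k S) + k`!%:R * G k S by ring.
rewrite mulrDr lerD ?G_tail // ler_wpM2l ?exprn_ge0 // lerD ?G_head //.
have /andP[_ h] := G_incr k T0 TS; apply: (le_trans h).
by rewrite ler_wpM2l ?(chain_ge0 cJ) // lerBlDr lerDl exprn_ge0.
Qed.

End ChainTheory.

(** * Layer-cake comparison of integrals *)

Lemma Rdominated_cvg d (T : measurableType d) (R : realType)
    (mu : {measure set T -> \bar R}) (D : set T) (f_ : nat -> T -> R)
    (f g : T -> R) :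
  measurable D -> (forall n, measurable_fun D (f_ n)) ->
  (forall x, D x -> f_ n x @[n --> \oo] --> f x) ->
  mu.-integrable D (EFin \o g) -> (forall n x, D x -> `|f_ n x| <= g x) ->
  mu.-integrable D (EFin \o f) /\
  \int[mu]_(x in D) f_ n x @[n --> \oo] --> \int[mu]_(x in D) f x.
Proof.
move=> mD mf cf ig fg.
have mEf n : measurable_fun D (fun x => (f_ n x)%:E) by apply/measurable_EFinP.
have mEF : measurable_fun D (fun x => (f x)%:E).
  by apply/measurable_EFinP; exact: measurable_fun_cvg mf cf.
have [||If _ cv] := dominated_convergence mD mEf mEF _ ig.
- apply: aeW => x Dx; apply: cvg_EFin; [exact: nearW|exact: cf].
- by apply: aeW => x n Dx; rewrite lee_fin fg.
by split => //; apply: fine_cvg; rewrite fineK // integrable_fin_num.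
Qed.

Lemma Rintegral_sum d (T : measurableType d) (R : realType)
    (mu : {measure set T -> \bar R}) (D : set T) (n : nat) (h : nat -> T -> R) :
  measurable D -> (forall i, mu.-integrable D (EFin \o h i)) ->
  mu.-integrable D (EFin \o (fun x => \sum_(i < n) h i x)) /\
  \int[mu]_(x in D) (\sum_(i < n) h i x) = \sum_(i < n) \int[mu]_(x in D) h i x.
Proof.
move=> mD ih; elim: n => [|n [IH1 IH2]].
  split; last first.
    rewrite big_ord0; under eq_Rintegral do rewrite big_ord0.
    by rewrite /Rintegral integral0.
  by apply: eq_integrable (integrable0 mu D) => // x _ /=; rewrite big_ord0.
split.
  have := integrableD mD IH1 (ih n); apply: eq_integrable => // x _ /=.
  by rewrite big_ord_recr EFinD.
rewrite big_ord_recr /= -IH2 -RintegralD //.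
by under eq_Rintegral do rewrite big_ord_recr.
Qed.

Lemma step_sum_itv (R : realType) (N : nat) (z : R) : 0 <= z ->
  Num.min (z - 1) N%:R <= \sum_(i < N) (i.+1%:R <= z)%R%:R <= Num.min z N%:R.
Proof.
move=> z0; elim: N => [|N]; first by rewrite big_ord0 !ge_min le_min z0 lexx orbT.
rewrite big_ord_recr /= => /andP[h1 h2].
have [Nz|zN] := leP N.+1%:R z.
  have e : Num.min z N%:R = N%:R.
    by apply/min_idPr; apply: le_trans Nz; rewrite ler_nat.
  have e' : Num.min (z - 1) N%:R = N%:R.
    by apply/min_idPr; rewrite lerBrDr natr1.
  rewrite e in h2; rewrite e' in h1.
  rewrite ge_min -natr1 lerD2r h1 orbT /=; lra.
rewrite (_ : false%:R = 0 :> R) // addr0; apply/andP; split.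
  apply: le_trans h1; rewrite le_min ge_min lexx /= ge_min.
  by rewrite lerBlDr natr1 (ltW zN).
by apply: (le_trans h2); rewrite ge_min lexx.
Qed.

(** For [y] in [[0, 1]] this is [y] rounded down to a multiple of [1/(n+1)], written as a sum over
    levels so that its integral is a sum of integrals over level sets. *)
Definition step_approx (R : realType) (n : nat) (y : R) : R :=
  n.+1%:R^-1 * \sum_(i < n.+1) (i.+1%:R / n.+1%:R <= y)%R%:R.

Lemma step_approx_itv (R : realType) (n : nat) (y : R) : 0 <= y <= 1 ->
  y - n.+1%:R^-1 <= step_approx n y <= y.
Proof.
move=> /andP[y0 y1]; rewrite /step_approx.
have N0 : 0 < n.+1%:R :> R by rewrite ltr0n.
under eq_bigr do rewrite ler_pdivrMr //.
have := step_sum_itv n.+1 (mulr_ge0 y0 (ltW N0)).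
have e1 : Num.min (y * n.+1%:R) n.+1%:R = y * n.+1%:R.
  by apply/min_idPl; rewrite ler_piMl.
have e2 : Num.min (y * n.+1%:R - 1) n.+1%:R = y * n.+1%:R - 1.
  by apply/min_idPl; rewrite lerBlDr (le_trans (_ : _ <= n.+1%:R)) ?ler_piMl// lerDl.
rewrite e1 e2 => /andP[h1 h2].
rewrite mulrC ler_pdivrMr // h2 ler_pdivlMr // mulrBl mulVf ?gt_eqF //.
by rewrite h1.
Qed.

(** Layer-cake comparison by Riemann sums in the level, hence without a product measure. For [w > 0]
    the indicator of a level set is at most [f / w], so its integral against [k] is finite. *)
Lemma Rintegral_le_of_levels d1 (T1 : measurableType d1) d2
    (T2 : measurableType d2) (R : realType)
    (mu1 : {measure set T1 -> \bar R}) (mu2 : {measure set T2 -> \bar R})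
    (D1 : set T1) (D2 : set T2) (f1 k1 : T1 -> R) (f2 k2 : T2 -> R) (C : R) :
  measurable D1 -> measurable D2 ->
  measurable_fun D1 f1 -> measurable_fun D2 f2 ->
  measurable_fun D1 k1 -> measurable_fun D2 k2 ->
  (forall x, D1 x -> 0 <= f1 x <= 1) -> (forall x, D2 x -> 0 <= f2 x <= 1) ->
  (forall x, D1 x -> 0 <= k1 x) -> (forall x, D2 x -> 0 <= k2 x) ->
  mu1.-integrable D1 (EFin \o (fun x => f1 x * k1 x)) ->
  mu2.-integrable D2 (EFin \o (fun x => f2 x * k2 x)) ->
  (forall w : R, 0 < w -> w <= 1 ->
    \int[mu1]_(x in D1) ((w <= f1 x)%R%:R * k1 x) <=
    C * \int[mu2]_(x in D2) ((w <= f2 x)%R%:R * k2 x)) ->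
  \int[mu1]_(x in D1) (f1 x * k1 x) <= C * \int[mu2]_(x in D2) (f2 x * k2 x).
Proof.
have key d (T : measurableType d) (mu : {measure set T -> \bar R}) (D : set T)
    (f k : T -> R) : measurable D -> measurable_fun D f -> measurable_fun D k ->
    (forall x, D x -> 0 <= f x <= 1) -> (forall x, D x -> 0 <= k x) ->
    mu.-integrable D (EFin \o (fun x => f x * k x)) ->
    n.+1%:R^-1 * (\sum_(i < n.+1)
      \int[mu]_(x in D) ((i.+1%:R / n.+1%:R <= f x)%R%:R * k x)) @[n --> \oo]
    --> \int[mu]_(x in D) (f x * k x).
  move=> mD mf mk f01 k0 ifk.
  have mind w : measurable_fun D (fun x => (w <= f x)%R%:R : R).
    apply: (@measurableT_comp _ _ _ _ _ _ (fun b : bool => b%:R : R)) => //.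
    by apply: measurable_fun_ler => //; exact: measurable_cst.
  have iind w : 0 < w -> mu.-integrable D (EFin \o (fun x => (w <= f x)%R%:R * k x)).
    move=> w0; apply: (le_integrable mD _ _ (integrableZl mD w^-1 ifk)).
      by apply/measurable_EFinP; apply: measurable_funM.
    move=> x Dx /=; rewrite lee_fin mulrA.
    have /andP[f0 _] := f01 x Dx; have kx := k0 x Dx.
    rewrite ger0_norm ?mulr_ge0 // ger0_norm; last first.
      by rewrite !mulr_ge0 // invr_ge0 ltW.
    rewrite ler_wpM2r //; case: (leP w (f x)) => [wf|_].
      by rewrite mulrC ler_pdivlMr // mul1r.
    by rewrite mulr_ge0 // invr_ge0 ltW.
  have E n : n.+1%:R^-1 * (\sum_(i < n.+1)
      \int[mu]_(x in D) ((i.+1%:R / n.+1%:R <= f x)%R%:R * k x)) =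
      \int[mu]_(x in D) (step_approx n (f x) * k x).
    have [i1 <-] := @Rintegral_sum _ _ _ mu D n.+1
      (fun i x => (i.+1%:R / n.+1%:R <= f x)%R%:R * k x) mD
      (fun i => iind _ (divr_gt0 (ltr0Sn _ _) (ltr0Sn _ _))).
    rewrite -RintegralZl //; apply: eq_Rintegral => x _.
    by rewrite /step_approx -mulrA mulr_suml.
  under eq_cvg do rewrite E.
  apply: (Rdominated_cvg mD _ _ ifk _).2.
  - move=> n; apply: measurable_funM => //; rewrite /step_approx.
    apply: measurable_funM => //.
    by apply: measurable_sum.
  - move=> x Dx; apply: cvgMr_tmp.
    apply: (@squeeze_cvgr _ _ _ _ (fun n => f x - n.+1%:R^-1) (cst (f x))).
    + by apply: nearW => n; apply: step_approx_itv; apply: f01.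
    + rewrite -[X in _ --> X]subr0; apply: cvgB; first exact: cvg_cst.
      exact: cvg_harmonic.
    + exact: cvg_cst.
  - move=> n x Dx; have kx := k0 x Dx.
    have /andP[_ h] := step_approx_itv n (f01 x Dx).
    rewrite ger0_norm ?ler_wpM2r // mulr_ge0 // /step_approx mulr_ge0 //.
    by apply: sumr_ge0.
move=> mD1 mD2 mf1 mf2 mk1 mk2 f01 f02 k01 k02 i1 i2 H.
have c1 := key _ _ _ _ _ _ mD1 mf1 mk1 f01 k01 i1.
have c2 := key _ _ _ _ _ _ mD2 mf2 mk2 f02 k02 i2.
apply: (ler_cvg_to c1 (cvgM (cvg_cst C) c2)); apply: nearW => n /=.
rewrite mulrCA ler_wpM2l // mulr_sumr; apply: ler_sum => i _; apply: H.
  by rewrite divr_gt0.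
by rewrite ler_pdivrMr // mul1r ler_nat.
Qed.

Section BorelMeasure.
Context (R : realType) (mu : borel_measure R) (D : set R).
Hypothesis mD : measurable (D : set (measurableTypeR R)).

Lemma le_integrable_real (f g : R -> R) :
  measurable_fun (D : set (measurableTypeR R)) f ->
  mu.-integrable D (EFin \o g) -> (forall x : R, D x -> `|f x| <= g x) ->
  mu.-integrable D (EFin \o f).
Proof.
move=> mf ig fg; apply: (le_integrable mD _ _ ig); first exact/measurable_EFinP.
by move=> x Dx; rewrite lee_fin (le_trans (fg x Dx)) // ler_norm.
Qed.

Lemma integrable_scale_real (c : R) (f : R -> R) : mu.-integrable D (EFin \o f) ->
  mu.-integrable D (EFin \o (fun x : R => c * f x)).
Proof. by move=> /(integrableZl mD c). Qed.

Lemma integrable_add_real (f g : R -> R) : mu.-integrable D (EFin \o f) ->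
  mu.-integrable D (EFin \o g) -> mu.-integrable D (EFin \o (fun x : R => f x + g x)).
Proof. by move=> i j; have := integrableD mD i j. Qed.

Lemma le_Rintegral_real (f g : R -> R) :
  mu.-integrable D (EFin \o f) -> mu.-integrable D (EFin \o g) ->
  (forall x : R, D x -> f x <= g x) ->
  \int[mu]_(x in D) f x <= \int[mu]_(x in D) g x.
Proof. by move=> i j fg; exact: le_Rintegral. Qed.

Lemma eq_Rintegral_real (f g : R -> R) : (forall x : R, D x -> f x = g x) ->
  \int[mu]_(x in D) f x = \int[mu]_(x in D) g x.
Proof. by move=> fg; apply: eq_Rintegral => x /set_mem; exact: fg. Qed.

Lemma Rintegral_ge0_real (f : R -> R) : (forall x : R, D x -> 0 <= f x) ->
  0 <= \int[mu]_(x in D) f x.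
Proof. by move=> f0; exact: Rintegral_ge0. Qed.

Lemma Rintegral_scale_real (c : R) (f : R -> R) : mu.-integrable D (EFin \o f) ->
  \int[mu]_(x in D) (c * f x) = c * \int[mu]_(x in D) f x.
Proof. by move=> i; rewrite RintegralZl. Qed.

Lemma Rintegral_add_real (f g : R -> R) : mu.-integrable D (EFin \o f) ->
  mu.-integrable D (EFin \o g) ->
  \int[mu]_(x in D) (f x + g x) = \int[mu]_(x in D) f x + \int[mu]_(x in D) g x.
Proof. by move=> i j; rewrite RintegralD. Qed.

Lemma Rintegral_gt0_real (A : set R) (f : R -> R) :
  mu.-integrable D (EFin \o f) -> (forall x : R, D x -> 0 <= f x) ->
  measurable (A : set (measurableTypeR R)) -> A `<=` D ->
  (forall x : R, A x -> 0 < f x) -> (0 < mu A)%E -> 0 < \int[mu]_(x in D) f x.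
Proof.
move=> i f0 mA AD fA mu_gt0.
rewrite lt_neqAle Rintegral_ge0_real // andbT eq_sym; apply/eqP => z.
have : (\int[mu]_(x in D) `| (f x)%:E | = 0)%E.
  transitivity (\int[mu]_(x in D) (f x)%:E)%E.
    by apply: eq_integral => x /set_mem xD; rewrite gee0_abs // lee_fin f0.
  by rewrite -(fineK (integrable_fin_num mD i)); congr EFin.
move/ae_eq_integral_abs => /(_ mD (measurable_int _ i)) [N [mN N0 sub]].
move: mu_gt0; rewrite lt_neqAle => /andP[/eqP + _]; apply; apply/esym.
apply: (subset_measure0 mA mN _ N0) => x xA; apply: sub => /= /(_ (AD _ xA)) [h].
by have := fA x xA; rewrite h ltxx.
Qed.

End BorelMeasure.

Lemma powR_le1 (R : realType) (x t : R) : 0 <= t -> 0 <= x <= 1 -> x `^ t <= 1.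
Proof.
move=> t0 /andP[x0 x1].
by have := ge0_ler_powR t0 _ _ x1; rewrite !nnegrE powR1; apply.
Qed.

Lemma powR_lt1 (R : realType) (x t : R) : 0 < t -> 0 <= x < 1 -> x `^ t < 1.
Proof.
move=> t0 /andP[x0 x1].
by have := gt0_ltr_powR t0 _ _ x1; rewrite !nnegrE powR1; apply.
Qed.

Lemma powR_le_base (R : realType) (r x y : R) : 0 <= r -> 0 <= x -> x <= y ->
  x `^ r <= y `^ r.
Proof.
by move=> r0 x0 xy; apply: ge0_ler_powR => //; rewrite nnegrE // (le_trans x0).
Qed.

(** * The function phi *)

(** Convexity of the exponential: [x^t] is at most the mean of [x^s] and [1] with weights [t/s] and
    [1 - t/s]. The two values are compared with the tangent line at the intermediate point [r u]. *)
Lemma powR_conv_le (R : realType) (x t s : R) : 0 < x -> 0 < t -> t <= s ->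
  t * (1 - x `^ s) <= s * (1 - x `^ t).
Proof.
move=> x0 t0 ts; have s0 := lt_le_trans t0 ts.
rewrite /powR gt_eqF //; set u := s * ln x.
have -> : t * ln x = t / s * u by rewrite /u; field; rewrite gt_eqF.
set r := t / s.
have r0 : 0 <= r by rewrite divr_ge0 // ltW.
have r1 : r <= 1 by rewrite ler_pdivrMr // mul1r.
have e1 : expR u = expR (r * u) * expR ((1 - r) * u) by rewrite -expRD; congr expR; ring.
have e2 : 1 = expR (r * u) * expR (- (r * u)) by rewrite -expRD subrr expR0.
have h1 := expR_ge1Dx ((1 - r) * u); have h2 := expR_ge1Dx (- (r * u)).
have E0 := expR_gt0 (r * u).
have k1 : expR (r * u) * (1 + (1 - r) * u) <= expR u by rewrite e1 ler_wpM2l // ltW.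
have k2 : expR (r * u) * (1 + - (r * u)) <= 1 by rewrite [leRHS]e2 ler_wpM2l // ltW.
have k : expR (r * u) <= r * expR u + (1 - r).
  have := ler_wpM2l r0 k1; have := ler_wpM2l (_ : 0 <= 1 - r) k2.
  by rewrite subr_ge0 => /(_ r1); nra.
have -> : t = r * s by rewrite /r divfK // gt_eqF.
nra.
Qed.

Section FragPhi.
Context (R : realType) (B : borel_measure R).
Hypothesis hBint : (\int[B]_(y in `]0%R, 1%R[) (y * (1 - y))%:E < +oo)%E.
Local Notation D := (`]0%R, 1%R[%classic : set R).
Local Notation phi := (frag_phi B).

Let mD : measurable (D : set (measurableTypeR R)). Proof. exact: measurable_itv. Qed.

Let Dx (x : R) : D x -> 0 < x < 1. Proof. by rewrite /= in_itv. Qed.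

Lemma integrable_frag_kernel :
  B.-integrable D (EFin \o (fun y : R => y * (1 - y))).
Proof.
apply/integrableP; split.
  by apply/measurable_EFinP; apply: measurable_funM => //; apply: measurable_funB.
rewrite (le_lt_trans _ hBint) // le_eqVlt; apply/orP; left; apply/eqP.
apply: eq_integral => y /set_mem/Dx /andP[y0 y1].
by rewrite gee0_abs // lee_fin mulr_ge0 ?subr_ge0 ?ltW.
Qed.

Let powD (x t : R) : 0 <= t -> D x -> 0 <= x `^ t <= 1.
Proof.
by move=> t0 /Dx/andP[x0 x1]; rewrite powR_ge0 powR_le1 // !ltW.
Qed.

Let measurable_pow_kernel (t : R) : measurable_fun D (fun x : R => (1 - x `^ t) * x).
Proof.
apply: measurable_funM => //; apply: measurable_funB => //.
by apply: measurable_funTS; exact: measurable_powR.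
Qed.

Lemma integrable_frag_phi (t : R) : 0 <= t ->
  B.-integrable D (EFin \o (fun x : R => (1 - x `^ t) * x)).
Proof.
move=> t0.
apply: (le_integrable_real mD (measurable_pow_kernel t)
  (integrable_scale_real mD (1 + t) integrable_frag_kernel)) => x xD.
have /andP[x0 x1] := Dx xD; have /andP[p0 p1] := powD t0 xD.
have k0 : 0 <= 1 - x `^ t by rewrite subr_ge0.
rewrite ger0_norm ?mulr_ge0 ?(ltW x0) //.
(* For [t <= 1] one has [x <= x^t]; for [t > 1] convexity against the exponent 1 gives the factor
   [t]. The constant [1 + t] serves both cases. *)
have h : 1 - x `^ t <= (1 + t) * (1 - x).
  have [t1|t1] := leP t 1.
    have : x <= x `^ t by apply: ger1_powR => //; rewrite x0 ltW.
    nra.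
  have := powR_conv_le x0 ltr01 (ltW t1).
  rewrite powRr1 ?(ltW x0) //; nra.
by rewrite [x * (1 - x)]mulrC mulrA ler_wpM2r // ltW.
Qed.

Lemma frag_phi_le (t s : R) : 0 <= t -> t <= s -> phi t <= phi s.
Proof.
move=> t0 ts; have s0 := le_trans t0 ts.
apply: le_Rintegral_real => //; [exact: integrable_frag_phi|exact: integrable_frag_phi|].
move=> x xD; have /andP[x0 x1] := Dx xD.
rewrite ler_wpM2r ?(ltW x0) // lerD2l lerN2.
by apply: ger_powR => //; rewrite x0 ltW.
Qed.

Lemma frag_phi_conv_le (t s : R) : 0 < t -> t <= s -> t * phi s <= s * phi t.
Proof.
move=> t0 ts; have s0 := lt_le_trans t0 ts.
have it := integrable_frag_phi (ltW t0); have is_ := integrable_frag_phi (ltW s0).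
rewrite -(Rintegral_scale_real mD t is_) -(Rintegral_scale_real mD s it).
apply: (le_Rintegral_real mD); try exact: (integrable_scale_real mD).
move=> x xD; have /andP[x0 x1] := Dx xD.
by rewrite !mulrA ler_wpM2r ?powR_conv_le // ltW.
Qed.

Lemma frag_phi_gt0 (t : R) : (0 < B D)%E -> 0 < t -> 0 < phi t.
Proof.
move=> BD t0; apply: (@Rintegral_gt0_real _ _ _ mD D) => //.
- exact/integrable_frag_phi/ltW.
- move=> x xD; have /andP[x0 _] := Dx xD; have /andP[_ p1] := powD (ltW t0) xD.
  by rewrite mulr_ge0 ?subr_ge0 // ltW.
- by move=> x /Dx/andP[x0 x1]; rewrite mulr_gt0 // subr_gt0 powR_lt1 // ltW.
Qed.

Let measurable_id_pow (t : R) : measurable_fun D (fun x : R => 1 - x `^ t).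
Proof.
by apply: measurable_funB => //; apply: measurable_funTS; exact: measurable_powR.
Qed.

Lemma size_tailE (b : R) : b < 1 ->
  \int[B]_(x in D) ((x <= b)%R%:R * x) = size_tail B (1 - b).
Proof.
move=> b1; rewrite /size_tail subKr Rintegral_mkcond [RHS]Rintegral_mkcond.
apply: eq_Rintegral_real => x _; rewrite !patchE.
have -> : (x \in D) = (0 < x < 1) by rewrite mem_setE in_itv.
have -> : (x \in `]0%R, b]%classic) = (0 < x <= b) by rewrite mem_setE in_itv.
case: (ltP 0 x) => //= x0; case: (leP x b) => xb.
  by rewrite (le_lt_trans xb) ?mul1r.
by rewrite mul0r; case: ifP.
Qed.

Lemma integrable_size_tail (b : R) : b < 1 ->
  B.-integrable D (EFin \o (fun x : R => (x <= b)%R%:R * x)).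
Proof.
move=> b1.
apply: (le_integrable_real mD _ (integrable_scale_real mD (1 - b)^-1
  integrable_frag_kernel)).
  apply: measurable_funM => //.
  apply: (@measurableT_comp _ _ _ _ _ _ (fun b : bool => b%:R : R)) => //.
  by apply: measurable_fun_ler.
move=> x xD; have /andP[x0 x1] := Dx xD.
have b0 : 0 < 1 - b by rewrite subr_gt0.
rewrite ger0_norm ?mulr_ge0 ?(ltW x0) // [x * (1 - x)]mulrC mulrA ler_wpM2r ?(ltW x0) // mulrC ler_pdivlMr //.
by case: (leP x b) => xb; rewrite ?mulr1n ?mulr0n ?mul1r ?mul0r; lra.
Qed.

Lemma size_tail_ge0 (u : R) : 0 <= size_tail B u.
Proof. by apply: Rintegral_ge0_real => x; rewrite /= in_itv /= => /andP[/ltW]. Qed.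

Lemma size_tail_le (u v : R) : 0 < u -> u <= v -> size_tail B v <= size_tail B u.
Proof.
move=> u0 uv; rewrite -(subKr 1 u) -(subKr 1 v).
have u1 : 1 - u < 1 by rewrite ltrBlDr ltrDl.
have v1 : 1 - v < 1 by rewrite ltrBlDr ltrDl (lt_le_trans u0).
rewrite -!size_tailE //; apply: le_Rintegral_real => //; try exact: integrable_size_tail.
move=> x /Dx/andP[x0 _]; rewrite ler_wpM2r ?(ltW x0) // ler_nat.
by case: (leP x (1 - v)) => // xv; rewrite (le_trans xv) // lerD2l lerN2.
Qed.

(* Comparing the level sets of the two integrands truncated at 1 - theta^x;
   the truncation only costs an exponentially small term. *)
Lemma frag_phi_scale_le (c K theta x : R) : 0 < c -> 0 <= K -> 0 < theta < 1 -> 0 < x ->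
  (forall b, theta <= b < 1 ->
     size_tail B (1 - b `^ c^-1) <= K * size_tail B (1 - b)) ->
  phi (c * x) <= K * phi x + theta `^ x * size_tail B (1 - theta `^ c^-1).
Proof.
move=> c0 K0 /andP[th0 th1] x0 hT; have cx0 : 0 < c * x by rewrite mulr_gt0.
have lt1 (b r : R) : 0 < b < 1 -> 0 < r -> b `^ r < 1.
  by move=> /andP[b0 b1] r0; rewrite powR_lt1 // ltW.
have thx0 : 0 < theta `^ x by rewrite powR_gt0.
have thx1 : theta `^ x < 1 by rewrite lt1 ?th0.
pose tr (z v : R) : R := Num.min (1 - v `^ z) (1 - theta `^ x).
have mtr (z : R) : measurable_fun D (tr z) by apply: measurable_minr.
have tr0 (z v : R) : 0 <= z -> D v -> 0 <= tr z v <= 1.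
  move=> z0 vD; have /andP[p0 p1] := powD z0 vD.
  by rewrite /tr le_min ge_min !subr_ge0 p1 ltW //= gerBl p0.
have itr (z : R) : 0 <= z -> B.-integrable D (EFin \o (fun v => tr z v * v)).
  move=> z0; apply: (le_integrable_real mD _ (integrable_frag_phi z0)).
    by apply: measurable_funM => //; exact: mtr.
  move=> v vD; have /andP[v0 v1] := Dx vD.
  have /andP[t0 t1] := tr0 z v z0 vD; have /andP[p0 p1] := powD z0 vD.
  rewrite ger0_norm ?mulr_ge0 ?(ltW v0) //.
  by rewrite ler_wpM2r ?(ltW v0) // /tr ge_min lexx.
have levelE (z w : R) : 0 < z -> 0 < w -> w <= 1 - theta `^ x ->
    \int[B]_(v in D) ((w <= tr z v)%R%:R * v) = size_tail B (1 - (1 - w) `^ z^-1).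
  move=> z0 w0 w1; rewrite -size_tailE; last first.
    by rewrite lt1 ?invr_gt0 //; apply/andP; split; lra.
  apply: eq_Rintegral_real => v /Dx/andP[v0 v1]; congr (_%:R * _); congr nat_of_bool.
  rewrite /tr le_min w1 andbT.
  have e : v = (v `^ z) `^ z^-1 by rewrite -powRrM divff ?gt_eqF // powRr1 // ltW.
  have w2 : 0 <= 1 - w by lra.
  rewrite lerBrDr -lerBrDl; apply/idP/idP => [h|h].
    by rewrite [leLHS]e powR_le_base ?powR_ge0 // invr_ge0 ltW.
  have -> : 1 - w = ((1 - w) `^ z^-1) `^ z.
    by rewrite -powRrM mulVf ?gt_eqF // powRr1.
  by rewrite powR_le_base ?(ltW z0) ?(ltW v0).
apply: (@le_trans _ _ (\int[B]_(v in D) (tr (c * x) v * v)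
    + theta `^ x * size_tail B (1 - theta `^ c^-1))).
  have b1 : theta `^ c^-1 < 1 by rewrite lt1 ?th0 ?invr_gt0.
  have ib := integrable_size_tail b1.
  rewrite -size_tailE // -Rintegral_scale_real // -Rintegral_add_real //;
    [|exact/itr/ltW|exact: integrable_scale_real].
  apply: le_Rintegral_real => //.
  - exact/integrable_frag_phi/ltW.
  - apply: integrable_add_real => //; [exact/itr/ltW|exact: integrable_scale_real].
  move=> v vD; have /andP[v0 v1] := Dx vD.
  rewrite mulrA -mulrDl ler_wpM2r ?(ltW v0) // /tr.
  have := powR_ge0 v (c * x).
  (* Up to [theta^(1/c)] the truncation lowers [1 - v^(c x)] by at most [theta^x]; beyond it,
     [v^(c x) >= theta^x] and nothing is cut. *)
  have [vb|vb] := leP v (theta `^ c^-1).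
    have : v `^ (c * x) <= theta `^ x.
      rewrite powRrM powR_le_base ?(ltW x0) ?powR_ge0 //.
      have -> : theta = (theta `^ c^-1) `^ c by rewrite -powRrM mulVf ?gt_eqF // powRr1 // ltW.
      by rewrite powR_le_base ?powR_ge0 ?(ltW c0) ?(ltW v0).
    rewrite ?mulr1n ?mulr0n ?mulr1 ?mulr0; case: (leP (1 - v `^ (c * x)) (1 - theta `^ x)); lra.
  have : theta `^ x <= v `^ (c * x).
    rewrite powRrM powR_le_base ?(ltW x0) ?powR_ge0 ?(ltW th0) //.
    have -> : theta = (theta `^ c^-1) `^ c by rewrite -powRrM mulVf ?gt_eqF // powRr1 // ltW.
    by rewrite powR_le_base ?powR_ge0 ?(ltW c0) ?(ltW vb).
  rewrite ?mulr1n ?mulr0n ?mulr1 ?mulr0; case: (leP (1 - v `^ (c * x)) (1 - theta `^ x)); lra.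
rewrite lerD2r.
apply: (@le_trans _ _ (K * \int[B]_(v in D) (tr x v * v))); last first.
  rewrite ler_wpM2l //; apply: le_Rintegral_real => //.
  - exact: itr (ltW x0).
  - exact: integrable_frag_phi (ltW x0).
  by move=> v /Dx/andP[v0 _]; rewrite ler_wpM2r ?(ltW v0) // /tr ge_min lexx.
apply: Rintegral_le_of_levels => //.
- exact: mtr.
- exact: mtr.
- by move=> v vD; apply: tr0 => //; exact: ltW.
- by move=> v vD; apply: tr0 => //; exact: ltW.
- by move=> v /Dx/andP[/ltW].
- by move=> v /Dx/andP[/ltW].
- exact: itr (ltW cx0).
- exact: itr (ltW x0).
move=> w w0 _; have [wt|wt] := leP w (1 - theta `^ x); last first.
  rewrite (_ : \int[B]_(v in D) _ = 0); last first.
    rewrite (@eq_Rintegral_real _ _ _ _ (cst 0)) ?/Rintegral ?integral0 // => v _.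
    by rewrite /tr le_min [w <= 1 - theta `^ x]leNgt wt andbF mul0r.
  rewrite mulr_ge0 //; apply: Rintegral_ge0_real => v /Dx/andP[v0 _].
  by rewrite mulr_ge0 // ltW.
rewrite !levelE //.
(* With [b = (1 - w)^(1/x)], the two level sets end at [b^(1/c)] and at [b]; the condition
   [w <= 1 - theta^x] means [b >= theta]. *)
have -> : (1 - w) `^ (c * x)^-1 = ((1 - w) `^ x^-1) `^ c^-1.
  by rewrite -powRrM invfM mulrC.
apply: hT; rewrite lt1 ?invr_gt0 //; last by apply/andP; split; lra.
have -> : theta = (theta `^ x) `^ x^-1 by rewrite -powRrM divff ?gt_eqF // powRr1 // ltW.
by rewrite andbT powR_le_base ?invr_ge0 ?powR_ge0 ?(ltW x0) //; lra.
Qed.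

End FragPhi.

(** * Regular variation of phi *)

Section Abelian.
Context (R : realType) (B : borel_measure R) (beta : R).
Hypothesis hBint : (\int[B]_(y in `]0%R, 1%R[) (y * (1 - y))%:E < +oo)%E.
Hypothesis hBpos : (0 < B `]0%R, 1%R[%classic)%E.
Hypothesis hbeta : 0 <= beta < 1.
Hypothesis hT : regularly_varying_at0 (size_tail B) (- beta).
Local Notation phi := (frag_phi B).

(** Near [b = 1], [1 - b^(1/c)] is about [(1 - b) / c], and regular variation of index [- beta] at
    the ratio [1/c] gives the factor [c^beta]. The error of this linearisation is absorbed by using
    the ratio [1/(c q)] with [q > 1]. *)
Lemma size_tail_scale (c K : R) : 0 < c -> c `^ beta < K ->
  exists2 theta : R, 0 < theta < 1 & forall b, theta <= b < 1 ->
    size_tail B (1 - b `^ c^-1) <= K * size_tail B (1 - b).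
Proof.
move=> c0 cK; have /andP[be0 be1] := hbeta.
have cb0 : 0 < c `^ beta by rewrite powR_gt0.
have K0 : 0 < K := lt_trans cb0 cK.
(* Halfway between [1] and [K / c^beta]; as [beta <= 1], the bound [q^beta <= q] keeps [(c q)^beta]
   below [K]. *)
pose q := (1 + K / c `^ beta) / 2.
have Kc1 : 1 < K / c `^ beta by rewrite ltr_pdivlMr // mul1r.
have q1 : 1 < q by rewrite /q; lra.
have q0 : 0 < q by lra.
have qK : c `^ beta * q < K.
  by rewrite mulrC -ltr_pdivlMr // /q; lra.
have cqb : (c * q) `^ beta < K.
  rewrite powRM ?(ltW c0) ?(ltW q0) //; apply: le_lt_trans qK.
  rewrite ler_wpM2l ?(ltW cb0) //.
  by apply: ler1_powR; rewrite ltW.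
have cq0 : 0 < c * q by rewrite mulr_gt0.
have [[d [d0 _ dpos]] rv] := hT.
have r0 : 0 < (c * q)^-1 by rewrite invr_gt0.
have lim := rv _ r0.
have limE : (c * q)^-1 `^ (- beta) = (c * q) `^ beta.
  by rewrite -powR_inv1 ?(ltW cq0) // -powRrM mulrNN mul1r.
rewrite limE in lim.
have : \forall u \near 0^'+, size_tail B ((c * q)^-1 * u) / size_tail B u < K.
  by apply: cvgr_lt cqb => //; exact: lim.
move=> [e /= e0 he].
(* [s0] will bound [- ln b]: the first term ensures [1 + y <= q] for [y = - ln b / c], the others
   bring [1 - b] into the ranges where the ratio bound and positivity hold. *)
pose s0 := Num.min ((q - 1) * c) (Num.min (e / 2) (d / 2)).
have s00 : 0 < s0.
  by rewrite /s0 !lt_min mulr_gt0 ?subr_gt0 // !divr_gt0.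
have [s0q s0e s0d] : [/\ s0 <= (q - 1) * c, s0 < e & s0 < d].
  split; first by rewrite /s0 ge_min lexx.
    by rewrite /s0 !gt_min ltr_pdivrMr // ltr_pMr // ltrDl ltr01 orbT.
  by rewrite /s0 !gt_min [d / 2 < d]ltr_pdivrMr // ltr_pMr // ltrDl ltr01 !orbT.
exists (expR (- s0)).
  by rewrite expR_gt0 /= -expR0 ltr_expR oppr_lt0.
move=> b /andP[tb b1].
have b0 : 0 < b by apply: lt_le_trans tb; exact: expR_gt0.
pose s := - ln b.
have bE : b = expR (- s) by rewrite /s opprK lnK.
have ss0 : s <= s0 by rewrite -lerN2 -ler_expR -bE.
have s_gt0 : 0 < s by rewrite /s oppr_gt0 ln_lt0 // b0.
have u0 : 0 < 1 - b by rewrite subr_gt0.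
have us : 1 - b <= s by rewrite bE; have := expR_ge1Dx (- s); lra.
have ue : 1 - b < e by lra.
have ud : 1 - b < d by lra.
have Tu0 := dpos (1 - b) (introT andP (conj u0 ud)).
have hr : size_tail B ((c * q)^-1 * (1 - b)) <= K * size_tail B (1 - b).
  rewrite -ler_pdivrMr // ltW //; apply: he => //=.
  by rewrite sub0r normrN gtr0_norm.
apply: le_trans hr; apply: size_tail_le => //; first by rewrite mulr_gt0.
pose y := c^-1 * s.
have y0 : 0 < y by rewrite mulr_gt0 // invr_gt0.
have pE : b `^ c^-1 = expR (- y).
  by rewrite /powR gt_eqF // /y /s mulrN opprK.
have yq : 1 + y <= q.
  by rewrite /y mulrC -lerBrDl ler_pdivrMr // (le_trans ss0).
have h1 : expR (- y) <= (1 + y)^-1.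
  rewrite expRN lef_pV2 ?posrE ?expR_gt0 ?expR_ge1Dx //; lra.
rewrite pE; apply: (@le_trans _ _ (1 - (1 + y)^-1)); last by lra.
have -> : 1 - (1 + y)^-1 = y / (1 + y) by field; lra.
apply: (@le_trans _ _ ((c * q)^-1 * s)); first by rewrite ler_wpM2l // ltW.
rewrite invfM mulrAC -/y ler_wpM2l ?(ltW y0) // lef_pV2 ?posrE //; lra.
Qed.

Let phi0 (x : R) : 0 < x -> 0 < phi x.
Proof. by move=> x0; exact: frag_phi_gt0. Qed.

(** Half of the margin [K - c^beta] is spent on [size_tail_scale]; the other half pays for the
    truncation term, which tends to 0 while [phi x >= phi 1 > 0]. *)
Let phi_scale_up (c K : R) : 0 < c -> c `^ beta < K ->
  exists A : R, forall x, A <= x -> phi (c * x) <= K * phi x.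
Proof.
move=> c0 cK.
pose K' := (c `^ beta + K) / 2.
have K'0 : 0 <= K' by rewrite /K'; have := powR_ge0 c beta; lra.
have [||theta /[dup] th /andP[th0 th1] Hth] := @size_tail_scale c K' => //.
  by rewrite /K'; lra.
pose C := size_tail B (1 - theta `^ c^-1).
have C0 : 0 <= C by apply: size_tail_ge0.
pose L := - ln theta.
have L0 : 0 < L by rewrite oppr_gt0 ln_lt0.
pose eta := (K - K') * phi 1.
have KK : K' < K by rewrite /K'; lra.
have eta0 : 0 < eta by rewrite mulr_gt0 ?subr_gt0 ?phi0.
exists (Num.max 1 (C / (eta * L))) => x; rewrite ge_max => /andP[x1 xC].
have x0 : 0 < x by lra.
apply: (le_trans (frag_phi_scale_le hBint c0 K'0 th x0 Hth)); rewrite -/C.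
suff h : theta `^ x * C <= eta.
  rewrite -lerBrDl -mulrBl; apply: (le_trans h).
  apply: ler_wpM2l; first by rewrite subr_ge0 ltW.
  exact: (frag_phi_le hBint ler01 x1).
have -> : theta `^ x = (expR (x * L))^-1.
  by rewrite -expRN /powR gt_eqF // /L mulrN opprK.
rewrite mulrC ler_pdivrMr ?expR_gt0 //.
have : C <= x * (eta * L) by move: xC; rewrite ler_pdivrMr // mulr_gt0.
have := ler_wpM2l (ltW eta0) (expR_ge1Dx (x * L)); lra.
Qed.

(** The upper bound at scale [1/c], read at the point [c x]. *)
Let phi_scale_lo (c k : R) : 0 < c -> k < c `^ beta ->
  exists A : R, forall x, A <= x -> k * phi x <= phi (c * x).
Proof.
move=> c0 kc; have [k0|k0] := leP k 0.
  exists 1 => x x1; have x0 : 0 < x by lra.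
  apply: (@le_trans _ _ 0); last by rewrite ltW // phi0 // mulr_gt0.
  by rewrite mulr_le0_ge0 // ltW // phi0.
have ic0 : 0 < c^-1 by rewrite invr_gt0.
have ik : c^-1 `^ beta < k^-1.
  rewrite -powR_inv1 ?(ltW c0) // -powRrM mulN1r powRN.
  by rewrite ltf_pV2 ?posrE // powR_gt0.
have [A HA] := phi_scale_up ic0 ik.
exists (A / c) => x; rewrite ler_pdivrMr // mulrC => /HA.
by rewrite mulKf ?gt_eqF // ler_pdivlMl // mulrC.
Qed.

Lemma frag_phi_scale_cvg (c : R) : 0 < c ->
  phi (c * x) / phi x @[x --> +oo] --> c `^ beta.
Proof.
move=> c0; apply/cvgrPdist_le => e e0.
have [||A1 H1] := @phi_scale_up c (c `^ beta + e) => //; first by rewrite ltrDl.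
have [||A2 H2] := @phi_scale_lo c (c `^ beta - e) => //; first by rewrite gtrBl.
near=> x.
have x0 : 0 < x by near: x; exact: nbhs_pinfty_gt.
have px := phi0 x0.
rewrite distrC ler_distl; apply/andP; split.
  rewrite (ler_pdivlMr _ _ px); apply: H2; near: x; apply: nbhs_pinfty_ge; exact: num_real.
rewrite (ler_pdivrMr _ _ px); apply: H1; near: x; apply: nbhs_pinfty_ge; exact: num_real.
Unshelve. all: by end_near. Qed.

End Abelian.

(** * Test functions *)

Lemma is_derive_of_cvg (R : realType) (f : R -> R) (x l : R) :
  h^-1 * (f (h + x) - f x) @[h --> 0^'] --> l -> is_derive x (1 : R) f l.
Proof.
move=> H; have H' : h^-1 *: ((f \o shift x) (h *: (1 : R)) - f x) @[h --> 0^'] --> l.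
  apply: cvg_trans H; apply: near_eq_cvg; near=> h.
  by rewrite /= /GRing.scale /= mulr1.
by apply: DeriveDef; [exact: cvgP H'|exact: cvg_lim H'].
Unshelve. all: by end_near. Qed.

Lemma is_derive_of_quadratic (R : realType) (f : R -> R) (x l C : R) :
  (forall h, `|f (h + x) - f x - l * h| <= C * h ^+ 2) -> is_derive x (1 : R) f l.
Proof.
move=> H; apply: is_derive_of_cvg; apply/cvgrPdist_le => e e0.
near=> h.
have h0 : h != 0 by near: h; exact: nbhs_dnbhs_neq.
have ah0 : 0 < `|h| by rewrite normr_gt0.
have -> : l - h^-1 * (f (h + x) - f x) = - (h^-1 * (f (h + x) - f x - l * h)).
  by field.
rewrite normrN normrM normfV mulrC ler_pdivrMr //.
apply: (le_trans (H h)); rewrite -real_normK ?num_real // expr2 mulrA ler_wpM2r //.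
have C1 : 0 < `|C| + 1 by have := normr_ge0 C; lra.
have : `|h| <= e / (`|C| + 1) by near: h; apply: dnbhs0_le; rewrite divr_gt0.
rewrite ler_pdivlMr //; have := ler_norm C; nra.
Unshelve. all: by end_near. Qed.

Definition sqpos (R : realType) (z : R) : R := (Num.max z 0) ^+ 2.

Lemma is_derive_sqpos (R : realType) (z : R) :
  is_derive z (1 : R) (@sqpos R) (2 * Num.max z 0).
Proof.
apply: (@is_derive_of_quadratic _ _ _ _ 1) => h; rewrite /sqpos ler_norml mul1r.
case: (leP (h + z) 0) => h1; case: (leP z 0) => h2; nra.
Qed.

Lemma sqpos_le0 (R : realType) (z : R) : z <= 0 -> sqpos z = 0.
Proof. by move=> z0; rewrite /sqpos; move/max_idPr: z0 => ->; rewrite expr0n. Qed.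

Lemma sqpos_ge0E (R : realType) (z : R) : 0 <= z -> sqpos z = z ^+ 2.
Proof. by move=> z0; rewrite /sqpos; move/max_idPl: z0 => ->. Qed.

Lemma sqpos_ge0 (R : realType) (z : R) : 0 <= sqpos z.
Proof. by rewrite /sqpos sqr_ge0. Qed.

Lemma sqpos_le (R : realType) (z w : R) : z <= w -> sqpos z <= sqpos w.
Proof.
by move=> zw; rewrite /sqpos; case: (leP z 0) => z0; case: (leP w 0) => w0; nra.
Qed.

Definition C1on (R : realType) (P : R -> Prop) (f f' : R -> R) : Prop :=
  forall x, P x -> is_derive x (1 : R) f (f' x) /\ {for x, continuous f'}.

Lemma C1on_continuous (R : realType) (P : R -> Prop) (f f' : R -> R) (x : R) :
  C1on P f f' -> P x -> {for x, continuous f}.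
Proof.
by move=> H /H[[df _] _]; apply: differentiable_continuous; apply/derivable1_diffP.
Qed.

Lemma C1on_cst (R : realType) (P : R -> Prop) (c : R) : C1on P (cst c) (cst 0).
Proof. by move=> x _; split; [exact: is_derive_cst|exact: cst_continuous]. Qed.

Lemma C1on_id (R : realType) (P : R -> Prop) : C1on P (@id R) (cst 1).
Proof. by move=> x _; split; [exact: is_derive_id|exact: cst_continuous]. Qed.

Lemma C1on_add (R : realType) (P : R -> Prop) (f f' g g' : R -> R) :
  C1on P f f' -> C1on P g g' -> C1on P (f \+ g) (f' \+ g').
Proof.
move=> Hf Hg x Px; have [df cf] := Hf x Px; have [dg cg] := Hg x Px.
split; [exact: is_deriveD|exact: continuousD].
Qed.

Lemma C1on_mul (R : realType) (P : R -> Prop) (f f' g g' : R -> R) :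
  C1on P f f' -> C1on P g g' -> C1on P (f \* g) (fun x => f x * g' x + g x * f' x).
Proof.
move=> Hf Hg x Px; have [df cf] := Hf x Px; have [dg cg] := Hg x Px.
have cf0 := C1on_continuous Hf Px; have cg0 := C1on_continuous Hg Px.
split; first exact: is_deriveM.
by apply: cvgD; apply: cvgM.
Qed.

Lemma C1on_comp (R : realType) (P : R -> Prop) (f f' g g' : R -> R) :
  C1on P f f' -> C1on setT g g' -> C1on P (g \o f) (fun x => g' (f x) * f' x).
Proof.
move=> Hf Hg x Px; have [df cf] := Hf x Px; have [dg cg] := Hg (f x) I.
have cf0 := C1on_continuous Hf Px.
split; last first.
  apply: cvgM => //; apply: (@cvg_comp _ _ _ f g' _ (nbhs (f x))) => //.
exact: is_derive1_comp.
Qed.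

Lemma C1on_sqpos (R : realType) : C1on setT (@sqpos R) (fun z => 2 * Num.max z 0).
Proof.
move=> z _; split; first exact: is_derive_sqpos.
apply: cvgM; first exact: cvg_cst.
by apply: (@continuous_max _ _ id (cst 0)); [exact: cvg_id|exact: cvg_cst].
Qed.

Lemma C1on_affine (R : realType) (k d : R) :
  C1on setT (fun x => k * x + d) (fun=> k).
Proof.
have := C1on_add (C1on_mul (@C1on_cst R setT k) (@C1on_id R setT)) (@C1on_cst R setT d).
congr C1on; apply/funext => x /=; ring.
Qed.

(** Two nested squared positive parts: the inner one makes the junction at [0] smooth, the outer one
    that at [1]. *)
Definition cutoff (R : realType) (z : R) : R := sqpos (1 - sqpos z).

Lemma cutoff_le0 (R : realType) (z : R) : z <= 0 -> cutoff z = 1.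
Proof. by move=> z0; rewrite /cutoff (sqpos_le0 z0) subr0 sqpos_ge0E ?ler01 // expr1n. Qed.

Lemma cutoff_ge1 (R : realType) (z : R) : 1 <= z -> cutoff z = 0.
Proof. by move=> z1; rewrite /cutoff sqpos_le0 // sqpos_ge0E; nra. Qed.

Lemma cutoff_le (R : realType) (z w : R) : z <= w -> cutoff w <= cutoff z.
Proof. by move=> zw; rewrite /cutoff sqpos_le // lerD2l lerN2 sqpos_le. Qed.

Lemma cutoff_itv (R : realType) (z : R) : 0 <= cutoff z <= 1.
Proof.
have h := sqpos_ge0 z; rewrite sqpos_ge0 /=.
have : sqpos (1 - sqpos z) <= sqpos 1 by apply: sqpos_le; lra.
by rewrite [sqpos 1]sqpos_ge0E ?ler01 // expr1n.
Qed.

Lemma C1on_cutoff (R : realType) : exists f', C1on setT (@cutoff R) f'.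
Proof.
have A := C1on_comp (@C1on_sqpos R) (C1on_affine (-1) 1).
have := C1on_comp A (@C1on_sqpos R); set f' := (f' in C1on _ _ f') => H.
exists f'; move: H; congr C1on; apply/funext => x /=.
by rewrite /cutoff; congr sqpos; ring.
Qed.

Lemma C1on_cutoff_affine (R : realType) (k d : R) :
  exists f', C1on setT (fun x => cutoff (k * x + d)) f'.
Proof.
have [c' Hc] := @C1on_cutoff R.
by exists (fun x => c' (k * x + d) * k); exact: (C1on_comp (C1on_affine k d) Hc).
Qed.

Lemma C1on_powR (R : realType) (s : R) :
  C1on (fun x : R => 0 < x) (fun x => x `^ s) (fun x => s * x `^ (s - 1)).
Proof.
move=> x x0; split; first exact: is_derive1_powR.
have c : {for x, continuous (fun y : R => y `^ (s - 1))}.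
  apply: differentiable_continuous; apply/derivable1_diffP.
  by have [] := @is_derive1_powR R (s - 1) x x0.
by apply: cvgM; [exact: cvg_cst|exact: c].
Qed.

(** The junction is placed at [b], strictly inside the interval []0, 2 b[] where [F] vanishes, so
    that near every point the glued function coincides with [0] or with [F]. *)
Lemma C1on_glue (R : realType) (b : R) (F F' : R -> R) : 0 < b ->
  C1on (fun x => 0 < x) F F' -> (forall x : R, 0 < x < 2 * b -> F x = 0) ->
  exists f', C1on setT (fun x => if x <= b then 0 else F x) f'.
Proof.
move=> b0 HF F0; exists (fun x => if x <= b then 0 else F' x).
have F'0 (x : R) : 0 < x < 2 * b -> F' x = 0.
  move=> /andP[x0 xb]; have [[_ <-] _] := HF x x0.
  have : is_derive x (1 : R) F 0.
    apply: (@near_eq_is_derive _ _ _ (cst (0 : R))).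
    near=> y; rewrite F0 //; apply/andP; split; near: y.
      exact: lt_nbhsr.
    exact: lt_nbhsl.
  by case.
move=> x _; have [xb|bx] := ltP x (2 * b).
  have e G : (forall y, 0 < y < 2 * b -> G y = 0) ->
      {near x, cst 0 =1 (fun y : R => if y <= b then 0 else G y : R)}.
    move=> G0; near=> y; case: (leP y b) => // yb; rewrite G0 // (lt_trans b0) //=.
    by near: y; exact: lt_nbhsl.
  have eF' : (if x <= b then 0 else F' x) = 0.
    by case: (leP x b) => // bx; rewrite F'0 // xb (lt_trans b0).
  rewrite eF'; split; first exact: near_eq_is_derive (e _ F0) (is_derive_cst _ _ _).
  change ((if y <= b then 0 else F' y) @[y --> x] --> (if x <= b then 0 else F' x)).
  rewrite eF'; exact: cvg_trans (near_eq_cvg (e _ F'0)) (cvg_cst _).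
have bx' : b < x by lra.
have x0 : 0 < x by lra.
have e G : {near x, G =1 (fun y : R => if y <= b then 0 else G y : R)}.
  near=> y; have yb : b < y by near: y; exact: lt_nbhsr.
  by rewrite leNgt yb.
have [dF cF] := HF x x0.
rewrite leNgt bx' /=; split; first exact: near_eq_is_derive (e F) dF.
change ((if y <= b then 0 else F' y) @[y --> x] --> (if x <= b then 0 else F' x)).
rewrite leNgt bx' /=.
exact: cvg_trans (near_eq_cvg (e _)) cF.
Unshelve. all: by end_near. Qed.

Lemma has_derivative_nonneg_MVT (R : realType) (F F' : R -> R) (T t : R) :
  (forall s : R, 0 <= s -> has_derivative_nonneg F s (F' s)) -> 0 <= T -> T < t ->
  exists2 c, T <= c <= t & F t - F T = (t - T) * F' c.
Proof.
move=> HF T0 Tt.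
have dF (x : R) : 0 < x -> is_derive x (1 : R) F (F' x).
  move=> x0; apply: is_derive_of_cvg.
  have := HF x (ltW x0); rewrite /has_derivative_nonneg => H.
  apply/cvgrPdist_le => e e0; move/cvgrPdist_le : H => /(_ e e0) [d /= d0 Hd].
  exists (Num.min d x); first by rewrite /= lt_min d0.
  move=> h /=; rewrite sub0r normrN lt_min => /andP[hd hx] h0.
  have := Hd (h + x); rewrite /= opprD addrCA subrr addr0 normrN => /(_ hd).
  rewrite addrK mulrC; apply; first by rewrite -subr_eq0 addrK.
  by move: hx; rewrite ltr_norml => /andP[]; lra.
have cF : {within `[T, t], continuous F}.
  apply/continuous_within_itvP => //; split.
  - move=> x; rewrite in_itv /= => /andP[Tx _].
    have [d _] := dF x (le_lt_trans T0 Tx).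
    by apply: differentiable_continuous; apply/derivable1_diffP.
  (* [T] may be 0, where the derivative is one-sided: difference quotients near [T] are bounded by
     [|F' T| + 1], which yields continuity from the right. *)
  - have H := HF T T0.
    apply/cvgrPdist_le => e e0.
    move/cvgrPdist_le : H => /(_ 1 ltr01) [d /= d0 Hd].
    pose M := `|F' T| + 1.
    have M0 : 0 < M by rewrite (le_lt_trans (normr_ge0 (F' T))) // ltrDl.
    exists (Num.min d (e / M)); first by rewrite /= lt_min d0 divr_gt0.
    move=> x /=; rewrite lt_min => /andP[xd xe] Tx.
    have := Hd x xd (negbT (gt_eqF Tx)) (le_trans T0 (ltW Tx)).
    move: xe; rewrite !(distrC T).
    have xT : 0 < `|x - T| by rewrite normr_gt0 subr_eq0 gt_eqF.
    rewrite ltr_pdivlMr // => xe h.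
    have : `|(F x - F T) / (x - T)| <= M.
      rewrite /M -lerBlDl; apply: le_trans h.
      by rewrite distrC lerB_dist.
    rewrite normrM normfV ler_pdivrMr // distrC => /le_trans; apply.
    by rewrite mulrC ltW.
  - have [d _] := dF t (le_lt_trans T0 Tt).
    apply: cvg_at_left_filter.
    by apply: differentiable_continuous; apply/derivable1_diffP.
have dI x : x \in `]T, t[ -> is_derive x (1 : R) F (F' x).
  by rewrite in_itv /= => /andP[Tx _]; apply: dF; exact: le_lt_trans Tx.
have [c] := MVT Tt dI cF.
rewrite in_itv /= => /andP[/ltW Tc /ltW ct] ->; exists c; first by rewrite Tc.
by rewrite mulrC.
Qed.

(** * Integrals and null sets *)

Import HBSimple HBNNSimple.

(** A simple function below [f] keeps its integral when multiplied by the indicator of [E], so both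
    suprema agree. *)
Lemma ge0_integral_null_compl d (T : measurableType d) (R : realType)
    (mu : {measure set T -> \bar R}) (E : set T) (f : T -> \bar R) :
  measurable E -> mu (~` E) = 0%E -> (forall x, 0 <= f x)%E ->
  (\int[mu]_x f x = \int[mu]_(x in E) f x)%E.
Proof.
move=> mE mE0 f0; rewrite [RHS]integral_mkcond.
have fE0 x : (0 <= (f \_ E) x)%E by rewrite patchE; case: ifP.
rewrite !ge0_integralTE //; apply/eqP; rewrite eq_le; apply/andP; split.
  apply: ge_ereal_sup => _ [h /= hf <-]; apply: ereal_sup_ubound.
  exists (proj_nnsfun h mE) => /=.
    move=> x; rewrite patchE mindicE; case: ifP => xE; rewrite ?mulr1 ?mulr0 //.
  rewrite -!integralT_nnsfun; apply: ge0_ae_eq_integral => //.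
  - exact/measurable_EFinP.
  - exact/measurable_EFinP.
  - by move=> x _; rewrite lee_fin.
  - by move=> x _; rewrite lee_fin.
  exists (~` E); split => //; first exact: measurableC.
  by move=> x /=; apply: contra_not => xE _; rewrite /= mindicE mem_set // mulr1.
apply: le_ereal_sup => _ [h /= hf <-]; exists h => //= x.
by apply: (le_trans (hf x)); rewrite patchE; case: ifP.
Qed.

(* No measurability of f is needed, since the integral of a nonnegative function
   is defined as a supremum over the simple functions below it. *)
Lemma integral_null_compl d (T : measurableType d) (R : realType)
    (mu : {measure set T -> \bar R}) (D E : set T) (f : T -> \bar R) :
  measurable E -> E `<=` D -> mu (~` E) = 0%E ->
  (\int[mu]_(x in D) f x = \int[mu]_(x in E) f x)%E.
Proof.
move=> mE ED mE0.
have H g : (\int[mu]_x g x = \int[mu]_(x in E) g x)%E.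
  rewrite integralE [RHS]integralE.
  by congr (_ - _)%E; apply: ge0_integral_null_compl.
rewrite [LHS]integral_mkcond H; apply: eq_integral => x /set_mem xE.
by rewrite patchE mem_set //; exact: ED.
Qed.

Lemma Rintegral_le0 d (T : measurableType d) (R : realType)
    (mu : {measure set T -> \bar R}) (D : set T) (f : T -> R) :
  (forall x, D x -> f x <= 0) -> \int[mu]_(x in D) f x <= 0.
Proof.
move=> f0; rewrite /Rintegral fine_le0 // integralE.
have f0' x : D x -> ((EFin \o f) x <= 0)%E by move=> Dx; rewrite lee_fin f0.
rewrite (eq_integral _ _ (le0_funeposE f0')) integral0 sub0e oppe_le0.
exact: integral_ge0.
Qed.

(** * Loss of a regularised power under one fragmentation *)

Section Dissipation.
Context (R : realType).

(* With e = eps / z, one has (h(z) - h(q z)) / z = dissip e q for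
   h(z) = sqpos (1 - eps / z) z. *)
Definition dissip (e q : R) : R := sqpos (1 - e) - q * sqpos (1 - e / q).

Let dissipE (r q : R) : 0 < q -> r <= 1 -> q <= 1 -> 0 <= r ->
  dissip (r * q) q = (1 - q) * (1 - q * r ^+ 2).
Proof.
move=> q0 r1 q1 r0; rewrite /dissip mulfK ?gt_eqF // !sqpos_ge0E ?subr_ge0 //; first ring.
by rewrite mulr_ile1 // ltW.
Qed.

Let dissipE' (r q : R) : 0 < q -> 1 <= r -> dissip (r * q) q = sqpos (1 - r * q).
Proof.
by move=> q0 r1; rewrite /dissip mulfK ?gt_eqF // [X in q * X]sqpos_le0 ?subr_le0 // mulr0 subr0.
Qed.

(** The upper bound serves as dominating function, and the lower one forces convergence to [1 - q]
    as [e] tends to 0. With [r = e / q], the regimes [r <= 1] and [r >= 1] tell whether the fragment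
    still lies above the cut-off level. *)
Lemma dissip_itv (e q : R) : 0 < q <= 1 -> 0 <= e ->
  (1 - q) * (1 - e ^+ 2 / q) <= dissip e q <= 1 - q.
Proof.
move=> /andP[q0 q1] e0; pose r := e / q.
have r0 : 0 <= r by rewrite divr_ge0 // ltW.
have -> : e = r * q by rewrite /r divfK // gt_eqF.
have -> : (r * q) ^+ 2 / q = q * r ^+ 2 by field; rewrite gt_eqF.
have [r1|/ltW r1] := leP r 1.
  by rewrite dissipE // lexx /= ler_piMr ?subr_ge0 // gerBl mulr_ge0 ?sqr_ge0 // ltW.
rewrite dissipE' //; apply/andP; split.
  have [h|h] := leP (r * q) 1.
    rewrite sqpos_ge0E ?subr_ge0 //; have := mulr_ge0 (ltW q0) (sqr_ge0 (1 - r)); nra.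
  apply: (@le_trans _ _ 0); last exact: sqpos_ge0.
  rewrite mulr_ge0_le0 ?subr_ge0 // subr_le0; nra.
apply: (@le_trans _ _ (sqpos (1 - q))); first by apply: sqpos_le; nra.
by rewrite sqpos_ge0E ?subr_ge0 // expr2 ler_piMr ?subr_ge0 // gerBl ltW.
Qed.

(** This makes the dissipation of a regularised power nondecreasing in the size, which allows its
    integrals at different times to be compared. *)
Lemma dissip_le (e1 e2 q : R) : 0 < q <= 1 -> 0 <= e1 -> e1 <= e2 ->
  dissip e2 q <= dissip e1 q.
Proof.
move=> /andP[q0 q1] e0 e12; pose r1 := e1 / q; pose r2 := e2 / q.
have r10 : 0 <= r1 by rewrite divr_ge0 // ltW.
have r12 : r1 <= r2 by rewrite ler_wpM2r // invr_ge0 ltW.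
have -> : e1 = r1 * q by rewrite /r1 divfK // gt_eqF.
have -> : e2 = r2 * q by rewrite /r2 divfK // gt_eqF.
have r20 := le_trans r10 r12.
have [h2|/ltW h2] := leP r2 1.
  rewrite !dissipE // ?(le_trans r12) // ler_wpM2l ?subr_ge0 // lerD2l lerN2.
  by rewrite ler_wpM2l ?(ltW q0) // lerXn2r ?nnegrE.
have [h1|/ltW h1] := leP r1 1; last first.
  by rewrite !dissipE' // sqpos_le // lerD2l lerN2 ler_wpM2r // ltW.
rewrite dissipE' // dissipE //.
(* Across the two regimes, both sides are compared with the common value [(1 - q)^2] at [r = 1]. *)
apply: (@le_trans _ _ (sqpos (1 - q))); first by apply: sqpos_le; nra.
rewrite sqpos_ge0E ?subr_ge0 // expr2 ler_wpM2l ?subr_ge0 // lerD2l lerN2.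
by rewrite ler_piMr ?(ltW q0) // expr_le1.
Qed.

Lemma dissip_ge0 (e q : R) : 0 < q <= 1 -> 0 <= e -> 0 <= dissip e q.
Proof.
move=> q01 e0; have /andP[q0 q1] := q01.
apply: (le_trans _ (dissip_le q01 e0 (_ : e <= e + 1))); last by rewrite lerDl.
have -> : e + 1 = (e + 1) / q * q by rewrite divfK // gt_eqF.
rewrite dissipE' ?sqpos_ge0 // ler_pdivlMr // mul1r; lra.
Qed.

End Dissipation.

(** * Monotonicity in time *)

(* The solutions below do not charge ]1, +oo[; the restriction to ]0, 1] makes
   nondecreasing functions p bounded. *)
Definition sized_integral (R : realType) (m : borel_measure R) (p : R -> R) : R :=
  \int[m]_(x in `]0, 1]) (p x * x).

Section Fragmentation.
Context (R : realType) (alpha : R) (B mu0 : borel_measure R)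
  (mu : R -> borel_measure R).
Hypothesis halpha : alpha < 0.
Hypothesis hBint : (\int[B]_(y in `]0%R, 1%R[) (y * (1 - y))%:E < +oo)%E.
Hypothesis hmu0sup : support_sup mu0 1.
Hypothesis hmu : fragmentation_solution alpha B mu0 mu.
Local Notation D := (`]0%R, 1%R[%classic : set R).
Local Notation U := (`]0%R, 1%R]%classic : set R).
Local Notation V := (`]0%R, +oo[%classic : set R).
Local Notation nu t p := (sized_integral (mu t) p).

Let mD : measurable (D : set (measurableTypeR R)). Proof. exact: measurable_itv. Qed.
Let mU : measurable (U : set (measurableTypeR R)). Proof. exact: measurable_itv. Qed.

Let Ux (x : R) : U x -> 0 < x <= 1. Proof. by rewrite /= in_itv. Qed.
Let Dx (x : R) : D x -> 0 < x < 1. Proof. by rewrite /= in_itv. Qed.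
Let UV : U `<=` V.
Proof. by move=> x /Ux/andP[x0 _]; rewrite /= in_itv /= x0. Qed.

(** Condition (c) concerns closed rays and [mu0] may charge the point 1, so it is applied at
    [1 + 1/(n+1)], and []1, oo[] is recovered as a countable union. *)
Lemma frag_null (t : R) : 0 <= t -> mu t (~` U) = 0%E.
Proof.
move=> t0; have [[hon h0] _ _ hc] := hmu.
have m1 : mu t (`]1%R, +oo[%classic : set R) = 0%E.
  have null n : mu t (`[(1 + n.+1%:R^-1 : R), +oo[%classic) = 0%E.
    apply: hc => //.
    have [h1 _] := hmu0sup.
    apply: (subset_measure0 _ _ _ h1) => //; try exact: measurable_itv.
    move=> x /=; rewrite !in_itv /= !andbT; apply: lt_le_trans.
    by rewrite ltrDl.
  have mb : measurable (\bigcup_n (`[(1 + n.+1%:R^-1 : R), +oo[%classic)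
      : set (measurableTypeR R)).
    by apply: bigcup_measurable => n _; exact: measurable_itv.
  have h : mu t (\bigcup_n (`[(1 + n.+1%:R^-1 : R), +oo[%classic)) = 0%E.
    apply/negligibleP => //; apply: negligible_bigcup => n.
    by apply/negligibleP; [exact: measurable_itv|exact: null].
  apply: (subset_measure0 _ _ _ h).
  - exact: measurable_itv.
  - exact: mb.
  move=> x /=; rewrite in_itv /= andbT => x1.
  have x10 : 0 < x - 1 by rewrite subr_gt0.
  have [n _ /(_ n (leqnn n)) /ltW hn] := near_infty_natSinv_lt (PosNum x10).
  by exists n => //=; rewrite in_itv /= andbT -lerBrDl.
have mV : measurable (V : set (measurableTypeR R)) by exact: measurable_itv.
apply: (@subset_measure0 _ _ _ (mu t) _ (~` V `|` `]1%R, +oo[%classic)).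
- exact: measurableC.
- by apply: measurableU; [exact: measurableC|exact: measurable_itv].
- move=> x /= Ux'; have [x0|x0] := leP x 0.
    by left; rewrite in_itv /= andbT ltNge x0.
  right; rewrite in_itv /= andbT ltNge; apply/negP => x1.
  by apply: Ux'; rewrite in_itv /= x0.
apply/negligibleP; first by apply: measurableU; [exact: measurableC|exact: measurable_itv].
apply: negligibleU; apply/negligibleP; [exact: measurableC|exact: hon|
  exact: measurable_itv|exact: m1].
Qed.

(** Also applied to the right-hand side of the equation, whose inner integral is not known there to
    be measurable in [x]. *)
Lemma frag_Rintegral (t : R) (f : R -> R) : 0 <= t ->
  \int[mu t]_(x in V) f x = \int[mu t]_(x in U) f x.
Proof.
move=> t0; by rewrite /Rintegral (integral_null_compl (mu := mu t) (EFin \o f) mU UV (frag_null t0)).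
Qed.

Lemma frag_integrable_id (t : R) : 0 <= t -> (mu t).-integrable U (EFin \o (fun x : R => x)).
Proof.
move=> t0; have [_ _ hb _] := hmu; have [hle h1] := hb t t0.
apply/integrableP; split; first by apply/measurable_EFinP.
rewrite (@le_lt_trans _ _ 1%E) ?ltry // -h1; apply: le_trans hle.
rewrite (integral_null_compl (mu := mu t) EFin mU UV (frag_null t0)).
rewrite le_eqVlt; apply/orP; left; apply/eqP; apply: eq_integral => x /set_mem/Ux.
by move=> /andP[x0 _]; rewrite /= gtr0_norm.
Qed.

Lemma frag_mass (t : R) : 0 <= t -> total_mass mu t = nu t (cst 1).
Proof.
move=> t0; rewrite /total_mass frag_Rintegral //.
by apply: eq_Rintegral_real => x _; rewrite /= mul1r.
Qed.

Lemma sized_integral_int (t C : R) (p : R -> R) : 0 <= t ->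
  measurable_fun (U : set (measurableTypeR R)) p -> (forall x : R, U x -> `|p x| <= C) ->
  (mu t).-integrable U (EFin \o (fun x : R => p x * x)).
Proof.
move=> t0 mp pC.
apply: (le_integrable_real mU _ (integrable_scale_real mU C (frag_integrable_id t0))).
  exact: measurable_funM.
move=> x xU; have /andP[x0 _] := Ux xU.
by rewrite normrM (gtr0_norm x0) ler_wpM2r ?(ltW x0) // pC.
Qed.

Lemma sized_integral_cvg (t C : R) (p_ : nat -> R -> R) (p : R -> R) : 0 <= t ->
  (forall n, measurable_fun (U : set (measurableTypeR R)) (p_ n)) ->
  (forall n (x : R), U x -> `|p_ n x| <= C) ->
  (forall x : R, U x -> p_ n x @[n --> \oo] --> p x) ->
  nu t (p_ n) @[n --> \oo] --> nu t p.
Proof.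
move=> t0 mp pC pp.
apply: (@Rdominated_cvg _ _ _ (mu t) U (fun n x => p_ n x * x) (fun x => p x * x)
  (fun x => C * x) mU _ _ (integrable_scale_real mU C (frag_integrable_id t0)) _).2.
- by move=> n; apply: measurable_funM.
- by move=> x xU; apply: cvgM; [exact: pp|exact: cvg_cst].
move=> n x xU; have /andP[x0 _] := Ux xU.
by rewrite normrM (gtr0_norm x0) ler_wpM2r ?(ltW x0) // pC.
Qed.

(** [psi x * x] becomes a test function after multiplication by a cut-off equal to 1 on []0, 1]],
    and nothing changes: the solution lives on []0, 1]], and fragments [y x] are smaller than
    [x]. *)
Lemma frag_derivative (psi psi' : R -> R) (b t : R) : 0 < b -> 0 <= t ->
  C1on setT psi psi' -> (forall x, x <= b -> psi x = 0) ->
  has_derivative_nonneg (fun s => nu s psi) t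
    (\int[mu t]_(x in U) (x `^ alpha *
      \int[B]_(y in D) (psi (y * x) * (y * x) - psi x * x * y))).
Proof.
move=> b0 t0 Hpsi psi0; have [_ hd _ _] := hmu.
have [c' Hc] := C1on_cutoff_affine (1 : R) (-1).
pose chi (x : R) := cutoff (1 * x + -1).
have chi1 x : x <= 1 -> chi x = 1 by move=> x1; rewrite /chi cutoff_le0 //; lra.
pose f (x : R) := psi x * x * chi x.
have [f' Hf] : exists f', C1on setT f f'.
  by have := C1on_mul (C1on_mul Hpsi (@C1on_id R setT)) Hc; eexists; eassumption.
have tf : test_function f.
  split.
  - by move=> x; have [[]] := Hf x I.
  - have -> : derive1 f = f'.
      by apply/funext => x; rewrite derive1E; have [[_ ->]] := Hf x I.
    by move=> x; have [] := Hf x I.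
  - exists b, 2; split => // x; rewrite in_itv /= negb_and -!ltNge /f.
    move=> /orP[xb|x2]; first by rewrite psi0 ?mul0r // ltW.
    by rewrite /chi cutoff_ge1 ?mulr0 //; lra.
have fE x : x <= 1 -> f x = psi x * x by move=> x1; rewrite /f chi1 ?mulr1.
have nuE s : 0 <= s -> \int[mu s]_(x in V) f x = nu s psi.
  move=> s0; rewrite frag_Rintegral //; apply: eq_Rintegral_real => x /Ux/andP[_ x1].
  by rewrite fE.
have := hd f tf t t0.
rewrite (@frag_Rintegral t (fun x => x `^ alpha * \int[B]_(y in D) (f (y * x) - f x * y)) t0).
have -> : \int[mu t]_(x in U) (x `^ alpha * \int[B]_(y in D) (f (y * x) - f x * y)) =
   \int[mu t]_(x in U) (x `^ alpha *
      \int[B]_(y in D) (psi (y * x) * (y * x) - psi x * x * y)).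
  apply: eq_Rintegral_real => x /Ux/andP[x0 x1]; congr (_ * _).
  apply: eq_Rintegral_real => y /Dx/andP[y0 y1].
  by rewrite !fE // mulr_ile1 // ltW.
rewrite /has_derivative_nonneg nuE // => H.
apply: cvg_trans H; apply: near_eq_cvg; near=> s.
rewrite nuE //; near: s; exact: withinT.
Unshelve. all: by end_near. Qed.

(** The inner integrand is [y x (psi (y x) - psi x)], nonpositive since fragments are smaller; the
    mean value theorem turns this sign into monotonicity. *)
Lemma sized_integral_C1_le (psi psi' : R -> R) (b T t : R) : 0 < b -> 0 <= T -> T <= t ->
  C1on setT psi psi' -> (forall x, x <= b -> psi x = 0) ->
  (forall x y : R, x <= y -> psi x <= psi y) -> nu t psi <= nu T psi.
Proof.
move=> b0 T0; rewrite le_eqVlt => /predU1P[-> //|Tt] Hpsi psi0 psile.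
have [c /andP[Tc _] E] := has_derivative_nonneg_MVT
  (fun s s0 => frag_derivative b0 s0 Hpsi psi0) T0 Tt.
rewrite -subr_le0 E mulr_ge0_le0 ?subr_ge0 ?(ltW Tt) //.
apply: Rintegral_le0 => x /Ux/andP[x0 x1].
rewrite mulr_ge0_le0 ?powR_ge0 //; apply: Rintegral_le0 => y /Dx/andP[y0 y1].
have : psi (y * x) <= psi x by apply: psile; rewrite ger_pMl // ltW.
move=> /(ler_wpM2r (mulr_ge0 (ltW y0) (ltW x0))); lra.
Qed.

(** Ramps near [r] with slopes tending to infinity. At [x = r] the cut-off has argument [d], so
    [d = 1] yields the closed ray and [d = 0] the open one; the factor [2 / r] makes every ramp
    vanish below [r / 2], away from 0. *)
Lemma sized_integral_step_le (r d T t : R) (p : R -> R) : 0 < r -> 0 <= d <= 1 -> 0 <= T -> T <= t ->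
  (forall x : R, U x ->
    1 - cutoff ((n.+1%:R * (2 / r)) * x + (d - n.+1%:R * (2 / r) * r)) @[n --> \oo] --> p x) ->
  nu t p <= nu T p.
Proof.
move=> r0 /andP[d0 d1] T0 Tt hp; have t0 := le_trans T0 Tt.
pose k (n : nat) : R := n.+1%:R * (2 / r).
have k0 n : 0 < k n by rewrite mulr_gt0 // divr_gt0.
pose psi (n : nat) (x : R) := 1 - cutoff (k n * x + (d - k n * r)).
have psi_le n (x y : R) : x <= y -> psi n x <= psi n y.
  by move=> xy; rewrite lerD2l lerN2 cutoff_le // lerD2r ler_wpM2l // ltW.
have psi01 n x : `|psi n x| <= 1.
  have /andP[h1 h2] := cutoff_itv (k n * x + (d - k n * r)).
  by rewrite /psi ger0_norm ?subr_ge0 // gerBl.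
have mpsi n : measurable_fun (U : set (measurableTypeR R)) (psi n).
  by apply: nondecreasing_measurable => // x y; exact: psi_le.
have cv s : 0 <= s -> nu s (psi n) @[n --> \oo] --> nu s p.
  by move=> s0; apply: (@sized_integral_cvg s 1) => // n x _; exact: psi01.
apply: (ler_cvg_to (cv t t0) (cv T T0)); apply: nearW => n.
have [c' Hc] := C1on_cutoff_affine (k n) (d - k n * r).
have r20 : 0 < r / 2 by rewrite divr_gt0.
have Hpsi := C1on_add (@C1on_cst R setT 1) (C1on_mul (@C1on_cst R setT (-1)) Hc).
have e : psi n = (cst 1 \+ (cst (-1) \* (fun x => cutoff (k n * x + (d - k n * r))))).
  by apply/funext => x; rewrite /psi /= mulN1r.
apply: (@sized_integral_C1_le (psi n) _ _ T t r20 T0 Tt _ _ (psi_le n)); first by rewrite e; exact: Hpsi.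
move=> x xr; rewrite /psi cutoff_le0 ?subrr //.
have := ler_wpM2l (ltW (k0 n)) xr.
have -> : k n * (r / 2) = n.+1%:R by rewrite /k; field; rewrite gt_eqF.
have -> : k n * r = 2 * n.+1%:R by rewrite /k; field; rewrite gt_eqF.
have : 1 <= n.+1%:R :> R by rewrite ler1n.
lra.
Qed.

Lemma sized_integral_ray_le (r T t : R) : 0 < r -> 0 <= T -> T <= t ->
  nu t (fun x => (r <= x)%R%:R) <= nu T (fun x => (r <= x)%R%:R) /\
  nu t (fun x => (r < x)%R%:R) <= nu T (fun x => (r < x)%R%:R).
Proof.
move=> r0 T0 Tt.
have big (c : R) : \forall n \near \oo, c <= n.+1%:R * (2 / r).
  near=> n; rewrite mulrC -ler_pdivrMl ?divr_gt0 //.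
  apply: (@le_trans _ _ n%:R); last by rewrite ler_nat.
  by near: n; apply: nbhs_infty_ger; exact: num_real.
split.
- apply: (@sized_integral_step_le r 1) => //; first by rewrite ler01 lexx.
  move=> x _; case: (leP r x) => rx; apply: cvg_near_cst.
    near=> n; rewrite cutoff_ge1 ?subr0 //.
    have k0 : 0 <= n.+1%:R * (2 / r) by rewrite mulr_ge0 // divr_ge0 // ltW.
    have := ler_wpM2l k0 rx; lra.
  near=> n; rewrite cutoff_le0 ?subrr //.
  have : 1 / (r - x) <= n.+1%:R * (2 / r) by near: n; exact: big.
  rewrite ler_pdivrMr ?subr_gt0 //; lra.
- apply: (@sized_integral_step_le r 0) => //; first by rewrite ler01 lexx.
  move=> x _; case: (ltP r x) => rx; apply: cvg_near_cst.
    near=> n; rewrite cutoff_ge1 ?subr0 //.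
    have : 1 / (x - r) <= n.+1%:R * (2 / r) by near: n; exact: big.
    rewrite ler_pdivrMr ?subr_gt0 //; lra.
  near=> n; rewrite cutoff_le0 ?subrr //.
  have k0 : 0 <= n.+1%:R * (2 / r) by rewrite mulr_ge0 // divr_ge0 // ltW.
  have := ler_wpM2l k0 rx; lra.
Unshelve. all: by end_near. Qed.

Lemma sized_integral_eq (t : R) (p q : R -> R) : (forall x : R, 0 < x -> p x = q x) -> nu t p = nu t q.
Proof. by move=> pq; apply: eq_Rintegral_real => x /Ux/andP[x0 _]; rewrite pq. Qed.

Lemma sized_integral_cst_le (T t : R) : 0 <= T -> T <= t -> nu t (cst 1) <= nu T (cst 1).
Proof.
move=> T0 Tt; have t0 := le_trans T0 Tt.
pose p (n : nat) (x : R) : R := (n.+1%:R^-1 <= x)%R%:R.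
have cv s : 0 <= s -> nu s (p n) @[n --> \oo] --> nu s (cst 1).
  move=> s0; apply: (@sized_integral_cvg s 1) => //.
  - move=> n; apply: nondecreasing_measurable => // x y xy; rewrite /p ler_nat.
    by case: (leP _ x) => // nx; rewrite (le_trans nx).
  - by move=> n x _; rewrite /p; case: (_ <= x); rewrite ?normr1 ?normr0.
  - move=> x /Ux/andP[x0 _]; apply: cvg_near_cst; near=> n.
    suff : n.+1%:R^-1 <= x by rewrite /p => ->.
    by apply: ltW; near: n; exact: (near_infty_natSinv_lt (PosNum x0)).
apply: (ler_cvg_to (cv t t0) (cv T T0)); apply: nearW => n.
by have [] := @sized_integral_ray_le n.+1%:R^-1 T t; rewrite ?invr_gt0.
Unshelve. all: by end_near. Qed.

(** Within the positive axis an up-set is empty, everything, or a ray, closed or open according to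
    whether its infimum belongs to it. *)
Lemma sized_integral_upset_le (P : R -> bool) (T t : R) : 0 <= T -> T <= t ->
  (forall x y : R, x <= y -> P x -> P y) ->
  nu t (fun x => (P x)%:R) <= nu T (fun x => (P x)%:R).
Proof.
move=> T0 Tt hP.
have [[x0 [x0_gt0 Px0]]|noP] := pselect (exists x : R, 0 < x /\ P x); last first.
  have z s : nu s (fun x => (P x)%:R) = nu s (cst 0).
    apply: sized_integral_eq => x x0; case E : (P x) => //; exfalso; apply: noP; by exists x.
  by rewrite !z /sized_integral; do 2 (rewrite (@eq_Rintegral_real _ _ _ _ (cst 0));
    last by move=> x _; rewrite mul0r); rewrite /Rintegral !integral0.
pose S := [set x : R | 0 < x /\ P x].
have Slb : has_lbound S by exists 0 => x [/ltW].
have S0 : S !=set0 by exists x0.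
pose r := inf S.
have rlb x : S x -> r <= x by move=> Sx; exact: ge_inf.
have r0 : 0 <= r by apply: lb_le_inf => // x [/ltW].
have above x : 0 < x -> r < x -> P x.
  move=> _ rx; have [y [_ Py] yx] := inf_lt S0 rx.
  exact: hP (ltW yx) Py.
move: r0; rewrite le_eqVlt => /predU1P[r0|r0].
  have z s : nu s (fun x => (P x)%:R) = nu s (cst 1).
    by apply: sized_integral_eq => x x_gt0; rewrite above // -r0.
  by rewrite !z sized_integral_cst_le.
have [h1 h2] := sized_integral_ray_le r0 T0 Tt.
case Pr : (P r).
  have z s : nu s (fun x => (P x)%:R) = nu s (fun x => (r <= x)%R%:R).
    apply: sized_integral_eq => x x_gt0; congr (nat_of_bool _)%:R.
    apply/idP/idP => [Px|rx]; [exact: rlb|exact: hP rx Pr].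
  by rewrite !z.
have z s : nu s (fun x => (P x)%:R) = nu s (fun x => (r < x)%R%:R).
  apply: sized_integral_eq => x x_gt0; congr (nat_of_bool _)%:R.
  apply/idP/idP => [Px|rx]; last exact: above.
  by rewrite lt_neqAle rlb // andbT; apply/eqP => rx; rewrite rx Px in Pr.
by rewrite !z.
Qed.

(** Level sets of a nondecreasing function are up-sets, so the layer-cake comparison reduces the
    claim to [sized_integral_upset_le]. *)
Lemma sized_integral_le (p : R -> R) (T t : R) : 0 <= T -> T <= t ->
  (forall x y : R, 0 < x -> x <= y -> p x <= p y) -> (forall x : R, 0 < x -> 0 <= p x) ->
  nu t p <= nu T p.
Proof.
move=> T0 Tt ple p0; have t0 := le_trans T0 Tt.
(* [p] is at most [p 1] on []0, 1]]; the added 1 keeps the normalising constant positive when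
   [p 1 = 0]. *)
pose C := p 1 + 1.
have C0 : 0 < C by rewrite ltr_pwDr // p0.
pose q (x : R) := if x <= 0 then 0 else p x / C.
have q0 x : 0 <= q x.
  by rewrite /q; case: (leP x 0) => // x0; rewrite divr_ge0 ?p0 // ltW.
have qle (x y : R) : x <= y -> q x <= q y.
  move=> xy; rewrite {1}/q; case: (leP x 0) => x0; first exact: q0.
  by rewrite /q [y <= 0]leNgt (lt_le_trans x0 xy) /= ler_wpM2r ?ple // invr_ge0 ltW.
have q1 x : x <= 1 -> q x <= 1.
  move=> /qle/le_trans; apply; rewrite /q [1 <= 0]leNgt ltr01 /= ler_pdivrMr // mul1r.
  by rewrite lerDl.
have mq : measurable_fun (U : set (measurableTypeR R)) q.
  by apply: nondecreasing_measurable => // x y; exact: qle.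
have E s : 0 <= s -> nu s p = C * nu s q.
  move=> s0; rewrite /sized_integral -Rintegral_scale_real //; last first.
    apply: (@sized_integral_int s 1) => // x /Ux/andP[_ x1].
    by rewrite ger0_norm ?q1.
  apply: eq_Rintegral_real => x /Ux/andP[x0 _].
  by rewrite /q leNgt x0 /= mulrA mulrCA divff ?gt_eqF // mulr1.
rewrite !E // ler_wpM2l ?(ltW C0) // -[leRHS]mul1r.
have iq s : 0 <= s -> (mu s).-integrable U (EFin \o (fun x : R => q x * x)).
  move=> s0; apply: (@sized_integral_int s 1) => // x /Ux/andP[_ x1].
  by rewrite ger0_norm ?q1.
apply: Rintegral_le_of_levels => //.
- by move=> x /Ux/andP[_ x1]; rewrite q0 q1.
- by move=> x /Ux/andP[_ x1]; rewrite q0 q1.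
- by move=> x /Ux/andP[/ltW].
- by move=> x /Ux/andP[/ltW].
- exact: iq.
- exact: iq.
move=> w w0 _; rewrite mul1r; apply: (@sized_integral_upset_le (fun x => w <= q x)) => // x y xy.
by move=> /le_trans; apply; exact: qle.
Qed.

End Fragmentation.

(** * Moments of a fragmentation solution *)

Lemma cvg_sub_harmonic (R : realType) (A C : R) :
  A - n.+1%:R^-1 * C @[n --> \oo] --> A.
Proof.
rewrite -[X in _ --> X]subr0 -[X in _ --> A - X](mul0r C).
apply: cvgB; first exact: cvg_cst.
by apply: cvgM; [exact: cvg_harmonic|exact: cvg_cst].
Qed.

Lemma measurable_sqpos (R : realType) (A : set R) (f : R -> R) :
  measurable_fun (A : set (measurableTypeR R)) f ->
  measurable_fun (A : set (measurableTypeR R)) (fun x => sqpos (f x)).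
Proof.
move=> mf; apply: (@measurableT_comp _ _ _ _ _ _ (@sqpos R)) => //.
apply: continuous_measurable_fun => x.
exact: (C1on_continuous (@C1on_sqpos R) I).
Qed.

Lemma measurable_nondecreasing_gt0 (R : realType) (p : R -> R) :
  (forall x y : R, 0 < x -> x <= y -> p x <= p y) -> (forall x : R, 0 < x -> 0 <= p x) ->
  measurable_fun (`]0%R, 1%R] : set (measurableTypeR R)) p.
Proof.
move=> ple p0; pose q (x : R) := if x <= 0 then 0 else p x.
apply: (@eq_measurable_fun _ _ _ _ _ q).
  by move=> x /set_mem; rewrite /= in_itv /= => /andP[x0 _]; rewrite /q leNgt x0.
apply: nondecreasing_measurable; first exact: measurable_itv.
move=> x y xy; rewrite {1}/q; case: (leP x 0) => x0.
  by rewrite /q; case: (leP y 0) => // y0; exact: p0.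
by rewrite /q [y <= 0]leNgt (lt_le_trans x0 xy) /= ple.
Qed.

Section FragmentationMoments.
Context (R : realType) (alpha : R) (B mu0 : borel_measure R)
  (mu : R -> borel_measure R).
Hypothesis halpha : alpha < 0.
Hypothesis hBint : (\int[B]_(y in `]0%R, 1%R[) (y * (1 - y))%:E < +oo)%E.
Hypothesis hmu0sup : support_sup mu0 1.
Hypothesis hmu : fragmentation_solution alpha B mu0 mu.
Local Notation D := (`]0%R, 1%R[%classic : set R).
Local Notation U := (`]0%R, 1%R]%classic : set R).
Local Notation phi := (frag_phi B).
Local Notation nu t p := (sized_integral (mu t) p).

Let mD : measurable (D : set (measurableTypeR R)). Proof. exact: measurable_itv. Qed.
Let mU : measurable (U : set (measurableTypeR R)). Proof. exact: measurable_itv. Qed.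
Let Ux (x : R) : U x -> 0 < x <= 1. Proof. by rewrite /= in_itv. Qed.
Let Dx (x : R) : D x -> 0 < x < 1. Proof. by rewrite /= in_itv. Qed.

(** * The differential inequality for one moment, by regularised powers *)

Section OneMoment.
Context (s : R) (s0 : 0 < s).

Let ys01 (y : R) : D y -> 0 < y `^ s <= 1.
Proof.
move=> /Dx/andP[y0 y1]; rewrite powR_gt0 //= powR_le1 ?(ltW s0) //.
by rewrite !ltW.
Qed.

(** [phi s] with [1 - y^s] replaced by the loss of a regularised power at relative level [e]; it
    tends to [phi s] as [e] decreases to 0. *)
Let Q (e : R) : R := \int[B]_(y in D) (y * dissip e (y `^ s)).

Let mQ (e : R) : measurable_fun (D : set (measurableTypeR R))
  (fun y : R => y * dissip e (y `^ s)).
Proof.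
apply: measurable_funM => //.
have -> : (fun y : R => dissip e (y `^ s)) =
    (fun y : R => sqpos (1 - e) - y `^ s * sqpos (1 - e * y `^ (- s))).
  by apply/funext => y; rewrite /dissip powRN.
have mp (r : R) : measurable_fun (D : set (measurableTypeR R)) (fun y : R => y `^ r).
  by apply: measurable_funTS; exact: measurable_powR.
apply: measurable_funB => //; apply: measurable_funM => //.
apply: measurable_sqpos; apply: measurable_funB => //.
exact: measurable_funM.
Qed.

Let Qdom (e y : R) : 0 <= e -> D y -> `|y * dissip e (y `^ s)| <= (1 - y `^ s) * y.
Proof.
move=> e0 yD; have /andP[y0 _] := Dx yD; have q01 := ys01 yD.
have /andP[_ h] := dissip_itv q01 e0.
by rewrite ger0_norm ?mulr_ge0 ?dissip_ge0 ?(ltW y0) // mulrC ler_wpM2r // ltW.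
Qed.

Let iQ (e : R) : 0 <= e -> B.-integrable D (EFin \o (fun y : R => y * dissip e (y `^ s))).
Proof.
move=> e0; apply: (le_integrable_real mD (mQ e) (integrable_frag_phi hBint (ltW s0))).
by move=> y yD; exact: Qdom.
Qed.

Let Q_itv (e : R) : 0 <= e -> 0 <= Q e <= phi s.
Proof.
move=> e0; apply/andP; split.
  apply: Rintegral_ge0_real => y yD; have /andP[y0 _] := Dx yD.
  by rewrite mulr_ge0 ?(ltW y0) // dissip_ge0 // ys01.
rewrite /Q /frag_phi; apply: le_Rintegral_real => //;
  [exact: iQ|exact: (integrable_frag_phi hBint (ltW s0))|].
by move=> y yD; apply: le_trans (Qdom e0 yD); exact: ler_norm.
Qed.

Let Q_le (e1 e2 : R) : 0 <= e1 -> e1 <= e2 -> Q e2 <= Q e1.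
Proof.
move=> e0 e12; apply: le_Rintegral_real => //; [exact: iQ (le_trans e0 e12)|exact: iQ|].
move=> y yD; have /andP[y0 _] := Dx yD.
by rewrite ler_wpM2l ?(ltW y0) // dissip_le // ys01.
Qed.

Let Q_cvg (c : R) : 0 <= c -> Q (n.+1%:R^-1 * c) @[n --> \oo] --> phi s.
Proof.
move=> c0.
have e0 (n : nat) : 0 <= n.+1%:R^-1 * c by rewrite mulr_ge0.
have -> : phi s = \int[B]_(y in D) (y * (1 - y `^ s)).
  by apply: eq_Rintegral_real => y _; rewrite mulrC.
apply: (@Rdominated_cvg _ _ _ B D (fun n y => y * dissip (n.+1%:R^-1 * c) (y `^ s)) _
  (fun y => (1 - y `^ s) * y) mD _ _ (integrable_frag_phi hBint (ltW s0)) _).2.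
- by move=> n; exact: mQ.
- move=> y yD; have q01 := ys01 yD; have /andP[q0 q1] := q01.
  apply: cvgM; first exact: cvg_cst.
  set q := y `^ s in q01 q0 q1 *.
  apply: (@squeeze_cvgr _ _ _ _ (fun n => (1 - q) - n.+1%:R^-1 * (c ^+ 2 / q)) (cst (1 - q))).
  + apply: nearW => n; have /andP[h1 h2] := dissip_itv q01 (e0 n).
    rewrite h2 andbT; apply: le_trans h1.
    have n1 : n.+1%:R^-1 <= 1 :> R by rewrite invf_le1 // ler1n.
    have n0 : 0 <= n.+1%:R^-1 :> R by rewrite invr_ge0.
    move: (n.+1%:R^-1) n0 n1 => u u0 u1.
    have -> : (u * c) ^+ 2 / q = u ^+ 2 * (c ^+ 2 / q) by ring.
    have k0 : 0 <= c ^+ 2 / q by rewrite divr_ge0 ?sqr_ge0 // ltW.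
    move: (c ^+ 2 / q) k0 => k k0.
    have : u ^+ 2 * k <= u * k by rewrite ler_wpM2r // expr2 ler_piMl.
    have : 0 <= u ^+ 2 * k by rewrite mulr_ge0 ?sqr_ge0.
    nra.
  + exact: cvg_sub_harmonic.
  + exact: cvg_cst.
by move=> n y yD; apply: Qdom.
Qed.

(** With [eps = 1/(n+1)], [F n] vanishes for [x <= eps^(1/s)], and [b n] is half that threshold, as
    [C1on_glue] requires. By homogeneity the loss rate of [F n] is [p n], where [Q] is taken at
    [eps x^(-s)]. *)
Let F (n : nat) (x : R) : R := x `^ s * sqpos (1 - n.+1%:R^-1 * x `^ (- s)).
Let b (n : nat) : R := (n.+1%:R^-1) `^ s^-1 / 2.
Let psi (n : nat) (x : R) : R := if x <= b n then 0 else F n x.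
Let p (n : nat) (x : R) : R := x `^ (s + alpha) * Q (n.+1%:R^-1 * x `^ (- s)).

Let e0 (n : nat) : 0 < n.+1%:R^-1 :> R. Proof. by rewrite invr_gt0. Qed.

Let b0 (n : nat) : 0 < b n. Proof. by rewrite divr_gt0 // powR_gt0. Qed.

Let F_0 (n : nat) (x : R) : 0 < x < 2 * b n -> F n x = 0.
Proof.
move=> /andP[x0 xb]; rewrite /F sqpos_le0 ?mulr0 // subr_le0 powRN.
rewrite ler_pdivlMr ?powR_gt0 // mul1r.
have -> : n.+1%:R^-1 = ((n.+1%:R^-1) `^ s^-1) `^ s :> R.
  by rewrite -powRrM mulVf ?gt_eqF // powRr1 // ltW.
apply: powR_le_base; rewrite ?(ltW s0) ?(ltW x0) //.
by move: xb; rewrite /b mulrC divfK // => /ltW.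
Qed.

Let psiE (n : nat) (x : R) : 0 < x -> psi n x = F n x.
Proof.
move=> x0; rewrite /psi; case: leP => // xb; rewrite F_0 // x0 /=.
by apply: (le_lt_trans xb); have := b0 n; lra.
Qed.

Let psi_C1 (n : nat) : exists f', C1on setT (psi n) f'.
Proof.
have h1 := C1on_comp (C1on_powR (- s)) (C1on_affine (- n.+1%:R^-1) 1).
have h2 := C1on_mul (C1on_powR s) (C1on_comp h1 (@C1on_sqpos R)).
apply: (@C1on_glue R (b n) (F n) _ (b0 n) _ (@F_0 n)).
move: h2; set f' := (f' in C1on _ _ f'); have -> : F n = (fun x => x `^ s) \*
    (@sqpos R \o ((fun x => - n.+1%:R^-1 * x + 1) \o (fun x => x `^ (- s)))).
  by apply/funext => x; rewrite /F /=; congr (_ * sqpos _); ring.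
exact.
Qed.

Let F_itv (n : nat) (x : R) : 0 < x -> x `^ s - n.+1%:R^-1 * 2 <= F n x <= x `^ s.
Proof.
move=> x0; have X0 : 0 < x `^ s by rewrite powR_gt0.
rewrite /F powRN; set u := n.+1%:R^-1 / x `^ s.
have u0 : 0 <= u by rewrite divr_ge0 // ltW.
have h1 : sqpos (1 - u) <= 1.
  have : sqpos (1 - u) <= sqpos 1 by apply: sqpos_le; lra.
  by rewrite [sqpos 1]sqpos_ge0E ?ler01 // expr1n.
have h2 : 1 - 2 * u <= sqpos (1 - u).
  by rewrite /sqpos; case: (leP (1 - u) 0) => h; nra.
rewrite ler_piMr ?(ltW X0) // andbT.
have -> : n.+1%:R^-1 = x `^ s * u by rewrite /u mulrC divfK // gt_eqF.
have := ler_wpM2l (ltW X0) h2; lra.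
Qed.

Let M (t : R) : R := nu t (fun x => x `^ s).

Let powU (r x : R) : 0 <= r -> U x -> 0 <= x `^ r <= 1.
Proof. by move=> r0 /Ux/andP[x0 x1]; rewrite powR_ge0 powR_le1 // (ltW x0). Qed.

Let psi_cvg (t : R) : 0 <= t -> nu t (psi n) @[n --> \oo] --> M t.
Proof.
move=> t0; apply: (sized_integral_cvg hmu0sup hmu (C := 1)) => //.
- move=> n; apply: measurable_funTS; apply: continuous_measurable_fun => x.
  by have [f' Hf] := psi_C1 n; exact: (C1on_continuous Hf I).
- move=> n x xU; have /andP[x0 x1] := Ux xU; rewrite psiE //.
  have /andP[_ h] := F_itv n x0; have /andP[_ h1] := powU (ltW s0) xU.
  by rewrite ger0_norm ?(le_trans h) // mulr_ge0 ?powR_ge0 ?sqpos_ge0.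
- move=> x xU; have /andP[x0 x1] := Ux xU.
  apply: (@squeeze_cvgr _ _ _ _ (fun n => x `^ s - n.+1%:R^-1 * 2) (cst (x `^ s))).
  + by apply: nearW => n; rewrite psiE //; exact: F_itv.
  + exact: cvg_sub_harmonic.
  + exact: cvg_cst.
Qed.

Hypothesis sa : 0 <= s + alpha.

Let arg0 (n : nat) (x : R) : 0 <= n.+1%:R^-1 * x `^ (- s).
Proof. by rewrite mulr_ge0 ?powR_ge0. Qed.

(** Both factors are nondecreasing: the power because [s + alpha >= 0], the other because [Q] is
    nonincreasing and its argument decreases with the size. *)
Let p_le (n : nat) (x y : R) : 0 < x -> x <= y -> p n x <= p n y.
Proof.
move=> x0 xy; have y0 := lt_le_trans x0 xy.
have /andP[q0 _] := Q_itv (arg0 n x).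
have h1 : x `^ (s + alpha) <= y `^ (s + alpha) by rewrite powR_le_base ?(ltW x0).
have h2 : Q (n.+1%:R^-1 * x `^ (- s)) <= Q (n.+1%:R^-1 * y `^ (- s)).
  apply: Q_le; first exact: arg0.
  rewrite ler_wpM2l // !powRN lef_pV2 ?posrE ?powR_gt0 //.
  by rewrite powR_le_base ?(ltW s0) ?(ltW x0).
exact: (ler_pM (powR_ge0 _ _) q0 h1 h2).
Qed.

Let p_ge0 (n : nat) (x : R) : 0 < x -> 0 <= p n x.
Proof. by move=> x0; have /andP[q0 _] := Q_itv (arg0 n x); rewrite mulr_ge0 ?powR_ge0. Qed.

Let p_ub (n : nat) (x : R) : U x -> `|p n x| <= phi s.
Proof.
move=> xU; have /andP[x0 _] := Ux xU; rewrite ger0_norm ?p_ge0 //.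
have /andP[q0 q1] := Q_itv (arg0 n x); have /andP[h0 h1] := powU sa xU.
by apply: le_trans q1; rewrite ler_piMl.
Qed.

Let mp (n : nat) : measurable_fun (U : set (measurableTypeR R)) (p n).
Proof.
by apply: measurable_nondecreasing_gt0; [move=> x y; exact: p_le|move=> x; exact: p_ge0].
Qed.

Let p_cvg (t : R) : 0 <= t ->
  nu t (p n) @[n --> \oo] --> phi s * nu t (fun x => x `^ (s + alpha)).
Proof.
move=> t0.
have -> : phi s * nu t (fun x => x `^ (s + alpha)) =
    nu t (fun x => x `^ (s + alpha) * phi s).
  rewrite /sized_integral -Rintegral_scale_real //.
    by apply: eq_Rintegral_real => x _; ring.
  apply: (sized_integral_int hmu0sup hmu (C := 1)) => //.
    by apply: measurable_funTS; exact: measurable_powR.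
  by move=> x xU; have /andP[h0 h1] := powU sa xU; rewrite ger0_norm.
apply: (sized_integral_cvg hmu0sup hmu (C := phi s)) => //.
move=> x _; apply: cvgM; first exact: cvg_cst.
by apply: Q_cvg; exact: powR_ge0.
Qed.

Let deriv (n : nat) (t : R) : 0 <= t ->
  has_derivative_nonneg (fun t => nu t (psi n)) t (- nu t (p n)).
Proof.
move=> t0; have [f' Hf] := psi_C1 n.
have psi0 x : x <= b n -> psi n x = 0 by move=> h; rewrite /psi h.
have := frag_derivative hmu0sup hmu (b0 n) t0 Hf psi0.
set l := (l in has_derivative_nonneg _ _ l).
suff -> : l = - nu t (p n) by [].
rewrite /l -mulN1r /sized_integral -Rintegral_scale_real //; last first.
  apply: (sized_integral_int hmu0sup hmu (C := phi s)) => // x; exact: p_ub.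
apply: eq_Rintegral_real => x xU; have /andP[x0 x1] := Ux xU.
have X0 : 0 < x `^ s by rewrite powR_gt0.
(* Homogeneity: [x^s x] factors out and leaves [dissip] at [e = eps x^(-s)] and [q = y^s], with
   [eps = 1/(n+1)]. *)
have -> : \int[B]_(y in D) (psi n (y * x) * (y * x) - psi n x * x * y) =
    \int[B]_(y in D) ((- (x `^ s * x)) * (y * dissip (n.+1%:R^-1 * x `^ (- s)) (y `^ s))).
  apply: eq_Rintegral_real => y yD; have /andP[y0 y1] := Dx yD.
  have Y0 : 0 < y `^ s by rewrite powR_gt0.
  rewrite !psiE ?mulr_gt0 // /F powRM ?ltW // !powRN /dissip powRM ?(ltW x0) ?(ltW y0) //.
  have -> : n.+1%:R^-1 / (y `^ s * x `^ s) = n.+1%:R^-1 / x `^ s / y `^ s.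
    by rewrite invfM [(y `^ s)^-1 * _]mulrC mulrA.
  by ring.
rewrite Rintegral_scale_real //; last exact: iQ.
rewrite /p powRD; last by rewrite (gt_eqF x0) implybT.
rewrite -/(Q _); ring.
Qed.

(** For each [n] the increment is [t - T] times the integral of [p n] at an unknown time [c]. As
    [p n] is nondecreasing in the size, that integral lies between those at [t] and [T], and the
    limit in [n] keeps both bounds. *)
Lemma frag_moment_incr (T t : R) : 0 <= T -> T <= t ->
  (t - T) * (phi s * nu t (fun x => x `^ (s + alpha))) <= M T - M t <=
  (t - T) * (phi s * nu T (fun x => x `^ (s + alpha))).
Proof.
move=> T0; rewrite le_eqVlt => /predU1P[<-|Tt]; first by rewrite !subrr !mul0r lexx.
have t0 : 0 <= t := le_trans T0 (ltW Tt).
have tT0 : 0 <= t - T by rewrite subr_ge0 ltW.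
have step n : (t - T) * nu t (p n) <= nu T (psi n) - nu t (psi n) <=
    (t - T) * nu T (p n).
  have [c /andP[Tc ct] E] := has_derivative_nonneg_MVT (fun s s0 => @deriv n s s0) T0 Tt.
  have -> : nu T (psi n) - nu t (psi n) = (t - T) * nu c (p n).
    by rewrite -opprB E mulrN opprK.
  have c0 := le_trans T0 Tc.
  have L u v : 0 <= u -> u <= v -> nu v (p n) <= nu u (p n).
    move=> u0 uv; apply: (sized_integral_le hmu0sup hmu u0 uv).
      by move=> x y; exact: p_le.
    by move=> x; exact: p_ge0.
  by rewrite (ler_wpM2l tT0 (L c t c0 ct)) (ler_wpM2l tT0 (L T c T0 Tc)).
have cvD : nu T (psi n) - nu t (psi n) @[n --> \oo] --> M T - M t.
  by apply: cvgB; exact: psi_cvg.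
have cvP u : 0 <= u -> (t - T) * nu u (p n) @[n --> \oo] -->
    (t - T) * (phi s * nu u (fun x => x `^ (s + alpha))).
  by move=> u0; apply: cvgM; [exact: cvg_cst|exact: p_cvg].
apply/andP; split.
  by apply: (ler_cvg_to (cvP t t0) cvD); apply: nearW => n; have /andP[] := step n.
by apply: (ler_cvg_to cvD (cvP T T0)); apply: nearW => n; have /andP[] := step n.
Qed.

End OneMoment.

(** * Bounds on moments, and the chain they form *)

Hypothesis hBpos : (0 < B D)%E.

Let powU (r x : R) : 0 <= r -> U x -> 0 <= x `^ r <= 1.
Proof. by move=> r0 /Ux/andP[x0 x1]; rewrite powR_ge0 powR_le1 // (ltW x0). Qed.

Let int_powU (r t : R) : 0 <= r -> 0 <= t ->
  (mu t).-integrable U (EFin \o (fun x : R => x `^ r * x)).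
Proof.
move=> r0 t0; apply: (sized_integral_int hmu0sup hmu (C := 1)) => //.
  by apply: measurable_funTS; exact: measurable_powR.
by move=> x xU; have /andP[h0 h1] := powU r0 xU; rewrite ger0_norm.
Qed.

Definition frag_moment (s t : R) : R := nu t (fun x => x `^ s).

Lemma frag_moment_0 (t : R) : 0 <= t -> frag_moment 0 t = total_mass mu t.
Proof.
move=> t0; rewrite (frag_mass hmu0sup hmu t0).
by apply: eq_Rintegral_real => x _; rewrite powRr0.
Qed.

Lemma frag_moment_ge0 (s t : R) : 0 <= frag_moment s t.
Proof.
by apply: Rintegral_ge0_real => x /Ux/andP[x0 _]; rewrite mulr_ge0 ?powR_ge0 // ltW.
Qed.

Lemma frag_moment_le (s T t : R) : 0 <= s -> 0 <= T -> T <= t ->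
  frag_moment s t <= frag_moment s T.
Proof.
move=> s0 T0 Tt; apply: (sized_integral_le hmu0sup hmu T0 Tt).
  by move=> x y x0 xy; rewrite powR_le_base // ltW.
by move=> x _; exact: powR_ge0.
Qed.

Lemma frag_moment_le1 (s t : R) : 0 <= s -> 0 <= t -> frag_moment s t <= 1.
Proof.
move=> s0 t0; apply: (@le_trans _ _ (\int[mu t]_(x in U) x)).
  apply: le_Rintegral_real => //; [exact: int_powU|exact: (frag_integrable_id hmu0sup hmu t0)|].
  move=> x xU; have /andP[x0 _] := Ux xU; have /andP[_ h] := powU s0 xU.
  by rewrite ler_piMl // ltW.
rewrite -(frag_Rintegral hmu0sup hmu (fun x => x) t0).
have [_ _ hb _] := hmu; have [+ h1] := hb t t0; rewrite h1 => h.
rewrite /Rintegral -[leRHS]/(fine 1%E); apply: fine_le => //.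
rewrite ge0_fin_numE; first exact: le_lt_trans h (ltry 1).
by apply: integral_ge0 => x; rewrite /= in_itv /= andbT lee_fin => /ltW.
Qed.

Lemma frag_moment_exp_le (s r t : R) : 0 <= s -> s <= r -> 0 <= t ->
  frag_moment r t <= frag_moment s t.
Proof.
move=> s0 sr t0; have r0 := le_trans s0 sr.
apply: le_Rintegral_real => //; [exact: int_powU|exact: int_powU|].
move=> x xU; have /andP[x0 _] := Ux xU.
have /andP[_ h] : 0 <= x `^ (r - s) <= 1 by apply: powU; rewrite ?subr_ge0.
rewrite ler_wpM2r ?(ltW x0) // -(subrK s r) powRD ?(gt_eqF x0) ?implybT //.
by rewrite ler_piMl // powR_ge0.
Qed.

(** Initial sizes in []1 - d, 1]] carry positive mass because the supremum of the support is 1, and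
    each contributes a factor at least [(1 - d)^s]. As [d] is arbitrary, initial moments decay
    slower than any exponential. *)
Lemma frag_moment0_ge (d : R) : 0 < d < 1 ->
  exists2 c : R, 0 < c & forall s, 0 <= s -> c * (1 - d) `^ s <= frag_moment s 0.
Proof.
move=> /andP[d0 d1]; pose q (x : R) : R := (1 - d < x)%R%:R.
have iq : (mu 0).-integrable U (EFin \o (fun x : R => q x * x)).
  apply: (sized_integral_int hmu0sup hmu (C := 1)) => //.
    apply: nondecreasing_measurable => // x y xy; rewrite /q ler_nat.
    by case: (ltP (1 - d) x) => // dx; rewrite (lt_le_trans dx xy).
  by move=> x _; rewrite /q; case: (_ < x); rewrite ?normr1 ?normr0.
exists (nu 0 q).
  apply: (@Rintegral_gt0_real _ _ _ mU (`](1 - d)%R, 1%R]%classic : set R)) => //.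
  - by move=> x /Ux/andP[x0 _]; rewrite mulr_ge0 // ltW.
  - move=> x; rewrite /= !in_itv /= => /andP[dx x1]; rewrite x1 andbT.
    by apply: lt_trans dx; lra.
  - move=> x; rewrite /= in_itv /= => /andP[dx x1]; rewrite /q dx mul1r.
    by apply: lt_trans dx; lra.
  have mA : measurable (`](1 - d)%R, 1%R]%classic : set (measurableTypeR R)).
    exact: measurable_itv.
  have [[_ h0] _ _ _] := hmu; rewrite (h0 _ mA).
  by have [_] := hmu0sup; apply; rewrite d0.
move=> s s0; rewrite mulrC /frag_moment /sized_integral -Rintegral_scale_real //.
apply: le_Rintegral_real => //; [exact: integrable_scale_real|exact: int_powU|].
move=> x /Ux/andP[x0 x1]; rewrite mulrA ler_wpM2r ?(ltW x0) // /q.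
case: (ltP (1 - d) x) => dx; last by rewrite mulr0 powR_ge0.
rewrite mulr1 powR_le_base //; first by lra.
exact: ltW.
Qed.

Let a := - alpha.
Let a0 : 0 < a. Proof. by rewrite oppr_gt0. Qed.

Definition frag_prod (k : nat) : R := \prod_(i < k) phi (i.+1%:R * a).

Lemma frag_prod_gt0 (k : nat) : 0 < frag_prod k.
Proof.
by apply: prodr_gt0 => i _; apply: frag_phi_gt0 => //; rewrite mulr_gt0.
Qed.

(** The exponents are multiples of [a] because [(k + 1) a + alpha = k a]; dividing by [frag_prod]
    absorbs the factor [phi ((k + 1) a)] of the increment bound. *)
Lemma frag_chain : chain (fun k t => frag_moment (k%:R * a) t / frag_prod k).
Proof.
have ka0 (k : nat) : 0 <= k%:R * a by rewrite mulr_ge0 // ltW.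
split.
- by move=> k t _; rewrite divr_ge0 ?frag_moment_ge0 // ltW // frag_prod_gt0.
- move=> k T t T0 Tt; rewrite ler_wpM2r ?frag_moment_le //.
  by rewrite invr_ge0 ltW // frag_prod_gt0.
move=> k T t T0 Tt.
have s0 : 0 < k.+1%:R * a by rewrite mulr_gt0.
have E : k.+1%:R * a + alpha = k%:R * a by rewrite /a -natr1; ring.
have := @frag_moment_incr (k.+1%:R * a) s0 _ T t T0 Tt; rewrite E => /(_ (ka0 k)).
have P0 := frag_prod_gt0 k; have F0 : 0 < phi (k.+1%:R * a) by apply: frag_phi_gt0.
have -> : frag_prod k.+1 = frag_prod k * phi (k.+1%:R * a).
  by rewrite /frag_prod big_ord_recr.
rewrite -/(frag_moment _ T) -/(frag_moment _ t) -/(frag_moment _ T) -/(frag_moment _ t).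
move: (frag_prod k) (phi _) P0 F0 => P F P0 F0.
have e u : (t - T) * (u / P) = (t - T) * (F * u) / (P * F).
  by field; rewrite (gt_eqF P0) (gt_eqF F0).
rewrite !e -mulrBl => /andP[h1 h2].
by rewrite !ler_pM2r ?invr_gt0 ?mulr_gt0 // h1 h2.
Qed.

End FragmentationMoments.

(** * Sums of logarithms *)

Lemma ln_mul_le (R : realType) (C e : R) : 0 <= C -> 0 < e ->
  exists K : nat, forall k : nat, (K <= k)%N -> C + C * ln k%:R <= e * k%:R.
Proof.
move=> C0 e0; pose c := 2 * (C + 1) / e.
have c0 : 0 < c by rewrite divr_gt0 // mulr_gt0 // ltr_wpDl.
pose K0 := (C + C * `|ln c|) * 2 / e.
exists (Num.truncn K0).+1 => k Kk.
have k0 : 0 < k%:R :> R by rewrite ltr0n (leq_trans _ Kk).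
have kK : K0 < k%:R by apply: lt_le_trans (truncnS_gt _) _; rewrite ler_nat.
have hK : (C + C * `|ln c|) * 2 < k%:R * e by rewrite -ltr_pdivrMr.
have h : ln k%:R <= k%:R / c + `|ln c|.
  have kc0 : 0 < k%:R / c by rewrite divr_gt0.
  have -> : ln k%:R = ln (k%:R / c) + ln c.
    by rewrite -lnM ?posrE // divfK // gt_eqF.
  by rewrite lerD ?ler_norm // ltW // ln_sublinear.
have h2 := ler_wpM2l C0 h.
have h3 : C * (k%:R / c) <= e / 2 * k%:R.
  have -> : C * (k%:R / c) = C / (C + 1) * (e / 2 * k%:R).
    by rewrite /c; field; rewrite (gt_eqF e0) /= gt_eqF // ltr_wpDl.
  rewrite ler_piMl ?mulr_ge0 ?divr_ge0 ?(ltW e0) ?(ltW k0) //.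
  by rewrite ler_pdivrMr ?mul1r ?lerDl // ltr_wpDl.
lra.
Qed.

(* That is, k ln k - ln k! = k + O(ln k). *)
Lemma stirling_sum_itv (R : realType) (k : nat) :
  (k.+1%:R : R) - 1 - ln (k.+1%:R : R) <= \sum_(i < k.+1) (ln (k.+1%:R : R) - ln (i.+1%:R : R)) <= (k.+1%:R : R).
Proof.
elim: k => [|k]; first by rewrite big_ord1 ln1 !subrr ?subr0 lexx ler01.
set Tk := \sum_(i < k.+1) _ => /andP[h1 h2].
have N0 : 0 < k.+1%:R :> R by rewrite ltr0n.
have N1 : 0 < k.+2%:R :> R by rewrite ltr0n.
have N2 : k.+2%:R = k.+1%:R + 1 :> R by rewrite natr1.
pose d : R := ln k.+2%:R - ln k.+1%:R.
have -> : \sum_(i < k.+2) (ln (k.+2%:R : R) - ln (i.+1%:R : R)) = Tk + k.+1%:R * d.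
  have <- : \sum_(i < k.+1) d = k.+1%:R * d by rewrite sumr_const card_ord mulr_natl.
  rewrite big_ord_recr /= subrr addr0 /Tk -big_split /=.
  by apply: eq_bigr => i _; rewrite /d; ring.
have d1 : k.+1%:R * d <= 1.
  have : d <= k.+1%:R^-1.
    rewrite /d -ln_div ?posrE //.
    have -> : k.+2%:R / k.+1%:R = 1 + k.+1%:R^-1 :> R by rewrite N2 mulrDl divff ?gt_eqF // mul1r.
    by apply: le_ln1Dx; apply: (@lt_trans _ _ 0); rewrite ?invr_gt0 // oppr_lt0.
  by move=> /(ler_wpM2l (ltW N0)); rewrite divff ?gt_eqF.
have d2 : 1 <= k.+2%:R * d.
  have : - d <= - k.+2%:R^-1.
    rewrite /d opprB -ln_div ?posrE //.
    have -> : k.+1%:R / k.+2%:R = 1 + - k.+2%:R^-1 :> R.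
      by rewrite -[k.+1%:R](addrK 1) -N2 mulrDl divff ?gt_eqF // mulN1r.
    by apply: le_ln1Dx; rewrite ltrN2 invf_lt1 // ltr1n.
  by rewrite lerN2 => /(ler_wpM2l (ltW N1)); rewrite divff ?gt_eqF.
have e1 : k.+2%:R * d = k.+1%:R * d + d by rewrite N2 mulrDl mul1r.
have e2 : ln k.+2%:R = ln k.+1%:R + d by rewrite /d addrC subrK.
rewrite e2; move: d1 d2; rewrite e1 N2 => d1 d2.
by apply/andP; split; lra.
Qed.

(* Potter's bounds, in logarithmic coordinates. *)
Lemma potter (R : realType) (h : R -> R) (l e : R) : 0 < e -> e <= l -> l <= 1 ->
  (forall u v, u <= v -> h u <= h v) ->
  (forall c, 0 < c -> h (u + c) - h u @[u --> +oo] --> l * c) ->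
  exists u0 : R, forall u v, u0 <= u -> u <= v ->
    h u + (l - e) * (v - u) - e <= h v <= h u + (l + e) * (v - u) + e.
Proof.
(* A step of length [c = e / 2] changes the affine bounds by at most [e], because [l + e <= 2];
   between grid points the monotonicity of [h] suffices. *)
move=> e0 el l1 hle hlim; pose c := e / 2.
have c0 : 0 < c by rewrite divr_gt0.
have /cvgrPdist_le /(_ (e * c) (mulr_gt0 e0 c0)) [u0 [_ Hu0]] := hlim c c0.
exists (u0 + 1) => u v uu0 uv.
have step w : u0 + 1 <= w -> h w + (l - e) * c <= h (w + c) <= h w + (l + e) * c.
  move=> ww; have : u0 < w by lra.
  move=> /Hu0; rewrite ler_norml => /andP[]; move: (h (w + c)) (h w) => x y; nra.
have iter n : h u + (l - e) * (n%:R * c) <= h (u + n%:R * c) <= h u + (l + e) * (n%:R * c).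
  elim: n => [|n IH]; first by rewrite !mul0r !mulr0 !addr0 lexx.
  have -> : u + n.+1%:R * c = (u + n%:R * c) + c by rewrite -natr1; ring.
  have : 0 <= n%:R * c by rewrite mulr_ge0 // ltW.
  move=> nc; have uw : u0 + 1 <= u + n%:R * c by lra.
  have /andP[s1 s2] := step _ uw.
  have -> : n.+1%:R * c = n%:R * c + c by rewrite -[n.+1]addn1 natrD mulrDl mul1r.
  move: IH => /andP[i1 i2].
  by apply/andP; split; lra.
have vu0 : 0 <= (v - u) / c by rewrite divr_ge0 ?(ltW c0) // subr_ge0.
have /andP[n1 n2] := truncn_itv vu0.
move: (Num.truncn _) n1 n2 => n; rewrite ler_pdivlMr // ltr_pdivrMr // => n1 n2.
have /andP[i1 _] := iter n; have /andP[_ i2] := iter n.+1.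
have h1 : h (u + n%:R * c) <= h v by apply: hle; lra.
have h2 : h v <= h (u + n.+1%:R * c) by apply: hle; lra.
have k1 : (l - e) * (v - u) <= (l - e) * (n%:R * c) + (l - e) * c.
  by rewrite -mulrDr ler_wpM2l ?subr_ge0 //; move: n2; rewrite -natr1 mulrDl mul1r; lra.
have k2 : (l + e) * (n.+1%:R * c) <= (l + e) * (v - u) + (l + e) * c.
  rewrite -mulrDr ler_wpM2l //; first by lra.
  by rewrite -natr1 mulrDl mul1r; lra.
have k3 : (l + e) * c <= e by rewrite /c; nra.
have k4 : (l - e) * c <= e by rewrite /c; nra.
by apply/andP; split; lra.
Qed.

Section LogSums.
Context (R : realType) (phi : R -> R) (beta a : R).
Hypothesis a0 : 0 < a.
Hypothesis hbeta : 0 <= beta < 1.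
Hypothesis phi_gt0 : forall x : R, 0 < x -> 0 < phi x.
Hypothesis phi_le : forall x y : R, 0 < x -> x <= y -> phi x <= phi y.
Hypothesis phi_conv : forall x y : R, 0 < x -> x <= y -> x * phi y <= y * phi x.
Hypothesis phi_scale : forall c : R, 0 < c ->
  phi (c * x) / phi x @[x --> +oo] --> c `^ beta.

Let g (x : R) : R := x / phi x.
Let l : R := 1 - beta.

Lemma g_gt0 (x : R) : 0 < x -> 0 < g x.
Proof. by move=> x0; rewrite divr_gt0 // phi_gt0. Qed.

Lemma g_le (x y : R) : 0 < x -> x <= y -> g x <= g y.
Proof.
move=> x0 xy; have y0 := lt_le_trans x0 xy.
by rewrite /g ler_pdivrMr ?phi_gt0 // mulrAC ler_pdivlMr ?phi_gt0 // phi_conv.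
Qed.

Lemma g_ub (x y : R) : 0 < x -> x <= y -> g y <= y / x * g x.
Proof.
move=> x0 xy; have y0 := lt_le_trans x0 xy.
rewrite /g mulrA divfK ?gt_eqF // ler_wpM2l ?(ltW y0) //.
by rewrite lef_pV2 ?posrE ?phi_gt0 // phi_le.
Qed.

Lemma g_scale (c : R) : 0 < c -> g (c * x) / g x @[x --> +oo] --> c `^ l.
Proof.
move=> c0.
have -> : c `^ l = c * (c `^ beta)^-1.
  by rewrite /l powRB ?powRr1 ?(ltW c0) // (gt_eqF c0) implybT.
have cb0 : c `^ beta != 0 by rewrite gt_eqF // powR_gt0.
have : c * (phi (c * x) / phi x)^-1 @[x --> +oo] --> c * (c `^ beta)^-1.
  by apply: cvgM; [exact: cvg_cst|apply: cvgV => //; exact: phi_scale].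
apply: cvg_trans; apply: near_eq_cvg; near=> x.
have x0 : 0 < x by near: x; exact: nbhs_pinfty_gt.
have := phi_gt0 x0; have := phi_gt0 (mulr_gt0 c0 x0) => p1 p2.
by rewrite /g; field; rewrite !gt_eqF.
Unshelve. all: by end_near. Qed.

Let h (u : R) : R := ln (g (expR u)).

Let h_le (u v : R) : u <= v -> h u <= h v.
Proof.
move=> uv; rewrite /h ler_ln ?posrE ?g_gt0 ?expR_gt0 //.
by rewrite g_le ?expR_gt0 // ler_expR.
Qed.

Let h_lim (c : R) : 0 < c -> h (u + c) - h u @[u --> +oo] --> l * c.
Proof.
move=> c0; have ec0 := expR_gt0 c.
have el : ln (expR c `^ l) = l * c by rewrite ln_powR expRK.
have p0 : 0 < expR c `^ l by rewrite powR_gt0.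
have hg : ln (g (expR c * x) / g x) @[x --> +oo] --> l * c.
  rewrite -el; apply: (cvg_comp _ _ (g_scale ec0)).
  exact: continuous_ln p0.
have : ln (g (expR c * expR u) / g (expR u)) @[u --> +oo] --> l * c.
  apply: (@cvg_comp _ _ _ (@expR R) (fun x => ln (g (expR c * x) / g x))) hg.
  apply/cvgryPge => A; near=> u; apply: (le_trans _ (expR_ge1Dx u)).
  rewrite -lerBlDl; near: u; apply: nbhs_pinfty_ge; exact: num_real.
apply: cvg_trans; apply: near_eq_cvg; near=> u.
have gu := g_gt0 (expR_gt0 u); have guc := g_gt0 (mulr_gt0 ec0 (expR_gt0 u)).
by rewrite /h expRD [expR u * _]mulrC ln_div ?posrE.
Unshelve. all: by end_near. Qed.

(** [exp (- log_sum k)] is the product of the [g (i a)], [1 <= i <= k], divided by [g (k a)^k]: the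
    factor left by Markov's inequality when [a t = g (k a)]. *)
Definition log_sum (k : nat) : R :=
  \sum_(i < k) (ln (g (k%:R * a)) - ln (g (i.+1%:R * a))).

(** Potter's bounds compare the [i]-th term with [l (ln k - ln (i + 1))], and these sum to about
    [l k] by [stirling_sum_itv]. The finitely many indices below [N] cost at most [N ln k]. *)
Lemma log_sum_itv (e : R) : 0 < e -> exists K : nat, forall k : nat, (K <= k)%N ->
  (l - e) * k%:R <= log_sum k <= (l + e) * k%:R.
Proof.
move=> e0; have /andP[be0 be1] := hbeta.
have l0 : 0 < l by rewrite subr_gt0.
have l1 : l <= 1 by rewrite /l gerBl.
(* Three errors of size [e' k]: the slope and the additive constant in Potter's bounds, and the
   logarithmic remainder. *)
pose e' := Num.min (e / 3) l.
have e'0 : 0 < e' by rewrite lt_min l0 divr_gt0.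
have e'l : e' <= l by rewrite ge_min lexx orbT.
have e'e : e' * 3 <= e by rewrite -ler_pdivlMr // ge_min lexx.
have [u0 Hu0] := potter e'0 e'l l1 h_le h_lim.
pose N := (Num.truncn (expR u0 / a)).+1.
have Nu (i : nat) : (N <= i)%N -> u0 <= ln (i%:R * a).
  move=> Ni; have i0 : 0 < i%:R :> R by rewrite ltr0n (leq_trans _ Ni).
  rewrite -ler_expR lnK ?posrE ?mulr_gt0 // -ler_pdivrMr //.
  by apply: (le_trans (ltW (truncnS_gt _))); rewrite ler_nat.
have [K HK] := @ln_mul_le R (N%:R + 1) e' (addr_ge0 (ler0n _ _) ler01) e'0.
exists (maxn K 1) => k; rewrite geq_max => /andP[/HK hk k0].
have k1 : 0 < k%:R :> R by rewrite ltr0n.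
have lnk0 : 0 <= ln k%:R :> R by rewrite ln_ge0 // ler1n.
pose D (i : nat) : R := ln k%:R - ln i.+1%:R.
pose L (i : nat) : R := ln (g (k%:R * a)) - ln (g (i.+1%:R * a)).
have D_itv i : (i < k)%N -> 0 <= D i <= ln k%:R.
  move=> ik; rewrite subr_ge0 ler_ln ?posrE ?ltr0n // ler_nat ik /=.
  by rewrite gerBl ln_ge0 // ler1n.
have hE (i : nat) : (0 < i)%N -> ln (g (i%:R * a)) = h (ln (i%:R * a)).
  by move=> i0; rewrite /h lnK // posrE mulr_gt0 // ltr0n.
have L_small i : (i < k)%N -> 0 <= L i <= D i.
  move=> ik; have i0 : 0 < i.+1%:R * a by rewrite mulr_gt0.
  have ia : i.+1%:R * a <= k%:R * a by rewrite ler_wpM2r ?(ltW a0) // ler_nat.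
  have ka0 : 0 < k%:R * a by rewrite mulr_gt0.
  have gk := g_gt0 ka0; have gi := g_gt0 i0.
  have q0 : 0 < k%:R / i.+1%:R :> R by rewrite divr_gt0.
  rewrite subr_ge0 ler_ln ?posrE // g_le //=.
  rewrite lerBlDr /D -ln_div ?posrE // -lnM ?posrE //.
  rewrite ler_ln ?posrE //; last exact: mulr_gt0.
  have := g_ub i0 ia; have -> : k%:R * a / (i.+1%:R * a) = k%:R / i.+1%:R.
    by rewrite -mulf_div divff ?gt_eqF // mulr1.
  by [].
have L_big i : (i < k)%N -> (N <= i.+1)%N ->
    (l - e') * D i - e' <= L i <= (l + e') * D i + e'.
  move=> ik Ni; have := Hu0 _ (ln (k%:R * a)) (Nu _ Ni).
  have ka0 : 0 < k%:R * a by rewrite mulr_gt0.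
  have i0 : 0 < i.+1%:R * a by rewrite mulr_gt0.
  have ia : i.+1%:R * a <= k%:R * a by rewrite ler_wpM2r ?(ltW a0) // ler_nat.
  rewrite ler_ln ?posrE // => /(_ ia); rewrite -!hE //.
  have -> : ln (k%:R * a) - ln (i.+1%:R * a) = D i.
    by rewrite /D !lnM ?posrE //; ring.
  by rewrite /L => /andP[h1 h2]; apply/andP; split; lra.
pose small (i : nat) : R := (i < N)%N%:R * ln k%:R.
have L_all i : (i < k)%N ->
    (l - e') * D i - e' - small i <= L i <= (l + e') * D i + e' + small i.
  move=> ik; rewrite /small; have /andP[d0 d1] := D_itv i ik.
  case: (ltnP i N) => iN; last first.
    by rewrite mul0r subr0 addr0 L_big // (leq_trans iN).
  have /andP[s0 s1] := L_small i ik; rewrite mul1r; apply/andP; split; last by nra.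
  have : (l - e') * D i <= D i by rewrite ler_piMl //; lra.
  lra.
have sD : \sum_(i < k) D i = \sum_(i < k) (ln k%:R - ln i.+1%:R) by [].
have := stirling_sum_itv R k.-1; rewrite prednK // -sD => /andP[T1 T2].
have sS : \sum_(i < k) small i <= N%:R * ln k%:R.
  rewrite -mulr_suml ler_wpM2r //.
  have -> : \sum_(i < k) (i < N)%N%:R = (\sum_(i < k) (i < N)%N)%:R :> R by rewrite natr_sum.
  rewrite ler_nat; elim: {k0 k1 hk D L D_itv L_small L_big L_all lnk0 small T1 T2 sD} k => [|k IH].
    by rewrite big_ord0.
  rewrite big_ord_recr /=; case: (ltnP k N) => kN; last by rewrite addn0.
  apply: leq_trans kN; rewrite addn1 ltnS.
  apply: (leq_trans (leq_sum _ (fun i _ => leq_b1 _))).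
  by rewrite sum_nat_const card_ord muln1.
have sc : \sum_(i < k) e' = k%:R * e' by rewrite sumr_const card_ord mulr_natl.
have lo : (l - e') * \sum_(i < k) D i - k%:R * e' - \sum_(i < k) small i <= log_sum k.
  rewrite mulr_sumr -sc -!sumrB; apply: ler_sum => i _.
  by have /andP[] := L_all i (ltn_ord i).
have hi : log_sum k <= (l + e') * \sum_(i < k) D i + k%:R * e' + \sum_(i < k) small i.
  rewrite mulr_sumr -sc -!big_split; apply: ler_sum => i _.
  by have /andP[] := L_all i (ltn_ord i).
move: T1 T2 sS lo hi; move: (\sum_(i < k) D i) (\sum_(i < k) small i) => SD SS T1 T2 sS lo hi.
have b1 : (l + e') * SD <= (l + e') * k%:R by rewrite ler_wpM2l //; lra.
have b2 : (l - e') * (k%:R - 1 - ln k%:R) <= (l - e') * SD by rewrite ler_wpM2l // subr_ge0.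
have b3 : (l - e') * (1 + ln k%:R) <= 1 + ln k%:R.
  by rewrite ler_piMl //; lra.
have hNk : (0 : R) <= N%:R * ln k%:R by rewrite mulr_ge0.
have hN0 : (0 : R) <= N%:R by [].
have b4 : e' * 3 * k%:R <= e * k%:R by rewrite ler_wpM2r // ltW.
by apply/andP; split; lra.
Qed.

End LogSums.

(** * Asymptotics of the mass *)

Section Asymptotics.
Context (R : realType) (phi : R -> R) (beta a : R) (J : nat -> R -> R) (M : nat -> R).
Hypothesis a0 : 0 < a.
Hypothesis hbeta : 0 <= beta < 1.
Hypothesis phi_gt0 : forall x : R, 0 < x -> 0 < phi x.
Hypothesis phi_le : forall x y : R, 0 < x -> x <= y -> phi x <= phi y.
Hypothesis phi_conv : forall x y : R, 0 < x -> x <= y -> x * phi y <= y * phi x.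
Hypothesis phi_scale : forall c : R, 0 < c ->
  phi (c * x) / phi x @[x --> +oo] --> c `^ beta.
Hypothesis cJ : chain J.
Hypothesis hJ : forall k, J k 0 = M k / \prod_(i < k) phi (i.+1%:R * a).
Hypothesis M_le1 : forall k, M k <= 1.
Hypothesis M_ge : forall e : R, 0 < e ->
  exists2 c : R, 0 < c & forall k : nat, c * expR (- e * k%:R) <= M k.

Let g (x : R) : R := x / phi x.
Let l : R := 1 - beta.
Let g_gt0 (x : R) : 0 < x -> 0 < g x. Proof. exact: g_gt0. Qed.
Let g_le (x y : R) : 0 < x -> x <= y -> g x <= g y. Proof. exact: g_le. Qed.
Let g_ub (x y : R) : 0 < x -> x <= y -> g y <= y / x * g x. Proof. exact: g_ub. Qed.
Let ka (k : nat) : (0 < k)%N -> 0 < k%:R * a.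
Proof. by move=> k0; rewrite mulr_gt0 // ltr0n. Qed.

Let P (k : nat) : R := \prod_(i < k) g (i.+1%:R * a).

Let P_gt0 (k : nat) : 0 < P k.
Proof. by apply: prodr_gt0 => i _; apply: g_gt0; exact: ka. Qed.

(** Formally the [k]-th moment of [a I]: the factors [i a] of [a^k k!] turn each [1 / phi (i a)]
    into [g (i a)]. *)
Let factJ (k : nat) : a ^+ k * (k`!%:R * J k 0) = M k * P k.
Proof.
rewrite hJ; suff -> : P k = a ^+ k * k`!%:R / \prod_(i < k) phi (i.+1%:R * a).
  by ring.
elim: k => [|k IH]; first by rewrite /P !big_ord0 expr0 fact0 !mul1r invr1.
rewrite /P !big_ord_recr /= -/(P k) IH exprS factS natrM /g.
have p1 : 0 < phi (k.+1%:R * a) by apply: phi_gt0; exact: ka.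
have p2 : 0 < \prod_(i < k) phi (i.+1%:R * a).
  by apply: prodr_gt0 => i _; apply: phi_gt0; exact: ka.
by field; rewrite !gt_eqF.
Qed.

Let P_log (k : nat) : (0 < k)%N -> P k = g (k%:R * a) ^+ k * expR (- log_sum phi a k).
Proof.
move=> k0; have G0 := g_gt0 (ka k0).
have -> : - log_sum phi a k =
    \sum_(i < k) (ln (g (i.+1%:R * a)) - ln (g (k%:R * a))).
  by rewrite /log_sum -sumrN; apply: eq_bigr => i _; rewrite opprB.
have -> : g (k%:R * a) ^+ k = \prod_(i < k) g (k%:R * a) by rewrite prodr_const card_ord.
rewrite expR_sum -big_split /=.
apply: eq_bigr => i _; have Gi := g_gt0 (ka (ltn0Sn i)).
by rewrite expRD expRN !lnK ?posrE // mulrCA divff ?gt_eqF // mulr1.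
Qed.

Lemma chain_mass_le (k : nat) (t : R) : (0 < k)%N -> g (k%:R * a) <= a * t ->
  J 0%N t <= expR (- log_sum phi a k).
Proof.
move=> k0 gt; have G0 := g_gt0 (ka k0).
have at0 : 0 < a * t := lt_le_trans G0 gt.
have t0 : 0 < t by rewrite -(pmulr_rgt0 _ a0).
have := chain_pow_le cJ k (lexx 0) (ltW t0); rewrite subr0 => h.
have h2 := ler_wpM2l (exprn_ge0 k (ltW a0)) h.
rewrite factJ mulrA -exprMn in h2.
have h3 : M k * P k <= P k by rewrite ler_piMl // ltW.
have atk : 0 < (a * t) ^+ k by rewrite exprn_gt0.
rewrite -(ler_pM2l atk); apply: (le_trans h2); apply: (le_trans h3).
rewrite P_log // ler_wpM2r ?expR_ge0 //.
by rewrite lerXn2r ?nnegrE ?(ltW G0) ?(ltW at0).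
Qed.

Let P_step_ge (p n : nat) (c : R) : 0 <= c ->
  (forall i, (p <= i)%N -> c <= g (i.+1%:R * a)) -> P p * c ^+ n <= P (p + n).
Proof.
move=> c0 H; elim: n => [|n IH]; first by rewrite expr0 mulr1 addn0.
rewrite exprSr addnS /P big_ord_recr /= -/(P _) mulrA.
apply: ler_pM => //; last exact: H (leq_addr _ _).
by rewrite mulr_ge0 ?exprn_ge0 // ltW.
Qed.

Let P_step_le (p n : nat) (c : R) :
  (forall i, (i < p + n)%N -> g (i.+1%:R * a) <= c) -> P (p + n) <= P p * c ^+ n.
Proof.
elim: n => [|n IH] H; first by rewrite expr0 mulr1 addn0.
rewrite exprSr addnS /P big_ord_recr /= -/(P _) mulrA.
rewrite ler_pM ?(ltW (P_gt0 _)) //.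
- by rewrite ltW // g_gt0 // ka.
- by apply: IH => i ip; apply: H; rewrite addnS ltnW.
- by apply: H; rewrite addnS.
Qed.

(** With [G = g (k a)], the [k]-th moment is split at [exp (-e) G / a] and [exp e G / a], with
    exponents [k - n] and [k + n], [n] about [d k]. Between these indices [g] differs from [G] by a
    factor at most [exp (e / 2)], so each outer part is at most [q = exp (- n e / 2)] times [P k],
    whereas [M k >= 4 q]. *)
Lemma chain_mass_ge (e : R) : 0 < e -> exists K : nat, forall (k : nat) (t : R),
  (K <= k)%N -> 0 <= t -> a * t <= expR (- e) * g (k%:R * a) ->
  expR (- log_sum phi a k - 3 * e * k%:R) <= J 0%N t.
Proof.
(* Chosen so that [1 - d = 1 / (1 + e / 2)]. *)
move=> e0; pose d := e / (2 + e).
have d0 : 0 < d by rewrite divr_gt0 // addr_gt0.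
have d1 : d < 1 by rewrite ltr_pdivrMr ?addr_gt0 // mul1r ltrDr.
(* [q] decays at rate [e d / 2] in [k]: half of it is spent on the lower bound for [M k], half on
   the constant [C], which collects [ln c], the rounding of [n], and the factor 4 through
   [ln 4 <= 4]. *)
have ed0 : 0 < e * d / 4 by rewrite divr_gt0 // mulr_gt0.
have [c c0 Hc] := M_ge ed0.
pose C : R := `|ln c| + e / 2 + 4.
have C0 : 0 <= C by rewrite /C; have := normr_ge0 (ln c); lra.
have [K HK] := ln_mul_le C0 ed0.
exists (maxn K 1) => k t; rewrite geq_max => /andP[/HK hk k0] t0 hat.
have k1 : 0 < k%:R :> R by rewrite ltr0n.
have hC : C <= e * d / 4 * k%:R.
  by apply: le_trans hk; rewrite lerDl mulr_ge0 // ln_ge0 // ler1n.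
have dk0 : 0 <= d * k%:R by rewrite mulr_ge0 // ltW.
have /andP[n1 n2] := truncn_itv dk0; move: (Num.truncn _) n1 n2 => n n1 n2.
have nk : (n < k)%N by rewrite -(ltr_nat R) (le_lt_trans n1) // gtr_pMl.
pose p := (k - n)%N.
have p0 : (0 < p)%N by rewrite subn_gt0.
have pk : (p <= k)%N by rewrite leq_subr.
have kpn : (k - p)%N = n by rewrite subKn // ltnW.
have pn : (p + n)%N = k by rewrite subnK // ltnW.
set G := g (k%:R * a) in hat *.
have G0 : 0 < G by apply: g_gt0; exact: ka.
pose E := expR e; pose H := expR (e / 2).
have E0 : 0 < E by exact: expR_gt0.
have H0 : 0 < H by exact: expR_gt0.
have EH : E = H * H by rewrite /E /H -expRD; congr expR; field.
have H1 : 1 + e / 2 <= H := expR_ge1Dx _.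
have [tau tauE] : exists tau, tau = E^-1 * G by eexists.
have [sig sigE] : exists sig, sig = E * G by eexists.
have tau0 : 0 < tau by rewrite tauE mulr_gt0 // invr_gt0.
have sig0 : 0 < sig by rewrite sigE mulr_gt0.
have ts : tau <= sig.
  rewrite tauE sigE ler_wpM2r ?(ltW G0) // (@le_trans _ _ 1) //.
    by rewrite invf_le1 // EH; nra.
  by rewrite EH; nra.
pose q := (H ^+ n)^-1.
have q0 : 0 < q by rewrite invr_gt0 exprn_gt0.
have id1 (x y z : R) : 0 < x ->
    ((x * x)^-1 * y) ^+ n * z = (x ^+ n)^-1 * (z * (x^-1 * y) ^+ n).
  move=> x0; rewrite !exprMn !exprVn exprMn; have := exprn_gt0 n x0.
  by move: (x ^+ n) => xn xn0; field; rewrite gt_eqF.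
have id2 (x y z : R) : 0 < x ->
    (x ^+ n)^-1 * ((x * x * y) ^+ n * z) = z * (x * y) ^+ n.
  move=> x0; rewrite !exprMn; have := exprn_gt0 n x0.
  by move: (x ^+ n) => xn xn0; field; rewrite gt_eqF.
have B1 : tau ^+ n * P p <= q * P k.
  have h : P p * (H^-1 * G) ^+ n <= P k.
    have <- : P (p + n) = P k by rewrite pn.
    apply: P_step_ge; first by rewrite mulr_ge0 ?invr_ge0 ?(ltW H0) ?(ltW G0).
    move=> i pi; have i0 : 0 < i.+1%:R * a by exact: ka.
    apply: (@le_trans _ _ (p%:R / k%:R * G)); last first.
      have pa0 := ka p0.
      have pka : p%:R * a <= k%:R * a by rewrite ler_wpM2r ?(ltW a0) // ler_nat.
      have := g_ub pa0 pka.
      have -> : k%:R * a / (p%:R * a) = k%:R / p%:R.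
        by rewrite -mulf_div divff ?gt_eqF // mulr1.
      move=> /(ler_wpM2l (_ : 0 <= p%:R / k%:R)); rewrite divr_ge0 // => /(_ isT).
      have p1 : 0 < p%:R :> R by rewrite ltr0n.
      have pX (x y z : R) : 0 < x -> 0 < y -> x / y * (y / x * z) = z.
        by move=> x0 y0; field; rewrite !gt_eqF.
      rewrite (pX _ _ _ p1 k1).
      move=> /le_trans; apply; apply: g_le => //.
      by rewrite ler_wpM2r ?(ltW a0) // ler_nat ltnW.
    rewrite ler_wpM2r ?(ltW G0) //.
    have : 1 - d <= p%:R / k%:R.
      rewrite /p natrB ?(ltnW nk) // mulrBl divff ?gt_eqF // lerD2l lerN2.
      by rewrite ler_pdivrMr.
    apply: le_trans.
    have -> : 1 - d = (1 + e / 2)^-1.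
      by rewrite /d; field; lra.
    by rewrite lef_pV2 ?posrE //; lra.
  have -> : tau ^+ n * P p = q * (P p * (H^-1 * G) ^+ n).
    by rewrite tauE /q EH; exact: id1.
  by rewrite ler_wpM2l // ltW.
have B2 : P (k + n) <= q * (sig ^+ n * P k).
  have -> : q * (sig ^+ n * P k) = P k * (H * G) ^+ n.
    by rewrite sigE /q EH; exact: id2.
  apply: P_step_le => i ik.
  have kna : k%:R * a <= (k + n)%:R * a by rewrite ler_wpM2r ?(ltW a0) // ler_nat leq_addr.
  apply: (@le_trans _ _ (g ((k + n)%:R * a))).
    by apply: g_le; [exact: ka|rewrite ler_wpM2r ?(ltW a0) // ler_nat].
  apply: (le_trans (g_ub (ka k0) kna)); rewrite ler_wpM2r ?(ltW G0) //.
  have -> : (k + n)%:R * a / (k%:R * a) = 1 + n%:R / k%:R.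
    by rewrite -mulf_div divff ?gt_eqF // mulr1 natrD mulrDl divff ?gt_eqF.
  have nd : n%:R / k%:R <= d by rewrite ler_pdivrMr.
  have de : d <= e / 2.
    rewrite /d ler_wpM2l ?(ltW e0) // lef_pV2 ?posrE //; lra.
  lra.
have T0 : 0 <= tau / a by rewrite divr_ge0 // ltW.
have TS : tau / a <= sig / a by rewrite ler_wpM2r // invr_ge0 ltW.
have key := chain_moment_le cJ n p0 pk T0 TS.
have Jt : J 0%N (tau / a) <= J 0%N t.
  apply: (chain_le cJ) => //.
  by rewrite ler_pdivlMr // mulrC (le_trans hat) // tauE /E expRN.
set m := J 0%N (tau / a) in key Jt.
have Mk2 : 4 * q <= M k.
  apply: le_trans (Hc k).
  have -> : q = expR (- (n%:R * (e / 2))) by rewrite expRN expRM_natl.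
  have L4 : 4 = expR (ln 4) :> R by rewrite lnK // posrE.
  rewrite {1}L4.
  rewrite -[c](lnK c0) -!expRD ler_expR.
  have ln4 : ln 4 <= 4 :> R by rewrite ltW // ln_sublinear.
  have := ler_norm (- ln c); rewrite normrN => lnc.
  have e1 : e / 2 * (d * k%:R) <= e / 2 * n%:R + e / 2.
    have : d * k%:R <= n%:R + 1 by rewrite natr1 ltW.
    move=> /(ler_wpM2l (_ : 0 <= e / 2)); rewrite divr_ge0 ?(ltW e0) // => /(_ isT).
    by rewrite mulrDr mulr1.
  move: hC e1; rewrite /C; lra.
have key2 : M k * P k <= q * P k + m * sig ^+ k + q * P k.
  have ak : 0 < a ^+ (k + n) by rewrite exprn_gt0.
  have sn : 0 < sig ^+ n by rewrite exprn_gt0.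
  rewrite -(ler_pM2l sn).
  have e1 : sig ^+ n * (M k * P k) = a ^+ (k + n) * ((sig / a) ^+ n * (k`!%:R * J k 0)).
    rewrite -factJ exprD expr_div_n; have := exprn_gt0 n a0.
    by move: (a ^+ n) => an an0; field; rewrite gt_eqF.
  have e2 : a ^+ (k + n) * ((k + n)`!%:R * J (k + n)%N 0) = M (k + n)%N * P (k + n) by exact: factJ.
  have e3 : a ^+ (k + n) * ((sig / a) ^+ n *
      ((tau / a) ^+ (k - p) * (p`!%:R * J p 0) + m * (sig / a) ^+ k)) =
      sig ^+ n * (tau ^+ n * (M p * P p) + m * sig ^+ k).
    rewrite -factJ kpn !expr_div_n; have an := exprn_gt0 n a0.
    have -> : a ^+ (k + n) = a ^+ p * a ^+ n * a ^+ n by rewrite -!exprD pn.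
    have -> : a ^+ k = a ^+ p * a ^+ n by rewrite -exprD pn.
    have := exprn_gt0 p a0; move: (a ^+ n) (a ^+ p) an => an ap an0 ap0.
    by field; rewrite !gt_eqF.
  rewrite e1; apply: (le_trans (ler_wpM2l (ltW ak) key)).
  rewrite mulrDr e2 e3.
  have h1 : tau ^+ n * (M p * P p) <= q * P k.
    apply: le_trans B1; rewrite mulrCA ler_piMl // mulr_ge0 ?exprn_ge0 ?(ltW tau0) //.
    exact: ltW.
  have h2 : M (k + n)%N * P (k + n) <= q * (sig ^+ n * P k).
    by apply: le_trans B2; rewrite ler_piMl // ltW.
  have h3 := ler_wpM2l (ltW sn) h1; lra.
apply: le_trans Jt.
have sk : 0 < sig ^+ k by rewrite exprn_gt0.
(* Of the loss [3 e k], one [e k] cancels the factor [exp (e k)] of [sig^k]; the remaining [2 e k]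
   covers [q]. *)
rewrite -(ler_pM2r sk).
have Pk := P_gt0 k.
have key3 : 2 * q * P k <= m * sig ^+ k.
  have := ler_wpM2r (ltW Pk) Mk2; lra.
apply: le_trans key3.
rewrite P_log // -/G sigE [(E * G) ^+ k]exprMn.
have -> : expR (- log_sum phi a k - 3 * e * k%:R) * (E ^+ k * G ^+ k) =
    expR (- log_sum phi a k) * G ^+ k * expR (- (2 * e * k%:R)).
  rewrite /E -expRM_natl !expRD.
  have X : expR (- (3 * e * k%:R)) * expR (k%:R * e) = expR (- (2 * e * k%:R)).
    by rewrite -expRD; congr expR; ring.
  by rewrite -X -!mulrA; congr (_ * _); rewrite mulrA mulrC.
have -> : 2 * q * (G ^+ k * expR (- log_sum phi a k)) =
   expR (- log_sum phi a k) * G ^+ k * (2 * q) by ring.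
rewrite ler_wpM2l ?mulr_ge0 ?expR_ge0 ?exprn_ge0 ?(ltW G0) //.
apply: (@le_trans _ _ q); last by have := ltW q0; lra.
have -> : q = expR (- (n%:R * (e / 2))) by rewrite expRN expRM_natl.
rewrite ler_expR lerN2.
have : e / 2 * n%:R <= e / 2 * k%:R.
  by rewrite ler_wpM2l ?divr_ge0 ?(ltW e0) // ler_nat ltnW.
have := mulr_gt0 e0 k1; lra.
Qed.

(** The upper bound on the mass uses [n = floor (x / a)], for which [g (n a) <= a t]. The lower
    bound needs the margin [exp (- d)], obtained at an index just above [q x / a] with [q] slightly
    larger than 1. *)
Lemma chain_mass_log (e : R) : 0 < e -> exists X : R, forall x t : R,
  X <= x -> a * t = g x ->
  [/\ 0 < x, 0 < J 0%N t & (l - e) * (x / a) <= - ln (J 0%N t) <= (l + e) * (x / a)].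
Proof.
move=> e0; have /andP[be0 be1] := hbeta.
have l0 : 0 < l by rewrite subr_gt0.
have l1 : l <= 1 by rewrite /l gerBl.
have cl0 : 0 < 18 + 40 / l by rewrite addr_gt0 // divr_gt0.
(* The constant comes from [(l + 5 d) (1 + 4 d / l) <= l + 9 d + 20 d / l], valid for [d <= 1],
   where the right side must be at most [l + e / 2]. *)
pose d := Num.min (Num.min 1 (l / 4)) (e / (18 + 40 / l)).
have d0 : 0 < d by rewrite !lt_min ltr01 !divr_gt0.
have d1 : d <= 1 by rewrite !ge_min lexx.
have dl : d <= l / 4 by rewrite !ge_min lexx orbT.
have de : d * (18 + 40 / l) <= e by rewrite -ler_pdivlMr // ge_min lexx orbT.
(* Then [q = exp y] satisfies [q^l = exp (2 d) > exp d], so [g (q x)] eventually exceeds [exp d]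
   times [g x]. *)
pose y := 2 * d / l.
have y0 : 0 < y by rewrite !divr_gt0 // mulr_gt0.
have yl : y * l = 2 * d by rewrite /y divfK // gt_eqF.
have y12 : y <= 2^-1 by rewrite /y ler_pdivrMr //; lra.
pose q := expR y.
have q0 : 0 < q := expR_gt0 _.
have q1 : 1 <= q by have := expR_ge1Dx y; rewrite -/q; lra.
have q2 : q <= 1 + 2 * y.
  have h := expR_ge1Dx (- y).
  have : q <= (1 - y)^-1.
    by rewrite /q -[y]opprK expRN lef_pV2 ?posrE ?expR_gt0 ?opprK //; lra.
  move=> /le_trans; apply.
  rewrite -[leRHS]mul1r -ler_pdivrMr ?mul1r; last by lra.
  by rewrite -invfM invf_le1; [nra|nra].
have qlim : g (q * x) / g x @[x --> +oo] --> q `^ l.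
  by apply: g_scale.
have ql : q `^ l = expR (2 * d) by rewrite /q -expRM yl.
have : expR d < q `^ l by rewrite ql ltr_expR; lra.
move=> /(cvgr_gt _ qlim) [X1 [_ HX1]].
have [K1 HK1] := log_sum_itv a0 hbeta phi_gt0 phi_le phi_conv phi_scale d0.
have [K2 HK2] := chain_mass_ge d0.
pose c := l + 5 * d.
have c0 : 0 < c by rewrite /c; lra.
have cq : c * q <= l + e / 2.
  have h1 : c * q <= c * (1 + 2 * y) by rewrite ler_wpM2l // ltW.
  have h2 : c * (1 + 2 * y) = l + 9 * d + d * (20 * (d / l)).
    by rewrite /c /y; field; rewrite gt_eqF.
  have h3 : d * (20 * (d / l)) <= d * (20 * (1 / l)).
    by rewrite ler_wpM2l ?(ltW d0) // ler_wpM2l // ler_wpM2r // invr_ge0 ltW.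
  move: de; rewrite mulrDr; have -> : 40 / l = 2 * (20 * (1 / l)) by field; rewrite gt_eqF.
  by lra.
(* The last two bounds make the rounding errors [1] and [c] at most [e / 2] times [x / a]; the
   others put [x] in the range of the asymptotic statements. *)
pose X := Num.max (Num.max (X1 + 1) 1)
  (Num.max (a * (maxn K1 (maxn K2 1)).+1%:R) (Num.max (2 * a / e) (2 * a * (c / e)))).
exists X => x t; rewrite /X !ge_max => /andP[/andP[xX1 x1] /andP[xK /andP[xe xc]]] hat.
have x0 : 0 < x by lra.
have xa0 : 0 < x / a by rewrite divr_gt0.
have gx0 := g_gt0 x0.
have t0 : 0 < t by rewrite -(pmulr_rgt0 _ a0) hat.
have Kx : (maxn K1 (maxn K2 1)).+1%:R <= x / a by rewrite ler_pdivlMr // mulrC.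
have /andP[n1 n2] := truncn_itv (ltW xa0); move: (Num.truncn _) n1 n2 => n n1 n2.
have nK : (maxn K1 (maxn K2 1) <= n)%N.
  by rewrite -ltnS -(ltr_nat R) (le_lt_trans _ n2) // (le_trans _ Kx) // ler_nat.
have nn0 : (0 < n)%N by move: nK; rewrite !geq_max => /andP[_ /andP[]].
have up : J 0%N t <= expR (- log_sum phi a n).
  apply: chain_mass_le => //; rewrite hat; apply: g_le; first exact: ka.
  by rewrite -ler_pdivlMr.
have /andP[s1 _] : (l - d) * n%:R <= log_sum phi a n <= (l + d) * n%:R.
  by apply: HK1; move: nK; rewrite geq_max => /andP[].
have qxa0 : 0 <= q * (x / a) by rewrite mulr_ge0 // ltW.
have /andP[k1 k2] := truncn_itv qxa0; move: (Num.truncn _) k1 k2 => k' k1 k2.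
pose k := k'.+1.
have nk : (n <= k)%N.
  rewrite ltnW // /k -(ltr_nat R) (le_lt_trans n1) //; apply: le_lt_trans k2.
  by rewrite ler_peMl // ltW.
have kK : (maxn K1 (maxn K2 1) <= k)%N := leq_trans nK nk.
have lo : expR (- log_sum phi a k - 3 * d * k%:R) <= J 0%N t.
  apply: HK2; [by move: kK; rewrite !geq_max => /and3P[]|exact: ltW|].
  have xX : X1 < x by lra.
  have := HX1 x xX; rewrite ltr_pdivlMr // => /ltW h.
  rewrite hat expRN ler_pdivlMl ?expR_gt0 //.
  apply: (le_trans h); apply: g_le; first exact: mulr_gt0.
  by rewrite -ler_pdivrMr // -mulrA ltW.
have /andP[_ s2] : (l - d) * k%:R <= log_sum phi a k <= (l + d) * k%:R.
  by apply: HK1; move: kK; rewrite geq_max => /andP[].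
have J0 : 0 < J 0%N t by apply: lt_le_trans lo; exact: expR_gt0.
split => //; apply/andP; split.
- have : ln (J 0%N t) <= - log_sum phi a n.
    by rewrite -(expRK (- _)) ler_ln ?posrE ?expR_gt0.
  have h1 : (l - d) * (x / a - 1) <= (l - d) * n%:R.
    by apply: ler_wpM2l; [lra|rewrite lerBlDr natr1 ltW].
  have h2 : 1 <= e / 2 * (x / a).
    move: xe; rewrite ler_pdivrMr // => h.
    have -> : e / 2 * (x / a) = x * e / (2 * a) by field; rewrite gt_eqF.
    by rewrite ler_pdivlMr ?mulr_gt0 // mul1r.
  have h3 : (l - d) * 1 <= 1 by lra.
  have h4 : d * (x / a) <= e / 2 * (x / a).
    rewrite ler_wpM2r ?(ltW xa0) //.
    have : d * 18 <= d * (18 + 40 / l).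
      by rewrite ler_wpM2l ?(ltW d0) // lerDl divr_ge0 // ltW.
    by lra.
  lra.
- have : - log_sum phi a k - 3 * d * k%:R <= ln (J 0%N t).
    by rewrite -(expRK (_ - _)) ler_ln ?posrE ?expR_gt0.
  have h1 : c * k%:R <= c * (q * (x / a) + 1).
    by rewrite ler_wpM2l ?(ltW c0) // /k -natr1 lerD2r.
  have h2 : c * q * (x / a) <= (l + e / 2) * (x / a) by rewrite ler_wpM2r // ltW.
  have h3 : c <= e / 2 * (x / a).
    have -> : e / 2 * (x / a) = e * x / (2 * a) by field; rewrite gt_eqF.
    rewrite ler_pdivlMr ?mulr_gt0 //.
    have := ler_wpM2l (ltW e0) xc; congr (_ <= _); by field; rewrite gt_eqF.
  have hk : 0 <= d * k%:R by rewrite mulr_ge0 // ltW.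
  have e1 : c * k%:R = (l + d) * k%:R + 3 * d * k%:R + d * k%:R by rewrite /c; ring.
  lra.
Qed.

End Asymptotics.

(** * Inverting x / phi(x) *)

Lemma cvgr_scale_pinfty (R : realType) (c : R) : 0 < c -> c * t @[t --> +oo] --> +oo.
Proof.
move=> c0; apply/cvgryPge => A; exists (A / c); split; first exact: num_real.
by move=> t /ltW; rewrite ler_pdivrMr // mulrC.
Qed.

Section LogMass.
Context (R : realType) (phi : R -> R) (beta a : R) (N : R -> R).
Hypothesis a0 : 0 < a.
Hypothesis hbeta : 0 <= beta < 1.
Hypothesis phi_gt0 : forall x : R, 0 < x -> 0 < phi x.
Hypothesis phi_le : forall x y : R, 0 < x -> x <= y -> phi x <= phi y.
Hypothesis phi_conv : forall x y : R, 0 < x -> x <= y -> x * phi y <= y * phi x.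
Hypothesis phi_scale : forall c : R, 0 < c ->
  phi (c * x) / phi x @[x --> +oo] --> c `^ beta.

Let g (x : R) : R := x / phi x.
Let l : R := 1 - beta.
Let g_gt0 (x : R) : 0 < x -> 0 < g x. Proof. exact: g_gt0. Qed.
Let g_le (x y : R) : 0 < x -> x <= y -> g x <= g y. Proof. exact: g_le. Qed.
Let g_ub (x y : R) : 0 < x -> x <= y -> g y <= y / x * g x. Proof. exact: g_ub. Qed.

(** [g] is unbounded since far out [g (expR 1 * x) >= (1 + l / 2) g x], and continuous because
    [g_le] and [g_ub] pinch it; the intermediate value theorem applies. *)
Lemma g_surj (X s : R) : 0 < X -> g X <= s -> exists2 x, X <= x & g x = s.
Proof.
move=> X0 gs; have /andP[be0 be1] := hbeta.
have l0 : 0 < l by rewrite subr_gt0.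
have qlim : g (expR 1 * x) / g x @[x --> +oo] --> expR 1 `^ l.
  by apply: g_scale => //; exact: expR_gt0.
have ql : 1 + l <= expR 1 `^ l by rewrite -expRM mul1r expR_ge1Dx.
have r1 : 1 + l / 2 < expR 1 `^ l by apply: lt_le_trans ql; lra.
move: r1 => /(cvgr_gt _ qlim) [X1 [_ HX1]].
pose x0 := Num.max X (X1 + 1).
have x0X : X <= x0 by rewrite /x0 le_max lexx.
have x00 : 0 < x0 := lt_le_trans X0 x0X.
have grow n : g x0 * (1 + n%:R * (l / 2)) <= g (expR n%:R * x0).
  elim: n => [|n IH]; first by rewrite mul0r addr0 mulr1 expR0 mul1r.
  pose y := expR n%:R * x0.
  have y0 : 0 < y by rewrite mulr_gt0 // expR_gt0.
  have yx : X1 < y.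
    apply: (@lt_le_trans _ _ x0); first by rewrite /x0 lt_max ltrDl ltr01 orbT.
    by rewrite ler_peMl ?(ltW x00) // -expR0 ler_expR.
  have := HX1 y yx; rewrite ltr_pdivlMr ?g_gt0 // => h.
  have -> : expR n.+1%:R * x0 = expR 1 * y by rewrite -nat1r expRD mulrA.
  apply: le_trans (ltW h); have gx0 := g_gt0 x00.
  apply: (@le_trans _ _ ((1 + l / 2) * (g x0 * (1 + n%:R * (l / 2))))).
    have : 0 <= g x0 * (n%:R * (l / 2) * (l / 2)).
      have l20 : 0 <= l / 2 by rewrite divr_ge0 // ltW.
      by rewrite mulr_ge0 ?(ltW gx0) // mulr_ge0 // mulr_ge0.
    rewrite -natr1; lra.
  by rewrite ler_wpM2l // addr_ge0 // divr_ge0 // ltW.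
have gx0 := g_gt0 x00.
pose n := (Num.truncn (`|s| / (g x0 * (l / 2)))).+1.
pose Y := expR n%:R * x0.
have gl0 : 0 < g x0 * (l / 2) by rewrite mulr_gt0 // divr_gt0.
have sY : s <= g Y.
  apply: le_trans (grow n).
  have : `|s| / (g x0 * (l / 2)) < n%:R by exact: truncnS_gt.
  rewrite ltr_pdivrMr // => h; have := ler_norm s; nra.
have XY : X <= Y.
  by rewrite (le_trans x0X) // ler_peMl ?(ltW x00) // -expR0 ler_expR.
have gc : {within `[X, Y], continuous g}.
  apply: continuous_in_subspaceT => x /set_mem; rewrite /= in_itv /= => /andP[Xx _].
  have xp : 0 < x := lt_le_trans X0 Xx.
  have gx := g_gt0 xp.
  apply/cvgrPdist_le => e e0; near=> y.
  have y0 : 0 < y by near: y; exact: lt_nbhsr.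
  have hy : g x * `|x - y| <= e * x.
    rewrite mulrC -ler_pdivlMr //; near: y; apply: cvgr_dist_le => //.
    by rewrite divr_gt0 // mulr_gt0.
  have [xy|/ltW yx] := leP x y.
    have h1 := g_le xp xy; have := g_ub xp xy.
    rewrite mulrAC ler_pdivlMr // => h2.
    move: hy; rewrite ler0_norm ?subr_le0 // => hy.
    rewrite ler0_norm ?subr_le0 // -(ler_pM2r xp); lra.
  have h1 := g_le y0 yx; have := g_ub y0 yx.
  rewrite mulrAC ler_pdivlMr // => h2.
  move: hy; rewrite ger0_norm ?subr_ge0 // => hy.
  rewrite ger0_norm ?subr_ge0 // -(ler_pM2r xp).
  have : g x * y <= g y * x by lra.
  lra.
have [|x] := @IVT _ g X Y s XY gc.
  by rewrite ge_min le_max gs sY orbT.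
by rewrite in_itv /= => /andP[Xx _] gxs; exists x.
Unshelve. all: by end_near. Qed.

(** A right inverse is constructed because the regular variation of the logarithm of the mass is
    asserted without any given [varphi]. *)
Lemma g_inverse : exists x : R -> R,
  [/\ forall t : R, g 1 <= a * t -> 1 <= x t /\ g (x t) = a * t & x t @[t --> +oo] --> +oo].
Proof.
have /choice [x Hx] : forall t, exists x, g 1 <= a * t -> 1 <= x /\ g x = a * t.
  move=> t; have [h|h] := pselect (g 1 <= a * t); last by exists 0.
  by have [y y1 gy] := g_surj ltr01 h; exists y.
exists x; split => //; apply/cvgryPge => Y.
pose Y1 := Num.max Y 1.
have Y10 : 0 < Y1 by rewrite lt_max ltr01 orbT.
near=> t.
have h1 : g 1 <= a * t.
  by rewrite mulrC -ler_pdivrMr //; near: t; apply: nbhs_pinfty_ge; exact: num_real.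
have h2 : g Y1 < a * t.
  by rewrite mulrC -ltr_pdivrMr //; near: t; apply: nbhs_pinfty_gt; exact: num_real.
have [x1 gx] := Hx t h1.
apply: (@le_trans _ _ Y1); first by rewrite le_max lexx.
rewrite leNgt; apply/negP => xY; move: h2; rewrite -gx ltNge g_le //.
  exact: lt_le_trans x1.
exact: ltW.
Unshelve. all: by end_near. Qed.

Section Inverse.
Variable x : R -> R.
Hypothesis hx : forall t : R, g 1 <= a * t -> 1 <= x t /\ g (x t) = a * t.
Hypothesis N_log : forall e : R, 0 < e -> exists X : R, forall x t : R,
  X <= x -> a * t = g x ->
  [/\ 0 < x, 0 < N t & (l - e) * (x / a) <= - ln (N t) <= (l + e) * (x / a)].
Hypothesis x_y : x t @[t --> +oo] --> +oo.

Let near_hx : \forall t \near +oo, 1 <= x t /\ g (x t) = a * t.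
Proof.
near=> t; apply: hx.
by rewrite mulrC -ler_pdivrMr //; near: t; apply: nbhs_pinfty_ge; exact: num_real.
Unshelve. all: by end_near. Qed.

Let near_x (X : R) : \forall t \near +oo, X <= x t.
Proof. by move/cvgryPge : x_y => /(_ X). Qed.

Lemma log_mass_cvg : (- ln (N t)) / x t @[t --> +oo] --> l / a.
Proof.
apply/cvgrPdist_le => e e0.
have ea0 : 0 < e * a by rewrite mulr_gt0.
have [X HX] := N_log ea0.
near=> t.
have [x1 gx] : 1 <= x t /\ g (x t) = a * t by near: t; exact: near_hx.
have Xx : X <= x t by near: t; exact: near_x.
have [x0 _ /andP[h1 h2]] := HX (x t) t Xx (esym gx).
rewrite distrC ler_distl; apply/andP; split.
  rewrite ler_pdivlMr //; apply: le_trans h1; rewrite le_eqVlt; apply/orP; left.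
  by apply/eqP; field; rewrite gt_eqF.
rewrite ler_pdivrMr //; apply: (le_trans h2); rewrite le_eqVlt; apply/orP; left.
by apply/eqP; field; rewrite gt_eqF.
Unshelve. all: by end_near. Qed.

Lemma log_mass_gt0 : \forall t \near +oo, 0 < N t /\ 0 < - ln (N t).
Proof.
have /andP[be0 be1] := hbeta.
have l0 : 0 < l by rewrite subr_gt0.
have l20 : 0 < l / 2 by rewrite divr_gt0.
have [X HX] := N_log l20.
near=> t.
have [x1 gx] : 1 <= x t /\ g (x t) = a * t by near: t; exact: near_hx.
have Xx : X <= x t by near: t; exact: near_x.
have [x0 J0 /andP[h1 _]] := HX (x t) t Xx (esym gx); split => //.
apply: lt_le_trans h1; rewrite mulr_gt0 ?divr_gt0 //; lra.
Unshelve. all: by end_near. Qed.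

(** Inverts regular variation: with [w = c^(1/l)], the values [g ((w - e') x)] and [g ((w + e') x)]
    are eventually separated by [c g x], and monotonicity of [g] transfers this to the arguments. *)
Lemma g_inverse_scale (c : R) : 0 < c -> x (c * t) / x t @[t --> +oo] --> c `^ l^-1.
Proof.
move=> c0; have /andP[be0 be1] := hbeta.
have l0 : 0 < l by rewrite subr_gt0.
set w := c `^ l^-1; have w0 : 0 < w by rewrite powR_gt0.
have wl : w `^ l = c by rewrite /w -powRrM mulVf ?gt_eqF // powRr1 // ltW.
have cty := cvgr_scale_pinfty c0.
have ghx (u : R) : 0 < u -> \forall t \near +oo, `|u `^ l - g (u * x t) / g (x t)| < `|u `^ l - c| \/ u = w.
  move=> u0; have [->|uw] := eqVneq u w; first by near=> t; right.
  have d0 : 0 < `|u `^ l - c|.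
    rewrite normr_gt0 subr_eq0; apply: contra_neq uw => ulc.
    by rewrite /w -ulc -powRrM divff ?gt_eqF // powRr1 // ltW.
  have h : g (u * x t) / g (x t) @[t --> +oo] --> u `^ l.
    have gs : g (u * y) / g y @[y --> +oo] --> u `^ l by apply: g_scale.
    exact: (cvg_comp _ _ x_y gs).
  move/cvgrPdist_lt : h => /(_ _ d0); apply: filterS => t; by left.
apply/cvgrPdist_le => e e0.
pose e' := Num.min e (w / 2).
have e'0 : 0 < e' by rewrite lt_min e0 divr_gt0.
have e'e : e' <= e by rewrite ge_min lexx.
have e'w : e' <= w / 2 by rewrite ge_min lexx orbT.
have u10 : 0 < w - e' by lra.
have u20 : 0 < w + e' by lra.
have P1 : (w - e') `^ l < c by rewrite -wl gt0_ltr_powR ?nnegrE //; lra.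
have P2 : c < (w + e') `^ l by rewrite -[X in X < _]wl gt0_ltr_powR ?nnegrE //; lra.
near=> t.
have [x1 gx] : 1 <= x t /\ g (x t) = a * t by near: t; exact: near_hx.
have [y1 gy] : 1 <= x (c * t) /\ g (x (c * t)) = a * (c * t).
  by near: t; exact: (cty _ near_hx).
have x0 : 0 < x t by lra.
have y0 : 0 < x (c * t) by lra.
have gx0 := g_gt0 x0.
have gyE : g (x (c * t)) = c * g (x t) by rewrite gy gx; ring.
have Q1 : g ((w - e') * x t) < g (x (c * t)).
  rewrite gyE -ltr_pdivrMr //.
  have [|h] : `|(w - e') `^ l - g ((w - e') * x t) / g (x t)| < `|(w - e') `^ l - c| \/ w - e' = w.
  - by near: t; exact: ghx.
  - rewrite [X in _ < X]distrC (gtr0_norm (_ : 0 < c - _)) ?subr_gt0 //.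
    by rewrite ltr_norml => /andP[]; lra.
  - by lra.
have Q2 : g (x (c * t)) < g ((w + e') * x t).
  rewrite gyE -ltr_pdivlMr //.
  have [|h] : `|(w + e') `^ l - g ((w + e') * x t) / g (x t)| < `|(w + e') `^ l - c| \/ w + e' = w.
  - by near: t; exact: ghx.
  - rewrite (gtr0_norm (_ : 0 < _ - c)) ?subr_gt0 //.
    by rewrite ltr_norml => /andP[]; lra.
  - by lra.
have R1 : (w - e') * x t <= x (c * t).
  by rewrite leNgt; apply/negP => /ltW /(g_le y0); rewrite leNgt Q1.
have R2 : x (c * t) <= (w + e') * x t.
  rewrite leNgt; apply/negP => /ltW /(g_le (mulr_gt0 u20 x0)).
  by rewrite leNgt Q2.
rewrite distrC ler_distl ler_pdivlMr // ler_pdivrMr //.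
by apply/andP; split; [apply: le_trans R1|apply: (le_trans R2)]; rewrite ler_wpM2r ?(ltW x0) //; lra.
Unshelve. all: by end_near. Qed.

Lemma log_mass_scale (c : R) : 0 < c ->
  (- ln (N (c * t))) / (- ln (N t)) @[t --> +oo] --> c `^ l^-1.
Proof.
move=> c0; have /andP[be0 be1] := hbeta.
have l0 : 0 < l by rewrite subr_gt0.
have la0 : l / a != 0 by rewrite gt_eqF // divr_gt0.
have cty := cvgr_scale_pinfty c0.
have h1 := log_mass_cvg.
have h2 : (- ln (N (c * t))) / x (c * t) @[t --> +oo] --> l / a.
  exact: (cvg_comp _ _ cty h1).
have h3 := g_inverse_scale c0.
have -> : c `^ l^-1 = l / a * c `^ l^-1 * (l / a)^-1 by rewrite mulrC mulKf.
apply: cvg_trans (cvgM (cvgM h2 h3) (cvgV la0 h1)); apply: near_eq_cvg; near=> t.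
have [J0 L0] : 0 < N t /\ 0 < - ln (N t) by near: t; exact: log_mass_gt0.
have [x1 _] : 1 <= x t /\ g (x t) = a * t by near: t; exact: near_hx.
have [y1 _] : 1 <= x (c * t) /\ g (x (c * t)) = a * (c * t).
  by near: t; exact: (cty _ near_hx).
have x0 : 0 < x t by lra.
have y0 : 0 < x (c * t) by lra.
rewrite /= ; move: (ln (N (c * t))) (- ln (N t)) (x t) (x (c * t)) L0 x0 y0.
by move=> A L' X Y L0 X0 Y0; field; rewrite !gt_eqF.
Unshelve. all: by end_near. Qed.

End Inverse.

End LogMass.

(** * Exponential decay and conclusion *)

(* One step of length [d] multiplies [N] by at most [(1 + r d)^-1], which is at
   most [expR (- lam * d)] for the [d] chosen below. *)
Lemma exp_decay (R : realType) (N : R -> R) (r lam : R) : 0 <= lam -> lam < r ->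
  (forall t, 0 <= t -> 0 <= N t) ->
  (forall T t, 0 <= T -> T <= t -> (t - T) * (r * N t) <= N T - N t) ->
  exists C : R, forall t, 0 <= t -> N t <= C * expR (- lam * t).
Proof.
move=> lam0 lr N0 NN; have r0 : 0 < r := le_lt_trans lam0 lr.
have lr0 : 0 < lam * r + 1 by rewrite ltr_wpDl // mulr_ge0 // ltW.
(* This [d] gives [(1 + r d) (1 - lam d) = 1 + d^2], whence [exp (lam d) <= 1 / (1 - lam d) <= 1 + r
   d]. *)
have [d dE] : exists d, d = (r - lam) / (lam * r + 1) by eexists.
have d0 : 0 < d by rewrite dE divr_gt0 // subr_gt0.
have dE' : d * (lam * r + 1) = r - lam by rewrite dE divfK // gt_eqF.
have Nle T t : 0 <= T -> T <= t -> N t <= N T.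
  move=> T0 Tt; rewrite -subr_ge0; apply: le_trans (NN T t T0 Tt).
  by rewrite mulr_ge0 ?subr_ge0 // mulr_ge0 ?(ltW r0) // N0 // (le_trans T0).
have ed : expR (lam * d) <= 1 + r * d.
  have h := expR_ge1Dx (- (lam * d)).
  have ld1 : 0 < 1 - lam * d by nra.
  rewrite -[lam * d]opprK expRN; apply: (@le_trans _ _ (1 - lam * d)^-1).
    by rewrite lef_pV2 ?posrE ?expR_gt0.
  rewrite -[leLHS]mul1r ler_pdivrMr //; nra.
have step T : 0 <= T -> N (T + d) <= expR (- (lam * d)) * N T.
  move=> T0; rewrite expRN ler_pdivlMl ?expR_gt0 //.
  have Td0 : 0 <= N (T + d) by apply: N0; rewrite addr_ge0 // ltW.
  apply: (le_trans (ler_wpM2r Td0 ed)).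
  have := NN T (T + d) T0; rewrite lerDl (ltW d0) => /(_ isT).
  have -> : T + d - T = d by ring.
  lra.
have iter n : N (n%:R * d) <= expR (- (lam * d)) ^+ n * N 0.
  elim: n => [|n IH]; first by rewrite mul0r expr0 mul1r.
  rewrite -natr1 mulrDl mul1r; apply: le_trans (step _ _) _.
    by rewrite mulr_ge0 // ltW.
  by rewrite exprS -mulrA ler_wpM2l // expR_ge0.
exists (N 0 * expR (lam * d)) => t t0.
have td0 : 0 <= t / d by rewrite divr_ge0 // ltW.
have /andP[] := truncn_itv td0; move: (Num.truncn _) => n.
rewrite ler_pdivlMr // ltr_pdivrMr // -natr1 mulrDl mul1r => n1 n2.
have nd0 : 0 <= n%:R * d by rewrite mulr_ge0 // ltW.
apply: (le_trans (Nle _ _ nd0 n1)); apply: (le_trans (iter n)).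
rewrite mulrC -mulrA -expRD -expRM_natl ler_wpM2l ?N0 // ler_expR.
nra.
Qed.

(** The hypothesis turns the chain bound into a differential inequality for [J k.+1] alone;
    [chain_pow_le] over a unit of time transfers the decay to [J 0]. Times before 1 are covered by
    the second constant. *)
Lemma chain_mass_decay (R : realType) (J : nat -> R -> R) (k : nat) (r lam : R) :
  chain J -> 0 <= lam -> lam < r ->
  (forall t, 0 <= t -> r * J k.+1 t <= J k t) ->
  exists C : R, forall t, 0 <= t -> J 0%N t <= C * expR (- lam * t).
Proof.
move=> cJ lam0 lr hr.
have [t t0|T t T0 Tt|C HC] := @exp_decay R (J k.+1) r lam lam0 lr.
- exact: chain_ge0.
- have /andP[h _] := chain_incr cJ k T0 Tt; apply: le_trans h.
  by rewrite ler_wpM2l ?subr_ge0 // hr // (le_trans T0).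
pose C1 := (k.+1)`!%:R * C * expR lam; pose C2 := J 0%N 0 * expR lam.
exists (Num.max C1 C2) => t t0.
have [t1|t1] := leP 1 t; last first.
  apply: (@le_trans _ _ (C2 * expR (- lam * t))); last first.
    by rewrite ler_wpM2r ?expR_ge0 // le_max lexx orbT.
  apply: (le_trans (chain_le cJ 0%N (lexx 0) t0)).
  rewrite /C2 -mulrA -expRD ler_peMr ?(chain_ge0 cJ) //.
  by rewrite -expR0 ler_expR; nra.
apply: (@le_trans _ _ (C1 * expR (- lam * t))); last first.
  by rewrite ler_wpM2r ?expR_ge0 // le_max lexx.
have s0 : 0 <= t - 1 by rewrite subr_ge0.
have st : t - 1 <= t by rewrite gerBl.
have := chain_pow_le cJ k.+1 s0 st.
have -> : t - (t - 1) = 1 by ring.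
rewrite expr1n mul1r => /le_trans; apply.
rewrite /C1 -!mulrA -expRD ler_wpM2l ?ler0n //.
apply: (le_trans (HC _ s0)); rewrite le_eqVlt; apply/orP; left; apply/eqP.
by congr (_ * expR _); ring.
Qed.

Lemma lt_frag_phi_infty (R : realType) (B : borel_measure R) (lam y : R) :
  (\int[B]_(y in `]0%R, 1%R[) (y * (1 - y))%:E < +oo)%E ->
  (lam%:E < frag_phi_infty B)%E -> exists2 x, y <= x & lam < frag_phi B x.
Proof.
move=> hBint hlam; apply: contrapT => H.
have phile x : y <= x -> frag_phi B x <= lam.
  by move=> yx; rewrite leNgt; apply/negP => h; apply: H; exists x.
(* Monotonicity of [frag_phi] is known on [[0, oo[]; the maximum with 0 makes [h] monotone on the
   whole line, so its limit is its supremum. *)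
pose h (x : R) : \bar R := (frag_phi B (Num.max x 0))%:E.
have hc : h x @[x --> +oo] --> ereal_sup (range h).
  apply: nondecreasing_cvge => u v uv; rewrite lee_fin frag_phi_le //.
    by rewrite le_max lexx orbT.
  by rewrite ge_max !le_max uv lexx orbT.
have hE : (frag_phi B x)%:E @[x --> +oo] --> ereal_sup (range h).
  apply: cvg_trans hc; apply: near_eq_cvg; near=> x.
  by rewrite /h max_l //; near: x; apply: nbhs_pinfty_ge; exact: num_real.
move: hlam; rewrite /frag_phi_infty (cvg_lim _ hE) // ltNge => /negP; apply.
apply: ub_ereal_sup => _ [x _ <-]; rewrite lee_fin.
apply: (@le_trans _ _ (frag_phi B (Num.max (Num.max x 0) y))).
  by apply: (frag_phi_le hBint); [rewrite le_max lexx orbT|rewrite le_max lexx].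
by apply: phile; rewrite le_max lexx orbT.
Unshelve. all: by end_near. Qed.

Section Proposition.
Context (R : realType) (alpha : R) (B mu0 : borel_measure R)
  (mu : R -> borel_measure R).
Hypothesis halpha : alpha < 0.
Hypothesis hBint : (\int[B]_(y in `]0%R, 1%R[) (y * (1 - y))%:E < +oo)%E.
Hypothesis hBpos : (0 < B `]0%R, 1%R[%classic)%E.
Hypothesis hmu0sup : support_sup mu0 1.
Hypothesis hmu : fragmentation_solution alpha B mu0 mu.
Local Notation phi := (frag_phi B).
Local Notation a := (- alpha).
Local Notation M := (frag_moment mu).

Let J (k : nat) (t : R) : R := M (k%:R * a) t / frag_prod alpha B k.

Let a0 : 0 < a. Proof. by rewrite oppr_gt0. Qed.

Let ka0 (k : nat) : 0 <= k%:R * a. Proof. by rewrite mulr_ge0 // ltW. Qed.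

Let cJ : chain J. Proof. exact: (frag_chain halpha hBint hmu0sup hmu hBpos). Qed.

Let J_mass (t : R) : 0 <= t -> J 0%N t = total_mass mu t.
Proof.
by move=> t0; rewrite /J /frag_prod big_ord0 divr1 mul0r (frag_moment_0 hmu0sup hmu).
Qed.

Lemma total_mass_decay (lambda : R) : (lambda%:E < frag_phi_infty B)%E ->
  exists C : R, forall t : R, 0 <= t -> total_mass mu t <= C * expR (- lambda * t).
Proof.
move=> hlam; have [x ax lx] := lt_frag_phi_infty a hBint hlam.
have x0 : 0 < x := lt_le_trans a0 ax.
pose k := Num.truncn (x / a).
have xk : x <= k.+1%:R * a.
  by rewrite -ler_pdivrMr // ltW //; exact: truncnS_gt.
pose r := phi (k.+1%:R * a).
have xr : phi x <= r by rewrite frag_phi_le // ltW.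
have r0 : 0 < r by apply: lt_le_trans xr; exact: frag_phi_gt0.
(* [lambda] may be negative, while [chain_mass_decay] takes a nonnegative rate. *)
have lr : Num.max lambda 0 < r by rewrite gt_max r0 andbT (lt_le_trans lx).
have l0 : 0 <= Num.max lambda 0 by rewrite le_max lexx orbT.
have [t t0|C HC] := chain_mass_decay (k := k) cJ l0 lr.
  (* Once [r] is cancelled in [frag_prod], this is the monotonicity of moments in the exponent. *)
  rewrite /J /frag_prod big_ord_recr /= -/(frag_prod alpha B k) -/r.
  have p0 : 0 < frag_prod alpha B k by exact: frag_prod_gt0.
  have -> (z : R) : r * (z / (frag_prod alpha B k * r)) = z / frag_prod alpha B k.
    by field; rewrite !gt_eqF.
  rewrite ler_wpM2r ?invr_ge0 ?(ltW p0) //.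
  apply: (frag_moment_exp_le hmu0sup hmu) => //.
  by rewrite ler_wpM2r ?(ltW a0) // ler_nat.
have C0 : 0 <= C.
  have := HC 0 (lexx _); rewrite mulr0 expR0 mulr1; apply: le_trans.
  exact: chain_ge0.
exists C => t t0; rewrite -J_mass //; apply: (le_trans (HC t t0)).
by rewrite ler_wpM2l // ler_expR ler_wpM2r // lerN2 le_max lexx.
Qed.

Section Regular.
Context (beta : R) (hbeta : 0 <= beta < 1).
Hypothesis hT : regularly_varying_at0 (size_tail B) (- beta).

Let phi_gt0 (x : R) : 0 < x -> 0 < phi x.
Proof. by move=> x0; exact: frag_phi_gt0. Qed.

Let phi_le (x y : R) : 0 < x -> x <= y -> phi x <= phi y.
Proof. by move=> x0 xy; rewrite frag_phi_le // ltW. Qed.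

Let phi_conv (x y : R) : 0 < x -> x <= y -> x * phi y <= y * phi x.
Proof. by move=> x0 xy; exact: frag_phi_conv_le. Qed.

Let phi_scale (c : R) : 0 < c -> phi (c * x) / phi x @[x --> +oo] --> c `^ beta.
Proof. by move=> c0; exact: frag_phi_scale_cvg. Qed.

Let M_ge (e : R) : 0 < e ->
  exists2 c : R, 0 < c & forall k : nat, c * expR (- e * k%:R) <= M (k%:R * a) 0.
Proof.
(* With this [d], [(1 - d)^(k a) = exp (- e k)]. *)
move=> e0; have d01 : 0 < 1 - expR (- (e / a)) < 1.
  have : expR (- (e / a)) < 1 by rewrite -expR0 ltr_expR oppr_lt0 divr_gt0.
  have := expR_gt0 (- (e / a)); lra.
have [c c0 Hc] := frag_moment0_ge hmu0sup hmu d01.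
exists c => // k; have := Hc _ (ka0 k).
rewrite opprB addrC subrK -expRM.
have -> // : - (e / a) * (k%:R * a) = - e * k%:R.
by rewrite mulrCA mulNr divfK ?gt_eqF // mulrC.
Qed.

Let N_log := chain_mass_log a0 hbeta phi_gt0 phi_le phi_conv phi_scale cJ
  (fun k => erefl : J k 0 = M (k%:R * a) 0 / \prod_(i < k) phi (i.+1%:R * a))
  (fun k => frag_moment_le1 hmu0sup hmu (ka0 k) (lexx 0)) M_ge.

(** Eventually [varphi (a t) = varphi (g (x t)) = x t] for [g x = x / phi x], so the claim is the
    convergence of [- ln m / x] to [(1 - beta) / a]. *)
Lemma log_total_mass_equiv (varphi : R -> R) :
  inverse_near_infty (fun t => t / phi t) varphi ->
  (fun t => - ln (total_mass mu t)) ~_(at_infty R)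
    (fun t => (1 - beta) / `|alpha| * varphi (`|alpha| * t)).
Proof.
move=> [hv _]; have aE : `|alpha| = a by rewrite ltr0_norm.
have /andP[be0 be1] := hbeta.
have l0 : 0 < 1 - beta by rewrite subr_gt0.
have [x [hx x_y]] := g_inverse a0 hbeta phi_gt0 phi_le phi_conv phi_scale.
have L := log_mass_cvg a0 hx N_log x_y.
have near_ge (b : R) : \forall t \near +oo, b <= t.
  by apply: nbhs_pinfty_ge; exact: num_real.
have near_x : \forall t \near +oo, 1 <= x t /\ varphi (a * t) = x t.
  near=> t; have [x1 gx] : 1 <= x t /\ x t / phi (x t) = a * t.
    by apply: hx; rewrite [a * t]mulrC -ler_pdivrMr //; near: t; exact: near_ge.
  split => //; have : varphi (x t / phi (x t)) = x t by near: t; exact: (x_y _ hv).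
  by rewrite gx.
apply/eqaddoP => e e0; rewrite aE.
have e10 : 0 < e * ((1 - beta) / a) by rewrite mulr_gt0 // divr_gt0.
near=> t.
have t0 : 0 <= t by near: t; apply: nbhs_pinfty_ge; exact: num_real.
have [x1 vx] : 1 <= x t /\ varphi (a * t) = x t by near: t.
have x0 : 0 < x t by lra.
have h : `|(1 - beta) / a - - ln (J 0%N t) / x t| <= e * ((1 - beta) / a).
  by near: t; move/cvgrPdist_le : L; apply.
change (`|- ln (total_mass mu t) - (1 - beta) / a * varphi (a * t)| <=
  e * `|(1 - beta) / a * varphi (a * t)|).
rewrite vx -(J_mass t0) (ger0_norm (_ : 0 <= _ * x t)); last first.
  by rewrite mulr_ge0 ?divr_ge0 // ltW.
move: h; rewrite distrC => /(ler_wpM2r (ltW x0)) h.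
have -> (y z : R) : y - z * x t = (y / x t - z) * x t.
  by rewrite mulrBl divfK // gt_eqF.
by rewrite normrM (gtr0_norm x0) mulrA.
Unshelve. all: by end_near. Qed.

Lemma log_total_mass_regularly_varying :
  regularly_varying_at_infty (fun t => - ln (total_mass mu t)) (1 - beta)^-1.
Proof.
have [x [hx x_y]] := g_inverse a0 hbeta phi_gt0 phi_le phi_conv phi_scale.
split.
  have [A [_ HA]] := log_mass_gt0 a0 hbeta hx N_log x_y.
  exists (Num.max A 0); split; last first.
    by move=> t; rewrite gt_max => /andP[At t0]; have [] := HA t At; rewrite J_mass // ltW.
  pose q (t : R) := J 0%N (Num.max t 0).
  have mq : measurable_fun setT q.
    apply: nonincreasing_measurable => // u v uv; apply: (chain_le cJ).
      by rewrite le_max lexx orbT.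
    by rewrite ge_max !le_max uv lexx orbT.
  apply: (eq_measurable_fun (fun t => - ln (q t))).
    move=> t /set_mem; rewrite /= in_itv /= andbT gt_max => /andP[_ t0].
    by rewrite /q max_l ?(ltW t0) // J_mass // ltW.
  apply: measurable_funTS; apply: measurableT_comp => //.
  by apply: measurableT_comp => //; exact: measurable_ln.
move=> c c0.
have H := log_mass_scale a0 hbeta phi_gt0 phi_conv phi_scale hx N_log x_y c0.
apply: cvg_trans H; apply: near_eq_cvg; near=> t.
have t0 : 0 <= t by near: t; apply: nbhs_pinfty_ge; exact: num_real.
by rewrite !J_mass // mulr_ge0 // ltW.
Unshelve. all: by end_near. Qed.

End Regular.
End Proposition.

Theorem proposition1p2 (R : realType) (alpha : R) (B mu0 : borel_measure R)
    (mu : R -> borel_measure R)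
    (halpha : alpha < 0)
    (hBon : measure_on `]0, 1[ B)
    (hBint : (\int[B]_(y in `]0%R, 1%R[) (y * (1 - y))%:E < +oo)%E)
    (hBpos : (0 < B `]0%R, 1%R[%classic)%E)
    (hmu0on : measure_on `]0, +oo[ mu0)
    (hmu0mass : (\int[mu0]_(x in `]0%R, +oo[) x%:E = 1)%E)
    (hmu0sup : support_sup mu0 1)
    (hmu : fragmentation_solution alpha B mu0 mu) :
  (forall lambda : R, (lambda%:E < frag_phi_infty B)%E ->
     exists C : R, forall t : R, 0 <= t ->
       total_mass mu t <= C * expR (- lambda * t)) /\
  (forall beta : R, 0 <= beta < 1 ->
     regularly_varying_at0 (size_tail B) (- beta) ->
     (forall varphi : R -> R,
        inverse_near_infty (fun t => t / frag_phi B t) varphi ->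
        (fun t => - ln (total_mass mu t)) ~_(at_infty R)
          (fun t => (1 - beta) / `|alpha| * varphi (`|alpha| * t))) /\
     regularly_varying_at_infty (fun t => - ln (total_mass mu t))
       (1 - beta)^-1).
Proof.
split; first exact: (total_mass_decay halpha hBint hBpos hmu0sup hmu).
move=> beta hbeta hT; split.
  exact: (log_total_mass_equiv halpha hBint hBpos hmu0sup hmu hbeta hT).
exact: (log_total_mass_regularly_varying halpha hBint hBpos hmu0sup hmu hbeta hT).
Qed.
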